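(* Let $n\ge1$, $\sigma\in[0,1)$, $s\ge0$ and $m\in[1,2]$. Assume $(|D|^2u_0,u_1,\theta_0)\in L^m(\mathbb{R}^n)\times L^m(\mathbb{R}^n)\times L^m(\mathbb{R}^n)$. Let $w^{(0)}$ be the solution of the system (S) and $\tilde w$ the solution of the reference system (R) given in the context. Then, for all $t\ge0$, $$\left\|\chi_{\mathrm{int}}(D)\mathcal{F}^{-1}_{\xi\to x}\left(w^{(0)}-T_0T_1T_{1\frac12}\tilde w\right)(t,\cdot)\right\|_{\dot H^s(\mathbb{R}^n)}\lesssim(1+t)^{-\frac{(2-m)n+2ms}{4m(2-\sigma)}-\frac{1-\sigma}{2-\sigma}}\left\|\left(|D|^2u_0,u_1,\theta_0\right)\right\|_{\left(L^m(\mathbb{R}^n)\right)^3}.$$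
   Context: System (S): $$w^{(0)}_t+\left(|\xi|^2A_0+|\xi|^{2\sigma}A_1\right)w^{(0)}=0,\quad t>0,\ \xi\in\mathbb{R}^n,\qquad w^{(0)}(0,\xi)=w^{(0)}_0(\xi):=\left(\hat u_1+|\xi|^2\hat u_0,\;\hat u_1-|\xi|^2\hat u_0,\;\hat\theta_0\right)^{\mathrm T},$$ $$A_0=\tfrac12\begin{pmatrix}0&-2&-2\\2&0&-2\\1&1&2\end{pmatrix},\qquad A_1=\tfrac12\begin{pmatrix}1&1&0\\1&1&0\\0&0&0\end{pmatrix}.$$ It is the Fourier transform in $x$ of the thermoelastic plate problem $u_{tt}+\Delta^2u+\Delta\theta+(-\Delta)^\sigma u_t=0$, $\theta_t-\Delta\theta-\Delta u_t=0$, $(u,u_t,\theta)(0,\cdot)=(u_0,u_1,\theta_0)$, with $w^{(0)}=(\hat u_t+|\xi|^2\hat u,\hat u_t-|\xi|^2\hat u,\hat\theta)^{\mathrm T}$. Matrices: $$T_0=\begin{pmatrix}-1&0&1\\1&0&1\\0&1&0\end{pmatrix},\quad T_1=I_3+|\xi|^{2-2\sigma}\begin{pmatrix}0&0&1\\0&0&1\\1&1&0\end{pmatrix},\quad T_{1\frac12}=I_3+|\xi|^{4-4\sigma}\begin{pmatrix}0&0&0\\0&0&1\\0&1&0\end{pmatrix}$$ (invertible for small $|\xi|$). Reference system (R): $$\tilde w_t+\mathrm{diag}\left(|\xi|^{4-2\sigma},|\xi|^2,|\xi|^{2\sigma}\right)\tilde w=0,\qquad\tilde w(0,\xi)=T_{1\frac12}^{-1}T_1^{-1}T_0^{-1}w^{(0)}_0(\xi).$$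 $\chi_{\mathrm{int}}\in\mathcal{C}^\infty(\mathbb{R}^n)$ is a cut-off function with values in $[0,1]$ supported in $\{|\xi|\le\varepsilon\}$, $0<\varepsilon\ll1$ fixed sufficiently small, equal to $1$ for $|\xi|\le\varepsilon/2$; $\chi_{\mathrm{int}}(D)$ is the Fourier multiplier with symbol $\chi_{\mathrm{int}}$. $|D|^s$ has symbol $|\xi|^s$ and $\|f\|_{\dot H^s}=\||D|^sf\|_{L^2}$. $f\lesssim g$ means $f\le Cg$ with a constant $C>0$ independent of $t$ and of the initial data. *)

(* Defs.v *)
From HB Require Import structures.
From mathcomp Require Import all_boot all_order all_algebra.
From mathcomp Require Import all_classical all_reals all_analysis.
From mathcomp Require Import complex.

Set Implicit Arguments.
Unset Strict Implicit.
Unset Printing Implicit Defensive.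

Import Order.TTheory GRing.Theory Num.Theory.
Import numFieldNormedType.Exports.

Local Open Scope classical_set_scope.
Local Open Scope ring_scope.
Local Open Scope complex_scope.

(* Lebesgue measure on R^n = 'rV[R]_n: the sigma-algebra is generated by the
   coordinates, and the measure is the iterated product, transported along
   R * R^n ~ R^(1 + n).  Dimension 0 carries the unit point mass. *)

Section measurable_rV.
Context (R : realType) (n : nat).

Definition rV_coor (i : 'I_n) (x : 'rV[R]_n) : measurableTypeR R := x 0 i.

Let rV_set0 : g_sigma_preimage rV_coor set0.
Proof. exact: sigma_algebra0. Qed.

Let rV_setC A : g_sigma_preimage rV_coor A -> g_sigma_preimage rV_coor (~` A).
Proof. exact: sigma_algebraC. Qed.

Let rV_bigcup (F : (set 'rV[R]_n)^nat) :
  (forall i, g_sigma_preimage rV_coor (F i)) ->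
  g_sigma_preimage rV_coor (\bigcup_i (F i)).
Proof. exact: sigma_algebra_bigcup. Qed.

HB.instance Definition _ := @isMeasurable.Build default_measure_display
  'rV[R]_n (g_sigma_preimage rV_coor) rV_set0 rV_setC rV_bigcup.

End measurable_rV.

Lemma measurable_rV_coor (R : realType) n (i : 'I_n) :
  measurable_fun [set: 'rV[R]_n] (@rV_coor R n i).
Proof.
move=> _ Y mY; rewrite setTI; apply: sub_sigma_algebra => /=.
rewrite -bigcup_seq/=; exists i => /=; first by rewrite mem_index_enum.
by exists Y => //; rewrite setTI.
Qed.

Lemma measurable_fun_rVP (R : realType) d (T : measurableType d) n
    (f : T -> 'rV[R]_n) :
  measurable_fun [set: T] f <->
  forall i, measurable_fun [set: T] (@rV_coor R n i \o f).
Proof.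
split=> [mf i|mf]; first exact: measurableT_comp (measurable_rV_coor i) mf.
move=> _ A; rewrite setTI => mA.
suff : g_sigma_preimage (fun i => @rV_coor R n i \o f) `<=` measurable.
  rewrite g_sigma_preimage_comp; apply; exists A => //; exact: setTI.
apply: smallest_sub; first exact: sigma_algebra_measurable.
move=> B; rewrite -bigcup_seq => -[i _ [C mC <-]].
exact: mf.
Qed.

Section lebesgue_rV.
Context (R : realType).

Definition rV_cons n (p : measurableTypeR R * 'rV[R]_n) : 'rV[R]_n.+1 :=
  row_mx (p.1 : R)%:M p.2.

Lemma rV_cons0 n p : @rV_cons n p 0 0 = p.1.
Proof.
have := row_mxEl (p.1 : R)%:M p.2 0 0; rewrite [RHS]mxE eqxx mulr1n => <-.
by congr (rV_cons p _ _); exact: val_inj.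
Qed.

Lemma rV_consS n p (i : 'I_n) : @rV_cons n p 0 (lift 0 i) = p.2 0 i.
Proof.
have <- := row_mxEr (p.1 : R)%:M p.2 0 i.
by congr (rV_cons p _ _); exact: val_inj.
Qed.

Lemma measurable_rV_cons n : measurable_fun setT (@rV_cons n).
Proof.
apply/measurable_fun_rVP => i; have [j ->|->] := unliftP 0 i.
  rewrite (_ : _ \o _ = rV_coor j \o snd).
    by apply: measurableT_comp (measurable_rV_coor j) _.
  by apply/funext => p; rewrite /= /rV_coor rV_consS.
rewrite (_ : _ \o _ = fst) //.
by apply/funext => p; rewrite /= /rV_coor rV_cons0.
Qed.

Section step.
Context (n : nat) (mu : {sigma_finite_measure set 'rV[R]_n -> \bar R}).

Definition lebesgue_rVS : set 'rV[R]_n.+1 -> \bar R :=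
  pushforward (lebesgue_measure \x mu)%E (@rV_cons n).

Let lebesgue_rVS0 : lebesgue_rVS set0 = 0%E.
Proof. by rewrite /lebesgue_rVS /pushforward preimage_set0 measure0. Qed.

Let lebesgue_rVS_ge0 A : (0 <= lebesgue_rVS A)%E.
Proof. by have mf := @measurable_rV_cons n; exact: measure_ge0. Qed.

Let lebesgue_rVS_sigma_additive : semi_sigma_additive lebesgue_rVS.
Proof.
have mf := @measurable_rV_cons n; exact: measure_semi_sigma_additive.
Qed.

HB.instance Definition _ := isMeasure.Build _ _ _ lebesgue_rVS
  lebesgue_rVS0 lebesgue_rVS_ge0 lebesgue_rVS_sigma_additive.

Let lebesgue_rVS_sigma_finite : sigma_finite setT lebesgue_rVS.
Proof.
have /sigma_finiteP[F [TF ndF Foo]] := sigma_finiteT (@lebesgue_measure R).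
have /sigma_finiteP[G [TG ndG Goo]] := sigma_finiteT mu.
pose tl (x : 'rV[R]_n.+1) : 'rV[R]_n := \row_j x 0 (lift 0 j).
have mtl : measurable_fun setT tl.
  apply/measurable_fun_rVP => i.
  rewrite (_ : _ \o _ = rV_coor (lift 0 i)); first exact: measurable_rV_coor.
  by apply/funext => x; rewrite /= /rV_coor mxE.
exists (fun k => (rV_coor ord0 @^-1` F k) `&` (tl @^-1` G k)).
  apply/esym/seteqP; split => // x _.
  have [j _ Fj] : (\bigcup_k F k) (rV_coor ord0 x) by rewrite -TF.
  have [k _ Gk] : (\bigcup_k G k) (tl x) by rewrite -TG.
  exists (maxn j k) => //; split.
    by have /subsetPset := ndF _ _ (leq_maxl j k); exact.
  by have /subsetPset := ndG _ _ (leq_maxr j k); exact.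
move=> k; have [mF Fk] := Foo k; have [mG Gk] := Goo k; split.
  apply: measurableI; rewrite -[X in measurable X]setTI.
    exact: measurable_rV_coor.
  exact: mtl.
rewrite /lebesgue_rVS /pushforward (_ : _ @^-1` _ = F k `*` G k).
  by rewrite product_measure1E// lte_mul_pinfty// ge0_fin_numE.
have tlE p : tl (rV_cons p) = p.2.
  by apply/rowP => j; rewrite mxE rV_consS.
by apply/seteqP; split => -[a v]; rewrite /= /rV_coor rV_cons0 tlE.
Qed.

HB.instance Definition _ := @Measure_isSigmaFinite.Build _ _ _
  lebesgue_rVS lebesgue_rVS_sigma_finite.

End step.

Fixpoint lebesgue_rV n : {sigma_finite_measure set 'rV[R]_n -> \bar R} :=
  match n with
  | 0 => \d_(0 : 'rV[R]_0)
  | n'.+1 => lebesgue_rVS (lebesgue_rV n')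
  end.

Lemma lebesgue_rV_box n (A : 'I_n -> set (measurableTypeR R)) :
  (forall i, measurable (A i)) ->
  lebesgue_rV n [set x | forall i, A i (x 0 i)] =
  (\prod_(i < n) lebesgue_measure (A i))%E.
Proof.
elim: n A => [|n IHn] A mA.
  rewrite big_ord0 /= diracE mem_set //; by case.
rewrite big_ord_recl /= /lebesgue_rVS /pushforward -IHn //.
rewrite -product_measure1E //; last first.
  rewrite [X in measurable X](_ : _ =
    \bigcap_(i in [set: 'I_n]) (@rV_coor R n i @^-1` A (lift ord0 i))).
    apply: fin_bigcap_measurable => // i _.
    by rewrite -[X in measurable X]setTI; exact: measurable_rV_coor.
  by apply/seteqP; split => [x h i _|x h i]; exact: h.
congr (_ _); apply/seteqP; split => [[a v]/= h|[a v]/= [h0 hS] i].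
  split; first by have := h ord0; rewrite rV_cons0.
  by move=> i; have := h (lift 0 i); rewrite rV_consS.
by have [j ->|->] := unliftP 0 i; rewrite ?rV_consS ?rV_cons0.
Qed.

End lebesgue_rV.

Section fourier.
Context (R : realType) (n : nat).
Local Notation C := R[i].
Local Notation mu := (lebesgue_rV R n).
Implicit Types (f F : 'rV[R]_n -> C) (x xi : 'rV[R]_n) (p : \bar R).

Definition dotv x xi : R := \sum_i x 0 i * xi 0 i.

(* The Euclidean norm; the canonical norm `|x| on 'rV[R]_n is the sup norm. *)
Definition enorm x : R := Num.sqrt (dotv x x).

Definition measurableC f : Prop :=
  measurable_fun setT (fun x => complex.Re (f x)) /\
  measurable_fun setT (fun x => complex.Im (f x)).

Definition LnormC p f : \bar R :=
  Lnorm mu p (fun x => (ComplexField.Normc.normc (f x))%:E).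

Definition memLp p f : Prop := measurableC f /\ (LnormC p f < +oo)%E.

Definition integralC f : C :=
  (\int[mu]_x complex.Re (f x)) +i* (\int[mu]_x complex.Im (f x)).

Definition cis (theta : R) : C := cos theta +i* sin theta.

(* Meaningful for integrable functions only. *)
Definition fourier f xi : C := integralC (fun x => cis (- dotv x xi) * f x).

Definition ifourier F x : C :=
  (((2 * pi) ^+ n)^-1)%:C * integralC (fun xi => cis (dotv x xi) * F xi).

(* F is the Fourier transform of f in L^m, 1 <= m <= 2, i.e. the extension by
   continuity of the integral transform from the dense subspace L^1 \cap L^m
   to a map L^m -> L^{m'}, 1/m + 1/m' = 1 (Hausdorff-Young). *)
Definition has_fourier (m : R) f F : Prop :=
  measurableC F /\
  exists g : nat -> 'rV[R]_n -> C,
    [/\ forall k, memLp 1%E (g k) /\ memLp m%:E (g k),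
        LnormC m%:E (fun x => g k x - f x) @[k --> \oo] --> 0%E &
        LnormC (hoelder_conjugate m%:E)
          (fun xi => fourier (g k) xi - F xi) @[k --> \oo] --> 0%E].

(* The norm || |D|^s F^{-1}(F) ||_{L^2}, where |D|^s F^{-1}(F) is by definition
   F^{-1}(|xi|^s F).  ifourier being an integral, it is to be used when
   |xi|^s F is integrable, e.g. for F in some L^q, q >= 1, of bounded support
   and s >= 0. *)
Definition Hdot_norm_ifourier (s : R) F : \bar R :=
  LnormC 2%:E (ifourier (fun xi => (enorm xi `^ s)%:C * F xi)).

Fixpoint Ck (k : nat) (f : 'rV[R]_n -> R) : Prop :=
  match k with
  | 0 => continuous f
  | k'.+1 => continuous f /\ forall i : 'I_n,
      (forall x, derivable f x (delta_mx 0 i)) /\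
      Ck k' (fun x => 'D_(delta_mx 0 i) f x)
  end.

Definition smooth (f : 'rV[R]_n -> R) : Prop := forall k, Ck k f.

Definition cutoff (eps : R) (chi : 'rV[R]_n -> R) : Prop :=
  [/\ smooth chi,
      forall xi, 0 <= chi xi <= 1,
      forall xi, eps < enorm xi -> chi xi = 0 &
      forall xi, enorm xi <= eps / 2 -> chi xi = 1].

(* w_t + M(xi) w = 0 for t > 0, w(0, xi) = w0(xi): for every xi, a function of
   t continuous up to t = 0 and differentiable for t > 0; the complex entries
   are differentiated through their real and imaginary parts. *)
Definition solves (M : 'rV[R]_n -> 'M[C]_3) (w0 : 'rV[R]_n -> 'cV[C]_3)
    (w : R -> 'rV[R]_n -> 'cV[C]_3) : Prop :=
  forall xi,
    [/\ w 0 xi = w0 xi,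
        forall i, complex.Re (w t xi i 0) @[t --> 0^'+] --> complex.Re (w 0 xi i 0) /\
                  complex.Im (w t xi i 0) @[t --> 0^'+] --> complex.Im (w 0 xi i 0) &
        forall t, 0 < t -> exists dw : 'cV[C]_3,
          dw + M xi *m w t xi = 0 /\
          forall i,
            is_derive t 1 (fun r : R => complex.Re (w r xi i 0)) (complex.Re (dw i 0)) /\
            is_derive t 1 (fun r : R => complex.Im (w r xi i 0)) (complex.Im (dw i 0))].

End fourier.

Section plate.
Context (R : realType) (n : nat).
Local Notation C := R[i].
Implicit Types (xi : 'rV[R]_n) (sigma : R).

Definition mx3 (rows : seq (seq C)) : 'M[C]_3 :=
  \matrix_(i, j) nth 0 (nth [::] rows i) j.

Definition A0 : 'M[C]_3 := 2^-1 *: mx3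
  [:: [:: 0; -2; -2];
      [:: 2; 0; -2];
      [:: 1; 1; 2]].

Definition A1 : 'M[C]_3 := 2^-1 *: mx3
  [:: [:: 1; 1; 0];
      [:: 1; 1; 0];
      [:: 0; 0; 0]].

Definition T0 : 'M[C]_3 := mx3
  [:: [:: -1; 0; 1];
      [:: 1; 0; 1];
      [:: 0; 1; 0]].

(* x `^ 0 = 1 for all x, and 0 `^ a = 0 for a != 0. *)
Definition absp xi (a : R) : C := (enorm xi `^ a)%:C.

Definition T1 sigma xi : 'M[C]_3 := 1%:M + absp xi (2 - 2 * sigma) *: mx3
  [:: [:: 0; 0; 1];
      [:: 0; 0; 1];
      [:: 1; 1; 0]].

(* The matrix T_{1 1/2} *)
Definition T1h sigma xi : 'M[C]_3 := 1%:M + absp xi (4 - 4 * sigma) *: mx3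
  [:: [:: 0; 0; 0];
      [:: 0; 0; 1];
      [:: 0; 1; 0]].

Definition plate_symbol sigma xi : 'M[C]_3 :=
  absp xi 2 *: A0 + absp xi (2 * sigma) *: A1.

(* Initial data on the Fourier side.  u0 itself need not be a function: it
   enters only through |xi|^2 u0h, the transform of |D|^2 u0, so u0h is any
   function for which this product is the transform of an element of L^m. *)
Definition plate_init (u0h u1h theta0h : 'rV[R]_n -> C) xi : 'cV[C]_3 :=
  \col_i nth 0 [:: u1h xi + absp xi 2 * u0h xi;
                   u1h xi - absp xi 2 * u0h xi;
                   theta0h xi] i.

Definition ref_symbol sigma xi : 'M[C]_3 :=
  diag_mx (\row_i nth 0 [:: absp xi (4 - 2 * sigma);
                            absp xi 2;
                            absp xi (2 * sigma)] i).

(* T1 and T1h are invertible for small xi.  At the other xi, where invmx is a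
   junk value, the reference solution is only ever used multiplied by a cutoff
   that vanishes there. *)
Definition ref_init sigma (w0 : 'rV[R]_n -> 'cV[C]_3) xi : 'cV[C]_3 :=
  invmx (T1h sigma xi) *m (invmx (T1 sigma xi) *m (invmx T0 *m w0 xi)).

End plate.

(* Main.v *)
(* Put r = |xi|, d = r^(2-2 sigma) and v = T0^-1 w.  At each frequency the
   system (S) reads v' = -r^(2 sigma) M(d) v, and a perturbation
   Y = T1 T_{1 1/2} + O(d) applied to the reference solution solves it up to
   an error that a Lyapunov function controls: for small d,
     |w - T0 T1 T_{1 1/2} wt|^2 <= C d^2 exp(-c r^(4-2 sigma) t) |w0|^2.
   Hence the squared low-frequency multiplier is at most B = C tau^-a, and its
   integral at most B V with V = C tau^-n, where tau = (1+t)^(1/(4-2 sigma))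
   and a = 2s + 4 - 4 sigma.  Splitting the data at a height, using the trivial
   L1-Loo bound on the large part and the L2 bound of the Fourier integral on
   the small one, gives for 1 <= m <= 2
     int W |F|^2 <= C B V^(2/m-1) ||f||_m^2  whenever 0 <= W <= B, int W <= B V,
   which is the claimed rate.  The L2 bound comes with a non-optimal constant:
   one integrates |F|^2 against the product of the weights (1 - (xi_i/N)^2)_+
   and applies Schur's test to their cosine transform, which is dominated by a
   Cauchy kernel of integral independent of N. *)

Require Import Defs.
From HB Require Import structures.
From mathcomp Require Import all_boot all_order all_algebra.
From mathcomp Require Import all_classical all_reals all_analysis.
From mathcomp Require Import complex measurable_realfun ess_sup_inf ring lra.

Import Order.TTheory GRing.Theory Num.Theory.
Import numFieldNormedType.Exports.

Local Open Scope classical_set_scope.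
Local Open Scope ring_scope.
Local Open Scope complex_scope.

Set Implicit Arguments.
Unset Strict Implicit.
Unset Printing Implicit Defensive.

(** * An L2 bound for the Fourier integral *)

(** The quadratic energy dictates the corrected ansatz. With [T1 T1h] itself the residual contains
    d^2 w2 in the first row and d^2 w1 in the second, while the dissipation has coefficients of
    order d^2, d, 1 on the squares of the error components and d^4, d^3, d^2 on those of [w]: such
    terms cannot be absorbed. [Y] has no residual in the first row and only d^3 w1 in the second,
    and it differs from the product by O(d), which is the size of the claimed error anyway. One
    threshold d <= 1/4 serves the polynomial inequalities and the invertibility of [T1] and [T1h],
    and fixes the radius of the cutoff. Two notions give less than the estimate consumes.
    [has_fourier] provides the transform only as a limit in the conjugate exponent, so bounds are
    proved for integrable approximants and then transferred. [solves] is a statement at each single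
    frequency, so measurability in xi must be recovered: a solution is the limit of an exponential
    series whose partial sums are polynomial in the symbol and the initial value. *)

Section kernel.
Variable R : realType.
Local Notation leb := (@lebesgue_measure R).

Lemma derivable_continuous (f : R -> R) :
  (forall x : R, derivable f x 1) -> continuous f.
Proof. by move=> df x; apply/differentiable_continuous/derivable1_diffP. Qed.

Lemma integral_is_derive (F f : R -> R) (a b : R) : a < b ->
  (forall x : R, is_derive x 1 F (f x)) -> continuous f ->
  (\int[leb]_(x in `[a, b]) (f x)%:E = (F b - F a)%:E)%E.
Proof.
move=> ab dF cf; have fourier_const : continuous F.
  by apply: derivable_continuous => x; exact: ex_derive.
rewrite (@continuous_FTC2 _ f F)//.
- exact: continuous_subspaceT.
- split; first by move=> x _; exact: ex_derive.
  + by apply: cvg_at_right_filter; exact: fourier_const.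
  + by apply: cvg_at_left_filter; exact: fourier_const.
- by move=> x _; rewrite derive1E; exact: derive_val.
Qed.

(** A compactly supported weight that tends to 1 as [N] grows. Being polynomial on its support it
    has elementary cosine and sine moments; vanishing at both ends [N] and [- N], it has a cosine
    transform of order z^-2, hence integrable. *)
Definition bump (N x : R) : R := Num.max 0 (1 - (x / N) ^+ 2).

Lemma bump_ge0 N x : 0 <= bump N x.
Proof. by rewrite /bump le_max lexx. Qed.

Lemma bump_le1 N x : bump N x <= 1.
Proof. by rewrite /bump ge_max ler01/= lerBlDr lerDl sqr_ge0. Qed.

Lemma measurable_bump N : measurable_fun setT (bump N).
Proof.
apply: measurable_maxr => //; apply: measurable_funB => //.
by apply: measurable_funX; exact: measurable_funM.
Qed.

Lemma bumpE N x : 0 < N -> bump N x = ((fun x => 1 - (x / N) ^+ 2) \_ `[- N, N]) x.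
Proof.
move=> N0; rewrite /bump patchE mem_setE in_itv/= -ler_norml.
have -> : (`|x| <= N) = ((x / N) ^+ 2 <= 1).
  rewrite -[(_ / _) ^+ 2]real_normK ?num_real// -[in RHS](expr1n _ 2) ler_pXn2r ?nnegrE//.
  by rewrite normrM normfV (gtr0_norm N0) ler_pdivrMr// mul1r.
case: ifPn => h; first by rewrite max_r// subr_ge0.
by rewrite max_l// subr_le0 ltW// ltNge.
Qed.

Lemma integral_bump (N : R) (g : R -> R) : 0 < N ->
  (\int[leb]_x (bump N x * g x)%:E =
   \int[leb]_(x in `[(- N)%R, N%R]) ((1 - (x / N) ^+ 2) * g x)%:E)%E.
Proof.
move=> N0; rewrite [RHS]integral_mkcond; apply: eq_integral => x _.
by rewrite bumpE// !patchE; case: ifP => // _; rewrite mul0r.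
Qed.

Lemma integral_bump_sin (N z : R) : 0 < N ->
  (\int[leb]_x (bump N x * sin (z * x))%:E = 0)%E.
Proof.
move=> N0; have [->|z0] := eqVneq z 0.
  by apply: integral0_eq => x _; rewrite mul0r sin0 mulr0.
rewrite integral_bump//.
(* Antiderivative from repeated integration by parts. It is even in [x], so its increment over the
   symmetric interval vanishes. *)
pose F x := - (1 - (x / N) ^+ 2) * cos (z * x) / z - 2 * x / N ^+ 2 * sin (z * x) / z ^+ 2
  - 2 / N ^+ 2 * cos (z * x) / z ^+ 3.
have dF (x : R) : is_derive x 1 F ((1 - (x / N) ^+ 2) * sin (z * x)).
  rewrite /F; apply: is_derive_eq; rewrite /GRing.scale/=.
  by field; rewrite z0 gt_eqF.
rewrite (integral_is_derive _ dF).
- by rewrite /F mulrN sinN cosN (_ : _ - _ = 0)//; field; rewrite z0 gt_eqF.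
- lra.
- by apply: derivable_continuous => x; exact: ex_derive.
Qed.

Lemma normr_sin_le (x : R) : `|sin x| <= `|x|.
Proof.
wlog x0 : x / 0 < x.
  move=> h; have [/h//|x0|<-] := ltgtP 0 x; last by rewrite sin0 normr0.
  by rewrite -normrN -sinN -(normrN x); apply: h; rewrite oppr_gt0.
have [c _] := @MVT R sin cos 0 x x0 (fun y _ => is_derive_sin y)
  (continuous_subspaceT (@continuous_sin R)).
rewrite sin0 !subr0 => ->.
by rewrite normrM ler_piMl// cos_max.
Qed.

Lemma integral_bump1 (N : R) : 0 < N ->
  (\int[leb]_x (bump N x)%:E = (4 / 3 * N)%:E)%E.
Proof.
move=> N0; under eq_integral do rewrite -[bump N _]mulr1.
rewrite integral_bump//.
pose F x := x - x ^+ 3 / (3 * N ^+ 2).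
have dF (x : R) : is_derive x 1 F ((1 - (x / N) ^+ 2) * 1).
  rewrite /F; apply: is_derive_eq; rewrite /GRing.scale/=.
  by field; rewrite gt_eqF.
rewrite (integral_is_derive _ dF); first by congr EFin; rewrite /F; field; rewrite gt_eqF.
  lra.
by apply: derivable_continuous => x; exact: ex_derive.
Qed.

(** Two bounds are added. Trivially |c| <= 4/3 N; and since the weight vanishes at the endpoints,
    the 1/z term of the antiderivative drops out and N z^2 |c| <= 8. Hence |c| (1 + (N z)^2) <= (4/3
    + 8) N, and 16 is a convenient upper bound. *)
Lemma integral_bump_cos (N z : R) : 0 < N ->
  exists2 c : R, (\int[leb]_x (bump N x * cos (z * x))%:E = c%:E)%E &
    `|c| <= 16 * (N / (1 + (N * z) ^+ 2)).
Proof.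
move=> N0; have N20 : - N < N by lra.
have [->|z0] := eqVneq z 0.
  exists (4 / 3 * N).
    by rewrite -integral_bump1//; apply: eq_integral => x _; rewrite mul0r cos0 mulr1.
  rewrite mulr0 expr0n/= addr0 divr1 ger0_norm; lra.
pose F x := (1 - (x / N) ^+ 2) * sin (z * x) / z - 2 * x / N ^+ 2 * cos (z * x) / z ^+ 2
  + 2 / N ^+ 2 * sin (z * x) / z ^+ 3.
have dF (x : R) : is_derive x 1 F ((1 - (x / N) ^+ 2) * cos (z * x)).
  rewrite /F; apply: is_derive_eq; rewrite /GRing.scale/=.
  by field; rewrite z0 gt_eqF.
have Fint : (\int[leb]_x (bump N x * cos (z * x))%:E = (F N - F (- N))%:E)%E.
  rewrite integral_bump// (integral_is_derive N20 dF)//.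
  by apply: derivable_continuous => x; exact: ex_derive.
exists (F N - F (- N)) => //.
have c1 : `|F N - F (- N)| <= 4 / 3 * N.
  rewrite -lee_fin -abse_EFin -Fint -integral_bump1//.
  have mc : measurable_fun setT (fun x => (bump N x * cos (z * x))%:E).
    apply/measurable_EFinP; apply: measurable_funM; first exact: measurable_bump.
    apply: continuous_measurable_fun.
    by apply: derivable_continuous => x; exact: ex_derive.
  apply: le_trans (le_abse_integral _ _ _) _ => //.
  apply: ge0_le_integral => //; first exact: measurableT_comp.
    by apply/measurable_EFinP; exact: measurable_bump.
  move=> x _; rewrite abse_EFin lee_fin normrM (ger0_norm (bump_ge0 _ _)).
  by rewrite ler_piMr ?bump_ge0// cos_max.
have c2 : `|F N - F (- N)| * (N * z ^+ 2) <= 8.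
  rewrite -[X in _ * X]ger0_norm; last by rewrite mulr_ge0 ?sqr_ge0// ltW.
  rewrite -normrM.
  have -> : (F N - F (- N)) * (N * z ^+ 2) = 4 * (sin (z * N) / (z * N)) - 4 * cos (z * N).
    by rewrite /F !mulrN sinN cosN; field; rewrite z0 gt_eqF.
  rewrite (le_trans (ler_normB _ _))// !normrM normfV.
  have : `|sin (z * N)| / `|z * N| <= 1.
    by rewrite ler_pdivrMr ?mul1r ?normr_sin_le// normr_gt0 mulf_neq0// gt_eqF.
  have := cos_max (z * N).
  have -> : `|4| = 4 :> R by rewrite ger0_norm.
  move=> h1 h2; lra.
have d0 : 0 < 1 + (N * z) ^+ 2 by rewrite ltr_pwDl ?sqr_ge0.
rewrite mulrA ler_pdivlMr// mulrDr mulr1 exprMn.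
have := ler_wpM2l (ltW N0) c2; lra.
Qed.

(** The substitution [N * (y - x)] reduces to the arctangent integral; the mass does not depend on
    [N], which makes the later Schur bound uniform in [N]. *)
Lemma integral_cauchy (N x : R) : 0 < N ->
  (\int[leb]_y (N / (1 + (N * (y - x)) ^+ 2))%:E = pi%:E)%E.
Proof.
move=> N0; pose F (y : R) := N * (y - x).
have F'E : F^`()%classic = cst N.
  apply/funext => y; rewrite derive1E; apply: derive_val.
  by apply: is_derive_eq; rewrite /GRing.scale/=; ring.
transitivity (\int[leb]_y ((oneDsqr y)^-1)%:E)%E; last first.
  rewrite ge0_symfun_integralT.
  - rewrite (_ : [set x | _] = `[0, +oo[%classic); last first.
      by apply/seteqP; split => y/=; rewrite in_itv/= andbT.
    by rewrite integral0y_oneDsqr -EFinM mulrC divfK.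
  - by move=> y; rewrite invr_ge0 (le_trans ler01)// oneDsqr_ge1.
  - exact: continuous_oneDsqrV.
  - by move=> y; rewrite /oneDsqr/= sqrrN.
rewrite (increasing_ge0_integration_by_substitutionT (F := F) (G := fun y => (oneDsqr y)^-1)).
- by apply: eq_integral => y _; rewrite F'E !fctE/= /F /oneDsqr mulrC.
- by move=> y z yz; rewrite /F ltr_pM2l// ltrD2r.
- by rewrite F'E => ?; exact: cvg_cst.
- by rewrite F'E; exact: is_cvg_cst.
- by rewrite F'E; exact: is_cvg_cst.
- by move=> y; exact: ex_derive.
- by apply/gt0_cvgMrNy => //; exact: cvg_addrr_Ny.
- by apply/gt0_cvgMry => //; exact: cvg_addrr.
- exact: continuous_oneDsqrV.
- by move=> y; rewrite invr_ge0 (le_trans ler01)// oneDsqr_ge1.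
Qed.

End kernel.

(** * Iterated integration over the coordinates of R^n *)

Section rVint.
Variable R : realType.
Local Notation leb := (@lebesgue_measure R).
Local Notation mu n := (lebesgue_rV R n).

Lemma measurable_coord n (i : 'I_n) :
  measurable_fun setT (fun x : 'rV[R]_n => x 0 i : R).
Proof. exact: measurable_rV_coor. Qed.

Lemma measurable_dotv d (T : measurableType d) n (f g : T -> 'rV[R]_n) :
  measurable_fun setT f -> measurable_fun setT g ->
  measurable_fun setT (fun t => dotv (f t) (g t)).
Proof.
move=> mf mg; apply: measurable_sum => i.
by apply: measurable_funM; apply: measurableT_comp (measurable_coord i) _.
Qed.

Lemma measurable_cos_dotv d (T : measurableType d) n (f g : T -> 'rV[R]_n) :
  measurable_fun setT f -> measurable_fun setT g ->
  measurable_fun setT (fun t => cos (dotv (f t) (g t))).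
Proof.
move=> mf mg; apply: (measurableT_comp (continuous_measurable_fun (@continuous_cos R))).
exact: measurable_dotv.
Qed.

Lemma measurable_sin_dotv d (T : measurableType d) n (f g : T -> 'rV[R]_n) :
  measurable_fun setT f -> measurable_fun setT g ->
  measurable_fun setT (fun t => sin (dotv (f t) (g t))).
Proof.
move=> mf mg; apply: (measurableT_comp (continuous_measurable_fun (@continuous_sin R))).
exact: measurable_dotv.
Qed.

Lemma measurable_prod_coord n (f : 'I_n -> R -> R) :
  (forall i, measurable_fun setT (f i)) ->
  measurable_fun setT (fun x : 'rV[R]_n => \prod_i f i (x 0 i)).
Proof.
by move=> mf; apply: measurable_prod => i _; apply: measurableT_comp (mf i) (measurable_coord i).
Qed.

Lemma dotv_cons n (z : 'rV[R]_n.+1) a (v : 'rV[R]_n) :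
  dotv z (rV_cons (a, v)) = z 0 0 * a + dotv (\row_j z 0 (lift 0 j)) v.
Proof.
rewrite /dotv big_ord_recl rV_cons0; congr (_ + _).
by apply: eq_bigr => i _; rewrite rV_consS mxE.
Qed.

Lemma integral_rVS n (F : 'rV[R]_n.+1 -> \bar R) :
  measurable_fun setT F -> (forall x, 0 <= F x)%E ->
  (\int[mu n.+1]_x F x = \int[leb]_a \int[mu n]_v F (rV_cons (a, v)))%E.
Proof.
move=> mF F0; have mc := @measurable_rV_cons R n.
transitivity (\int[pushforward (leb \x mu n)%E (@rV_cons R n)]_x F x)%E.
  by apply: eq_measure_integral => A mA _.
rewrite ge0_integral_pushforward// preimage_setT fubini_tonelli1//.
  exact: measurableT_comp.
by move=> p; exact: F0.
Qed.

Lemma integral_rVS_integrable n (F : 'rV[R]_n.+1 -> \bar R) :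
  measurable_fun setT F -> (leb \x mu n)%E.-integrable setT (F \o @rV_cons R n) ->
  (\int[mu n.+1]_x F x = \int[leb]_a \int[mu n]_v F (rV_cons (a, v)))%E.
Proof.
move=> mF iF; have mc := @measurable_rV_cons R n.
transitivity (\int[pushforward (leb \x mu n)%E (@rV_cons R n)]_x F x)%E.
  by apply: eq_measure_integral => A mA _.
by rewrite integral_pushforward// preimage_setT -integral12_prod_meas1.
Qed.

Lemma integral_prod_coord n (f : 'I_n -> R -> R) (c : 'I_n -> R) :
  (forall i, measurable_fun setT (f i)) -> (forall i x, 0 <= f i x) ->
  (forall i, \int[leb]_x (f i x)%:E = (c i)%:E)%E ->
  (\int[mu n]_x (\prod_i f i (x 0 i))%:E = (\prod_i c i)%:E)%E.
Proof.
elim: n f c => [|n IH] f c mf f0 fc.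
  rewrite (_ : (fun _ => _) = cst 1%E); last by apply/funext => x; rewrite big_ord0.
  by rewrite integral_cst//= diracE mem_set// mule1 big_ord0.
rewrite integral_rVS; first last.
- by move=> x; rewrite lee_fin prodr_ge0.
- by apply/measurable_EFinP; exact: measurable_prod_coord.
have inner a : (\int[mu n]_v (\prod_(i < n.+1) f i (rV_cons (a, v) 0 i))%:E =
    (f ord0 a)%:E * (\prod_(i < n) c (lift ord0 i))%:E)%E.
  rewrite -(IH (fun i => f (lift ord0 i)))// -ge0_integralZl_EFin//.
  - apply: eq_integral => v _; rewrite big_ord_recl rV_cons0 -EFinM/=.
    by under eq_bigr do rewrite rV_consS.
  - by move=> v _; rewrite lee_fin prodr_ge0.
  - apply/measurable_EFinP.
    by apply: (measurable_prod_coord (f := fun i => f (lift ord0 i))).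
under eq_integral do rewrite inner.
rewrite ge0_integralZr//; first last.
- rewrite lee_fin prodr_ge0// => i _.
  by rewrite -lee_fin -fc integral_ge0// => x _; rewrite lee_fin.
- by move=> x _; rewrite lee_fin.
- by apply/measurable_EFinP; exact: mf.
by rewrite fc -EFinM big_ord_recl.
Qed.

Lemma integrable_prod_coord n (f : 'I_n -> R -> R) (c : 'I_n -> R) :
  (forall i, measurable_fun setT (f i)) -> (forall i x, 0 <= f i x) ->
  (forall i, \int[leb]_x (f i x)%:E = (c i)%:E)%E ->
  (mu n).-integrable setT (fun x => (\prod_i f i (x 0 i))%:E).
Proof.
move=> mf f0 fc; apply/integrableP; split.
  by apply/measurable_EFinP; exact: measurable_prod_coord.
under eq_integral do rewrite gee0_abs ?lee_fin ?prodr_ge0//.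
by rewrite (integral_prod_coord mf f0 fc) ltry.
Qed.

Lemma integrable_le (d : measure_display) (T : measurableType d)
    (nu : {measure set T -> \bar R}) (f g : T -> R) :
  measurable_fun setT f -> (forall x, `|f x| <= g x) ->
  nu.-integrable setT (EFin \o g) -> nu.-integrable setT (EFin \o f).
Proof.
move=> mf fg ig; apply: le_integrable ig => //; first exact/measurable_EFinP.
by move=> x _; rewrite /= lee_fin (le_trans (fg x))// ler_norm.
Qed.

(* The sine part of the addition formula drops out because [f] has vanishing
   sine moments. *)
Lemma integral_prod_cos (f : R -> R) (k : R) n (z : 'rV[R]_n) (c : 'I_n -> R) :
  measurable_fun setT f -> (forall x, 0 <= f x) -> (\int[leb]_x (f x)%:E = k%:E)%E ->
  (forall y, \int[leb]_x (f x * sin (y * x))%:E = 0)%E ->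
  (forall i, \int[leb]_x (f x * cos (z 0%R i * x))%:E = (c i)%:E)%E ->
  (\int[mu n]_x ((\prod_i f (x 0 i)) * cos (dotv z x))%:E = (\prod_i c i)%:E)%E.
Proof.
move=> mf f0 fk fs; elim: n z c => [|n IH] z c fc.
  rewrite (_ : (fun _ => _) = cst 1%E); last first.
    by apply/funext => x; rewrite /dotv !big_ord0 cos0 mulr1.
  by rewrite integral_cst//= diracE mem_set// mule1 big_ord0.
have mprod m : measurable_fun setT (fun x : 'rV[R]_m => \prod_i f (x 0 i)).
  exact: (measurable_prod_coord (fun=> mf)).
have iprod m := @integrable_prod_coord m _ _ (fun=> mf) (fun=> f0) (fun=> fk).
have mcos m (y : 'rV[R]_m) : measurable_fun setT (fun x => cos (dotv y x)).
  exact: measurable_cos_dotv.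
have mF : measurable_fun setT (fun x : 'rV[R]_n.+1 => (\prod_i f (x 0 i)) * cos (dotv z x)).
  by apply: measurable_funM; [exact: mprod|exact: mcos].
rewrite integral_rVS_integrable//; first last.
- apply: (@integrable_le _ _ _ _ (fun p => \prod_i f (rV_cons p 0 i))).
    by apply: (measurableT_comp mF); exact: measurable_rV_cons.
    move=> p; rewrite normrM ger0_norm ?prodr_ge0// ler_piMr ?prodr_ge0//.
    exact: cos_max.
  apply/integrableP; split.
    apply/measurable_EFinP.
    by apply: (measurableT_comp (mprod _)); exact: measurable_rV_cons.
  rewrite fubini_tonelli1//=.
    rewrite -(@integral_rVS n (fun x => `|(\prod_i f (x 0 i))%:E|)%E)//.
      by have /integrableP[] := iprod n.+1.
    by apply: measurableT_comp => //; apply/measurable_EFinP; exact: mprod.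
  apply/measurable_EFinP; apply: measurableT_comp => //.
  by apply: (measurableT_comp (mprod _)); exact: measurable_rV_cons.
- exact/measurable_EFinP.
pose z' : 'rV[R]_n := \row_j z 0 (lift 0 j).
have msin : measurable_fun setT (fun x : 'rV[R]_n => sin (dotv z' x)).
  exact: measurable_sin_dotv.
(* The value of this sine integral is never computed: it gets multiplied by the vanishing sine
   moment of [f], so only its finiteness matters. *)
pose s := \int[mu n]_v ((\prod_i f (v 0 i)) * sin (dotv z' v)).
have is_ : (mu n).-integrable setT (fun v => ((\prod_i f (v 0 i)) * sin (dotv z' v))%:E).
  apply: integrable_le (iprod n).
    by apply: measurable_funM; [exact: mprod|exact: msin].
  move=> v; rewrite normrM ger0_norm ?prodr_ge0// ler_piMr ?prodr_ge0//.
  exact: sin_max.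
have ic_ : (mu n).-integrable setT (fun v => ((\prod_i f (v 0 i)) * cos (dotv z' v))%:E).
  apply: integrable_le (iprod n).
    by apply: measurable_funM; [exact: mprod|exact: mcos].
  move=> v; rewrite normrM ger0_norm ?prodr_ge0// ler_piMr ?prodr_ge0//.
  exact: cos_max.
have sE : (\int[mu n]_v ((\prod_i f (v 0%R i)) * sin (dotv z' v))%:E = s%:E)%E.
  by rewrite fineK//; exact: integrable_fin_num.
have cE := IH z' (fun i => c (lift ord0 i)).
have inner a : (\int[mu n]_v ((\prod_(i < n.+1) f (rV_cons (a, v) 0 i)) *
      cos (dotv z (rV_cons (a, v))))%:E =
    (f a * cos (z 0%R 0%R * a))%:E * (\prod_(i < n) c (lift ord0 i))%:E
    - (f a * sin (z 0%R 0%R * a))%:E * s%:E)%E.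
  rewrite -cE; last by move=> i; rewrite mxE fc.
  rewrite -sE -!integralZl// -integralB//; [|exact: integrableZl|exact: integrableZl].
  apply: eq_integral => v _; rewrite big_ord_recl rV_cons0 dotv_cons cosD -!EFinM -EFinB.
  rewrite (_ : \prod_(i < n) _ = \prod_i f (v 0 i)); last first.
    by apply: eq_bigr => i _; rewrite rV_consS.
  by congr (_%:E); rewrite -/z' /=; ring.
under eq_integral do rewrite inner.
have ifa (g : R -> R) : measurable_fun setT g -> (forall x, `|g x| <= 1) ->
    leb.-integrable setT (fun a => (f a * g a)%:E).
  move=> mg g1; apply: (@integrable_le _ (measurableTypeR R) leb (fun a => f a * g a) f).
    exact: measurable_funM.
    by move=> a; rewrite normrM ger0_norm// ler_piMr.
  apply/integrableP; split; first exact/measurable_EFinP.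
  by under eq_integral do rewrite /= ger0_norm//; rewrite fk ltry.
have mcos1 : measurable_fun setT (fun a : R => cos (z 0 0 * a)).
  apply: continuous_measurable_fun.
  by apply: derivable_continuous => x; exact: ex_derive.
have msin1 : measurable_fun setT (fun a : R => sin (z 0 0 * a)).
  apply: continuous_measurable_fun.
  by apply: derivable_continuous => x; exact: ex_derive.
have ifc := ifa (fun a => cos (z 0 0 * a)).
have ifs := ifa (fun a => sin (z 0 0 * a)).
rewrite integralB//; first last.
- apply: integrableZr => //; apply: ifs => [|x]; last exact: sin_max.
  exact: msin1.
- apply: integrableZr => //; apply: ifc => [|x]; last exact: cos_max.
  exact: mcos1.
rewrite !integralZr//; first last.
- apply: ifc => [|x]; last exact: cos_max.
  exact: mcos1.
- apply: ifs => [|x]; last exact: sin_max.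
  exact: msin1.
by rewrite fs mul0e sube0 fc -EFinM big_ord_recl.
Qed.

End rVint.

Lemma integrableM_le1 (d : measure_display) (T : measurableType d) (R : realType)
    (nu : {measure set T -> \bar R}) (f g : T -> R) :
  measurable_fun setT g -> (forall x, `|g x| <= 1) ->
  nu.-integrable setT (EFin \o f) ->
  nu.-integrable setT (EFin \o (fun x => f x * g x)).
Proof.
move=> mg g1 if_; have mf : measurable_fun setT f.
  by apply/measurable_EFinP; case/integrableP: if_.
apply: le_integrable if_ => //; first by apply/measurable_EFinP; exact: measurable_funM.
by move=> x _; rewrite /= lee_fin normrM ler_piMr.
Qed.

Lemma integrable_tensor (d1 d2 : measure_display) (T1 : measurableType d1)
    (T2 : measurableType d2) (R : realType)
    (m1 : {sigma_finite_measure set T1 -> \bar R})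
    (m2 : {sigma_finite_measure set T2 -> \bar R}) (f : T1 -> R) (g : T2 -> R) :
  m1.-integrable setT (EFin \o f) -> m2.-integrable setT (EFin \o g) ->
  (m1 \x m2)%E.-integrable setT (fun p => (f p.1 * g p.2)%:E).
Proof.
move=> if_ ig.
have mf : measurable_fun setT f by apply/measurable_EFinP; case/integrableP: if_.
have mg : measurable_fun setT g by apply/measurable_EFinP; case/integrableP: ig.
have mfg : measurable_fun setT (fun p : T1 * T2 => f p.1 * g p.2).
  by apply: measurable_funM; exact: measurableT_comp.
apply/integrable12ltyP; first exact/measurable_EFinP.
have mnf : measurable_fun setT (fun x => (`|f x|)%:E).
  by apply/measurable_EFinP; exact: measurableT_comp.
have mng : measurable_fun setT (fun x => (`|g x|)%:E).
  by apply/measurable_EFinP; exact: measurableT_comp.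
under eq_integral => x _.
  rewrite (_ : (\int[m2]_y _)%E = (`|f x|)%:E * \int[m2]_y (`|g y|)%:E)%E; last first.
    rewrite -ge0_integralZl_EFin//.
    by apply: eq_integral => y _; rewrite /= normrM EFinM.
  over.
rewrite ge0_integralZr//; last by rewrite integral_ge0// => x _; rewrite lee_fin.
have /integrableP[_ foo] := if_; have /integrableP[_ goo] := ig.
rewrite lte_mul_pinfty//; first by rewrite integral_ge0// => x _; rewrite lee_fin.
rewrite ge0_fin_numE; first exact: foo.
by rewrite integral_ge0// => x _; rewrite lee_fin.
Qed.

Section lebesgue_rV2.
Variables (R : realType) (n : nat).

(* A product of sigma-finite measures is not inferred as such (the instance of
   [product_measure1] is the one for subprobabilities), hence this alias. *)
Definition lebesgue_rV2 : set ('rV[R]_n * 'rV[R]_n)%type -> \bar R :=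
  (lebesgue_rV R n \x lebesgue_rV R n)%E.

HB.instance Definition _ := Measure.on lebesgue_rV2.

Let lebesgue_rV2_sigma_finite : sigma_finite setT lebesgue_rV2.
Proof.
have /sigma_finiteP[F [TF ndF Foo]] := sigma_finiteT (lebesgue_rV R n).
exists (fun k => F k `*` F k) => [|k]; last first.
  have [mF Fk] := Foo k; split; first exact: measurableX.
  by rewrite /lebesgue_rV2 product_measure1E// lte_mul_pinfty// ge0_fin_numE.
apply/esym/seteqP; split => // -[x y] _.
have [j _ Fj] : (\bigcup_k F k) x by rewrite -TF.
have [k _ Fk] : (\bigcup_k F k) y by rewrite -TF.
exists (maxn j k) => //; split => /=.
  by have /subsetPset := ndF _ _ (leq_maxl j k); exact.
by have /subsetPset := ndF _ _ (leq_maxr j k); exact.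
Qed.

HB.instance Definition _ := @Measure_isSigmaFinite.Build _ _ _
  lebesgue_rV2 lebesgue_rV2_sigma_finite.

End lebesgue_rV2.

(** * Cosine and sine transforms of integrable functions on R^n *)

Section bessel.
Variables (R : realType) (n : nat).
Local Notation leb := (@lebesgue_measure R).
Local Notation mu := (lebesgue_rV R n).
Local Notation mu2 := (@lebesgue_rV2 R n).
Implicit Types f g : 'rV[R]_n -> R.

(** For real integrable [f] the Fourier integral is [cosT f - i sinT f], so
    [cosT f ^+ 2 + sinT f ^+ 2] is its squared modulus. *)
Definition cosT f xi : R := \int[mu]_x (f x * cos (dotv x xi)).
Definition sinT f xi : R := \int[mu]_x (f x * sin (dotv x xi)).

(** By Tonelli the integrals of the positive and negative parts are measurable in the parameter.
    [fine] of their difference is then measurable whether or not the sections of [h] are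
    integrable. *)
Lemma measurable_param_Rintegral (h : 'rV[R]_n * 'rV[R]_n -> R) :
  measurable_fun setT h -> measurable_fun setT (fun x => \int[mu]_y h (x, y)).
Proof.
move=> mh; have mH : measurable_fun setT (EFin \o h) by exact/measurable_EFinP.
have -> : (fun x => \int[mu]_y h (x, y)) =
  fine \o (fun x => \int[mu]_y (EFin \o h)^\+ (x, y) - \int[mu]_y (EFin \o h)^\- (x, y))%E.
  apply/funext => x; rewrite /Rintegral integralE /=.
  by congr (fine (_ - _)); apply: eq_integral => y _; rewrite ?funeposE ?funenegE.
apply: measurableT_comp => //.
apply: emeasurable_funB; apply: measurable_fun_fubini_tonelli_F => //.
- exact: measurable_funepos.
- exact: measurable_funeneg.
Qed.

Lemma measurable_cosT f : measurable_fun setT f -> measurable_fun setT (cosT f).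
Proof.
move=> mf; apply: (measurable_param_Rintegral (h := fun p => f p.2 * cos (dotv p.2 p.1))).
by apply: measurable_funM; [exact: measurableT_comp|exact: measurable_cos_dotv].
Qed.

Lemma measurable_sinT f : measurable_fun setT f -> measurable_fun setT (sinT f).
Proof.
move=> mf; apply: (measurable_param_Rintegral (h := fun p => f p.2 * sin (dotv p.2 p.1))).
by apply: measurable_funM; [exact: measurableT_comp|exact: measurable_sin_dotv].
Qed.

Lemma dotvBl (x y z : 'rV[R]_n) : dotv (x - y) z = dotv x z - dotv y z.
Proof. by rewrite /dotv -sumrB; apply: eq_bigr => i _; rewrite !mxE mulrBl. Qed.

Lemma measurable_rVB d (T : measurableType d) (f g : T -> 'rV[R]_n) :
  measurable_fun setT f -> measurable_fun setT g ->
  measurable_fun setT (fun t => f t - g t).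
Proof.
move=> /measurable_fun_rVP mf /measurable_fun_rVP mg; apply/measurable_fun_rVP => i.
rewrite (_ : _ \o _ = fun t => (rV_coor i (f t) : R) - rV_coor i (g t)).
  by apply: measurable_funB; [exact: mf|exact: mg].
by apply/funext => t; rewrite /= /rV_coor !mxE.
Qed.

(* Majorant of the cosine transform of the weight [wgt N] below; its integral
   does not depend on [N]. *)
Definition cauchy_kernel (N : R) (z : 'rV[R]_n) : R :=
  \prod_i (16 * (N / (1 + (N * z 0 i) ^+ 2))).

Lemma cauchy_factor_ge0 (N z : R) : 0 < N -> 0 <= 16 * (N / (1 + (N * z) ^+ 2)).
Proof. by move=> N0; rewrite mulr_ge0// divr_ge0 ?(ltW N0)// addr_ge0 ?sqr_ge0. Qed.

Lemma measurable_cauchy_factor (N : R) :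
  measurable_fun setT (fun z : R => 16 * (N / (1 + (N * z) ^+ 2))).
Proof.
apply: continuous_measurable_fun; apply: derivable_continuous => x.
have h : 1 + (N * x) ^+ 2 != 0 by rewrite gt_eqF// ltr_pwDl ?sqr_ge0.
exact: ex_derive.
Qed.

Lemma cauchy_kernel_ge0 (N : R) z : 0 < N -> 0 <= cauchy_kernel N z.
Proof. by move=> N0; apply: prodr_ge0 => i _; exact: cauchy_factor_ge0. Qed.

Lemma measurable_cauchy_kernel (N : R) : measurable_fun setT (cauchy_kernel N).
Proof. exact: (measurable_prod_coord (fun=> measurable_cauchy_factor N)). Qed.

Lemma integral_cauchy_kernel (N : R) x : 0 < N ->
  (\int[mu]_y (cauchy_kernel N (y - x))%:E = ((16 * pi) ^+ n)%:E)%E.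
Proof.
move=> N0; rewrite -[in RHS](card_ord n) -prodr_const.
rewrite -(@integral_prod_coord R n (fun i y => 16 * (N / (1 + (N * (y - x 0 i)) ^+ 2)))).
- by apply: eq_integral => y _; congr (_%:E); apply: eq_bigr => i _; rewrite !mxE.
- move=> i; apply: (measurableT_comp (measurable_cauchy_factor N)); exact: measurable_funB.
- by move=> i y; exact: cauchy_factor_ge0.
- move=> i; under eq_integral do rewrite EFinM.
  rewrite ge0_integralZl_EFin ?integral_cauchy//.
  + move=> y _; rewrite lee_fin.
    by rewrite divr_ge0 ?(ltW N0)// addr_ge0 ?sqr_ge0.
  + apply/measurable_EFinP; rewrite (_ : (fun _ => _) =
      (fun y => 16^-1 * (16 * (N / (1 + (N * (y - x 0 i)) ^+ 2))))).
      apply: measurable_funM => //; apply: (measurableT_comp (measurable_cauchy_factor N)).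
      exact: measurable_funB.
    by apply/funext => y; rewrite mulKf.
Qed.

Section integrable.
Variable f : 'rV[R]_n -> R.
Hypothesis mf : measurable_fun setT f.
Hypothesis if_ : mu.-integrable setT (EFin \o f).

Lemma integrable_cos xi : mu.-integrable setT (EFin \o (fun x => f x * cos (dotv x xi))).
Proof.
by apply: integrableM_le1 => // [|x]; [exact: measurable_cos_dotv|exact: cos_max].
Qed.

Lemma integrable_sin xi : mu.-integrable setT (EFin \o (fun x => f x * sin (dotv x xi))).
Proof.
by apply: integrableM_le1 => // [|x]; [exact: measurable_sin_dotv|exact: sin_max].
Qed.

Lemma cosTE xi : (\int[mu]_x (f x * cos (dotv x xi))%:E = (cosT f xi)%:E)%E.
Proof. by rewrite fineK//; exact: integrable_fin_num (integrable_cos xi). Qed.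

Lemma sinTE xi : (\int[mu]_x (f x * sin (dotv x xi))%:E = (sinT f xi)%:E)%E.
Proof. by rewrite fineK//; exact: integrable_fin_num (integrable_sin xi). Qed.

(** The subtraction formula for the cosine separates [p.1] from [p.2], so the double integral splits
    into products of single ones. This turns the squared transform into a kernel form to which
    Schur's test can be applied. *)
Lemma cosT_sqr_sinT_sqr xi :
  (\int[mu2]_p (f p.1 * f p.2 * cos (dotv (p.1 - p.2) xi))%:E =
   (cosT f xi ^+ 2 + sinT f xi ^+ 2)%:E)%E.
Proof.
rewrite /lebesgue_rV2 -integral12_prod_meas1; last first.
  apply: integrableM_le1 (integrable_tensor if_ if_); last by move=> p; exact: cos_max.
  by apply: measurable_cos_dotv => //; exact: measurable_rVB.
transitivity (\int[mu]_x ((cosT f xi)%:E * (f x * cos (dotv x xi))%:E +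
   (sinT f xi)%:E * (f x * sin (dotv x xi))%:E))%E.
  apply: eq_integral => x _; rewrite /fubini_F/= -cosTE -sinTE.
  rewrite muleC -integralZl//; last exact: integrable_cos.
  rewrite [X in (_ + X)%E]muleC -integralZl//; last exact: integrable_sin.
  rewrite -integralD//; first last.
  - by apply: integrableZl => //; exact: integrable_sin.
  - by apply: integrableZl => //; exact: integrable_cos.
  apply: eq_integral => y _; rewrite -!EFinM -EFinD; congr (_%:E).
  by rewrite dotvBl cosB /=; ring.
rewrite integralD//; first last.
- by apply: integrableZl => //; exact: integrable_sin.
- by apply: integrableZl => //; exact: integrable_cos.
rewrite integralZl//; last exact: integrable_cos.
rewrite integralZl//; last exact: integrable_sin.
by rewrite cosTE sinTE -!EFinM -EFinD !expr2.
Qed.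

(** Frequency truncation: [cos (dotv z xi)] alone is not integrable in [xi]; with this factor the
    integral over [xi] and both space variables converges absolutely and the order may be
    exchanged. *)
Definition wgt (N : R) (z : 'rV[R]_n) : R := \prod_i bump N (z 0 i).

Lemma bessel_wgt (N : R) : 0 < N ->
  (\int[mu]_xi (wgt N xi * (cosT f xi ^+ 2 + sinT f xi ^+ 2))%:E <=
   ((16 * pi) ^+ n)%:E * \int[mu]_x (f x ^+ 2)%:E)%E.
Proof.
move=> N0.
have kap0 z : 0 <= cauchy_kernel N z by exact: cauchy_kernel_ge0.
have mwgt : measurable_fun setT (wgt N).
  exact: (measurable_prod_coord (fun=> measurable_bump N)).
have iwgt : mu.-integrable setT (fun x => (wgt N x)%:E).
  exact: (integrable_prod_coord (fun=> measurable_bump N) (fun=> bump_ge0 N)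
    (fun=> integral_bump1 N0)).
have ikap x := integral_cauchy_kernel x N0.
have kapC x y : cauchy_kernel N (x - y) = cauchy_kernel N (y - x).
  by apply: eq_bigr => i _; rewrite !mxE -opprB mulrN sqrrN.
have /choice[c cP] : forall z, exists c : R,
    (\int[mu]_xi (wgt N xi * cos (dotv z xi))%:E = c%:E)%E /\ `|c| <= cauchy_kernel N z.
  move=> z.
  pose P i c := (\int[leb]_x (bump N x * cos (z 0%R i * x))%:E = c%:E)%E /\
     `|c| <= 16 * (N / (1 + (N * z 0 i) ^+ 2)).
  have /choice[c cP] : forall i, exists c, P i c.
    by move=> i; have [c c1 c2] := integral_bump_cos (z 0 i) N0; exists c.
  exists (\prod_i c i); split.
    apply: (integral_prod_cos (measurable_bump N) (bump_ge0 N) (integral_bump1 N0)).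
      by move=> y; exact: integral_bump_sin.
    by move=> i; have [] := cP i.
  by rewrite normr_prod; apply: ler_prod => i _; rewrite normr_ge0/=; have [] := cP i.
pose H (q : 'rV[R]_n * ('rV[R]_n * 'rV[R]_n)) :=
  (wgt N q.1 * (f q.2.1 * f q.2.2) * cos (dotv (q.2.1 - q.2.2) q.1))%:E.
have iH : (mu \x mu2)%E.-integrable setT H.
  have itt : mu2.-integrable setT (fun p => (f p.1 * f p.2)%:E) := integrable_tensor if_ if_.
  apply: integrableM_le1 (integrable_tensor iwgt itt).
  - apply: measurable_cos_dotv => //; apply: measurable_rVB => //.
      by apply: measurableT_comp => //; exact: measurableT_comp.
    by apply: measurableT_comp => //; exact: measurableT_comp.
  - by move=> q; exact: cos_max.
have -> : (\int[mu]_xi (wgt N xi * (cosT f xi ^+ 2 + sinT f xi ^+ 2))%:E =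
    \int[mu]_xi \int[mu2]_p H (xi, p))%E.
  apply: eq_integral => xi _; rewrite EFinM -cosT_sqr_sinT_sqr -integralZl//.
    by apply: eq_integral => p _; rewrite /H/= -EFinM !mulrA.
  apply: integrableM_le1 (integrable_tensor if_ if_); last by move=> p; exact: cos_max.
  by apply: measurable_cos_dotv => //; exact: measurable_rVB.
rewrite Fubini//.
have HE p : (\int[mu]_xi H (xi, p) = (f p.1 * f p.2 * c (p.1 - p.2))%:E)%E.
  rewrite EFinM -(cP (p.1 - p.2)).1 -integralZl//.
    by apply: eq_integral => xi _; rewrite /H/= -EFinM; congr (_%:E); ring.
  by apply: integrableM_le1 => //; [exact: measurable_cos_dotv|move=> x; exact: cos_max].
(* [c] comes from a pointwise choice and carries no measurability; that of
   [f p.1 * f p.2 * c (p.1 - p.2)] is read off from Fubini. *)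
have mG : measurable_fun setT (fun p => \int[mu]_xi H (xi, p))%E.
  exact: measurable_fubini_G iH.
have mf2 : measurable_fun setT (fun x => (f x ^+ 2)%:E).
  by apply/measurable_EFinP; exact: measurable_funX.
have mB (h : 'rV[R]_n * 'rV[R]_n -> 'rV[R]_n) : measurable_fun setT h ->
    measurable_fun setT (fun p : 'rV[R]_n * 'rV[R]_n =>
      (2^-1 * f (h p) ^+ 2 * cauchy_kernel N (p.1 - p.2))%:E).
  move=> mh; apply/measurable_EFinP; apply: measurable_funM.
    apply: measurable_funM => //; apply: measurable_funX; exact: measurableT_comp mf mh.
  by apply: (measurableT_comp (measurable_cauchy_kernel N)); exact: measurable_rVB.
have B0 (h : 'rV[R]_n * 'rV[R]_n -> 'rV[R]_n) p :
    (0 <= (2^-1 * f (h p) ^+ 2 * cauchy_kernel N (p.1 - p.2))%:E)%E.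
  by rewrite lee_fin mulr_ge0// mulr_ge0// ?sqr_ge0.
(* Schur's test: |f(x) f(y)| is at most half the sum of the two squares, and in each half the other
   variable is integrated out against the kernel, whose mass is [(16 * pi) ^+ n]. *)
apply: (@le_trans _ _ (\int[mu2]_p ((2^-1 * f p.1 ^+ 2 * cauchy_kernel N (p.1 - p.2))%:E +
   (2^-1 * f p.2 ^+ 2 * cauchy_kernel N (p.1 - p.2))%:E))%E).
  apply: (le_trans (lee_abs _)); apply: le_trans (le_abse_integral _ _ _) _ => //.
  apply: ge0_le_integral => //.
  - exact: measurableT_comp.
  - by apply: emeasurable_funD; [exact: (mB fst)|exact: (mB snd)].
  - move=> p _; rewrite HE abse_EFin -EFinD lee_fin !normrM -mulrDl.
    apply: ler_pM; rewrite ?mulr_ge0//; last exact: (cP _).2.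
    rewrite -[f p.1 ^+ 2]real_normK ?num_real// -[f p.2 ^+ 2]real_normK ?num_real//.
    have := sqr_ge0 (`|f p.1| - `|f p.2|); lra.
rewrite ge0_integralD//; [|exact: (mB fst)|exact: (mB snd)].
rewrite fubini_tonelli1//=; last exact: (mB fst).
rewrite fubini_tonelli2//=; last exact: (mB snd).
have half : ((2^-1)%:E * ((16 * pi) ^+ n)%:E * \int[mu]_x (f x ^+ 2)%:E +
  (2^-1)%:E * ((16 * pi) ^+ n)%:E * \int[mu]_x (f x ^+ 2)%:E <=
   ((16 * pi) ^+ n)%:E * \int[mu]_x (f x ^+ 2)%:E)%E.
  rewrite -ge0_muleDl ?lee_fin ?mulr_ge0 ?exprn_ge0 ?mulr_ge0 ?pi_ge0//.
  have -> : ((2^-1)%:E * ((16 * pi) ^+ n)%:E + (2^-1)%:E * ((16 * pi) ^+ n)%:E =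
      ((16 * pi) ^+ n)%:E :> \bar R)%E by rewrite -EFinM -EFinD; congr (_%:E); field.
  exact: lexx.
have K0 : (0 <= (2^-1)%:E * ((16 * pi) ^+ n)%:E :> \bar R)%E.
  by rewrite -EFinM lee_fin mulr_ge0// exprn_ge0// mulr_ge0// pi_ge0.
have mkx (x : 'rV[R]_n) : measurable_fun setT (fun y : 'rV[R]_n => (cauchy_kernel N (y - x))%:E).
  by apply/measurable_EFinP; apply: (measurableT_comp (measurable_cauchy_kernel N)); exact: measurable_rVB.
have eq_lee (a b : \bar R) : a = b -> (a <= b)%E by move=> ->.
apply: le_trans half; apply: leeD; rewrite -ge0_integralZl//;
  try by move=> x _; rewrite lee_fin sqr_ge0.
- apply: eq_lee; apply: eq_integral => x _; rewrite /fubini_F/=.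
  under eq_integral do rewrite EFinM kapC.
  rewrite ge0_integralZl_EFin//; last by rewrite mulr_ge0// sqr_ge0.
    by rewrite ikap -!EFinM mulrAC.
  by move=> y _; rewrite lee_fin.
- apply: eq_lee; apply: eq_integral => x _; rewrite /fubini_G/=.
  under eq_integral do rewrite EFinM.
  rewrite ge0_integralZl_EFin//; last by rewrite mulr_ge0// sqr_ge0.
    by rewrite ikap -!EFinM mulrAC.
  by move=> y _; rewrite lee_fin.
Qed.

Lemma bump_cvg1 (x : R) : bump k.+1%:R x @[k --> \oo] --> (1 : R).
Proof.
apply: (@squeeze_cvgr _ _ _ _ (fun k => 1 - (x * harmonic k) ^+ 2) (cst 1)).
- by apply: nearW => k; rewrite bump_le1 /bump le_max lexx orbT.
- rewrite [X in _ --> X](_ : (1 : R) = 1 - (x * 0) * (x * 0)); last by rewrite !mulr0 subr0.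
  apply: cvgB; first exact: cvg_cst.
  by apply: cvgM; apply: cvgM; (exact: cvg_cst || exact: cvg_harmonic).
- exact: cvg_cst.
Qed.

Lemma bessel :
  (\int[mu]_xi (cosT f xi ^+ 2 + sinT f xi ^+ 2)%:E <=
   ((16 * pi) ^+ n)%:E * \int[mu]_x (f x ^+ 2)%:E)%E.
Proof.
pose g xi := cosT f xi ^+ 2 + sinT f xi ^+ 2.
have g0 xi : 0 <= g xi by rewrite addr_ge0 ?sqr_ge0.
have mg : measurable_fun setT g.
  by apply: measurable_funD; apply: measurable_funX; [exact: measurable_cosT|exact: measurable_sinT].
pose h k xi := (wgt k.+1%:R xi * g xi)%:E.
have hcvg xi : h k xi @[k --> \oo] --> (g xi)%:E.
  apply: cvg_EFin; first exact: nearW.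
  rewrite -[g xi in X in _ --> X]mul1r; apply: cvgM; last exact: cvg_cst.
  rewrite /wgt; elim: (index_enum _) => [|i s IH].
    have : (fun=> 1) @ \oo --> (1 : R) by exact: cvg_cst.
    apply: cvg_trans.
    by apply: near_eq_cvg; apply: nearW => k; rewrite big_nil.
  have -> : (fun k => \prod_(i0 <- i :: s) bump k.+1%:R (xi 0 i0)) =
      (fun k => bump k.+1%:R (xi 0 i) * \prod_(j <- s) bump k.+1%:R (xi 0 j)).
    by apply/funext => k; rewrite big_cons.
  by rewrite -[X in _ --> X]mulr1; exact: cvgM (bump_cvg1 _) IH.
(* The truncated bounds are uniform in [N]; writing the integrand as a lower limit of truncated ones
   lets Fatou's lemma remove the weight. *)
have -> : (\int[mu]_xi (g xi)%:E = \int[mu]_xi limn_einf (h ^~ xi))%E.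
  by apply: eq_integral => xi _; rewrite (cvg_limn_einf_sup (hcvg xi)).1.
have w0 k xi : 0 <= wgt k.+1%:R xi by apply: prodr_ge0 => i _; exact: bump_ge0.
apply: le_trans (fatou _ _ _ _) _ => //.
- move=> k; apply/measurable_EFinP; apply: measurable_funM => //.
  exact: (measurable_prod_coord (fun=> measurable_bump _)).
- by move=> k xi _; rewrite lee_fin mulr_ge0.
rewrite limn_einf_lim; apply: lime_le; first exact: is_cvg_einfs.
apply: nearW => k; apply: le_trans (bessel_wgt (ltr0Sn _ k)).
by apply: ereal_inf_lbound; exists k => //=.
Qed.

Lemma cosT_le xi : `|cosT f xi| <= \int[mu]_x `|f x|.
Proof.
apply: (le_trans (le_normr_Rintegral measurableT (integrable_cos xi))).
apply: le_Rintegral => //.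
- by apply: integrable_norm; exact: integrable_cos.
- exact: integrable_norm.
- by move=> x _; rewrite normrM ler_piMr// cos_max.
Qed.

Lemma sinT_le xi : `|sinT f xi| <= \int[mu]_x `|f x|.
Proof.
apply: (le_trans (le_normr_Rintegral measurableT (integrable_sin xi))).
apply: le_Rintegral => //.
- by apply: integrable_norm; exact: integrable_sin.
- exact: integrable_norm.
- by move=> x _; rewrite normrM ler_piMr// sin_max.
Qed.

End integrable.
End bessel.

(** * Weighted L2 bounds for the transform of L^m data *)

Section weighted_interpolation.
Variables (R : realType) (n : nat).
Local Notation mu := (lebesgue_rV R n).

(** The function z^(m-1) is nondecreasing for [1 <= m]. Applied to the values of |f| above height
    [lam], this puts the large part of an L^m function in L^1. *)
Lemma le_powR_split (m lam y : R) : 1 <= m -> 0 < lam -> lam <= y ->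
  y <= lam / lam `^ m * y `^ m.
Proof.
move=> m1 l0 ly; have y0 : 0 < y by exact: lt_le_trans ly.
rewrite mulrAC ler_pdivlMr ?powR_gt0//.
have hp z : 0 < z -> z `^ m = z * z `^ (m - 1).
  move=> z0; rewrite -{2}(powRr1 (ltW z0)) -powRD; first by congr (_ `^ _); ring.
  by rewrite (gt_eqF z0) implybT.
rewrite (hp _ l0) (hp _ y0) mulrCA ler_pM2l// ler_pM2l//.
by apply: ge0_ler_powR; rewrite ?nnegrE ?subr_ge0// ltW.
Qed.

(** Counterpart below the height: z^(2-m) is nondecreasing for [m <= 2], which puts the small part
    of an L^m function in L^2. *)
Lemma sqr_le_powR_split (m lam y : R) : m <= 2 -> 0 < lam -> 0 <= y <= lam ->
  y ^+ 2 <= lam ^+ 2 / lam `^ m * y `^ m.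
Proof.
move=> m2 l0 /andP[]; rewrite le_eqVlt => /predU1P[<- _|y0 ly].
  by rewrite expr0n mulr_ge0 ?powR_ge0// divr_ge0 ?powR_ge0// sqr_ge0.
rewrite mulrAC ler_pdivlMr ?powR_gt0//.
have hp z : 0 < z -> z ^+ 2 = z `^ m * z `^ (2 - m).
  move=> z0; rewrite -powR_mulrn ?ltW// -powRD; first by congr (_ `^ _); ring.
  by rewrite (gt_eqF z0) implybT.
have key : y `^ (2 - m) <= lam `^ (2 - m).
  by apply: ge0_ler_powR; rewrite ?nnegrE ?subr_ge0// ltW.
have := ler_wpM2l (mulr_ge0 (powR_ge0 y m) (powR_ge0 lam m)) key.
rewrite (hp _ l0) (hp _ y0); lra.
Qed.

Variables (f : 'rV[R]_n -> R) (mf : measurable_fun setT f).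
Hypothesis if_ : mu.-integrable setT (EFin \o f).

(* The two pieces of [f] above and below height [lam] are estimated on the
   Fourier side in L^oo and in L^2 respectively; [lam] balances both bounds. *)
Lemma weighted_interpolation (W : 'rV[R]_n -> R) (B V m lam : R) :
  measurable_fun setT W -> (forall xi, 0 <= W xi <= B) -> 0 < V -> 0 < lam ->
  1 <= m <= 2 ->
  (\int[mu]_xi (W xi)%:E <= (B * V)%:E)%E ->
  (\int[mu]_x (`|f x| `^ m)%:E <= (lam `^ m / V)%:E)%E ->
  (\int[mu]_xi (W xi * (cosT f xi ^+ 2 + sinT f xi ^+ 2))%:E <=
   ((4 + 2 * (16 * pi) ^+ n) * (B * lam ^+ 2 / V))%:E)%E.
Proof.
move=> mW WB V0 l0 /andP[m1 m2] intW intf.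
have W0 xi : 0 <= W xi by have /andP[] := WB xi.
have WleB xi : W xi <= B by have /andP[] := WB xi.
have B0 : 0 <= B := le_trans (W0 0) (WleB 0).
pose big x := lam < `|f x|.
have mbig : measurable_fun setT big by apply: measurable_fun_ltr => //; exact: measurableT_comp.
pose f1 x := if big x then f x else 0.
pose f2 x := if big x then 0 else f x.
have mf1 : measurable_fun setT f1 by exact: measurable_fun_ifT.
have mf2 : measurable_fun setT f2 by exact: measurable_fun_ifT.
have if1 : mu.-integrable setT (EFin \o f1).
  apply: le_integrable if_ => //; first exact/measurable_EFinP.
  by move=> x _; rewrite /= lee_fin /f1; case: ifP => //; rewrite normr0.
have if2 : mu.-integrable setT (EFin \o f2).
  apply: le_integrable if_ => //; first exact/measurable_EFinP.
  by move=> x _; rewrite /= lee_fin /f2; case: ifP => //; rewrite normr0.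
have fE x : f x = f1 x + f2 x by rewrite /f1 /f2; case: ifP; rewrite ?addr0 ?add0r.
have cE xi : cosT f xi = cosT f1 xi + cosT f2 xi.
  rewrite /cosT -RintegralD//; [|exact: integrable_cos|exact: integrable_cos].
  by apply: eq_Rintegral => x _; rewrite fE mulrDl.
have sE xi : sinT f xi = sinT f1 xi + sinT f2 xi.
  rewrite /sinT -RintegralD//; [|exact: integrable_sin|exact: integrable_sin].
  by apply: eq_Rintegral => x _; rewrite fE mulrDl.
have mfm : measurable_fun setT (fun x => (`|f x| `^ m)%:E).
  apply/measurable_EFinP; apply: (measurableT_comp (measurable_powR m)).
  exact: measurableT_comp.
have lm0 : 0 < lam `^ m by exact: powR_gt0.
(* Chebyshev's inequality in a form shared by both pieces: with [c = lam] it bounds the L^1 norm of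
   [f1], with [c = lam ^+ 2] the squared L^2 norm of [f2]. *)
have split_int (g : 'rV[R]_n -> R) (c : R) : measurable_fun setT g ->
    (forall x, 0 <= g x <= c / lam `^ m * `|f x| `^ m) -> 0 <= c ->
    (\int[mu]_x (g x)%:E <= (c / V)%:E)%E.
  move=> mg gb c0.
  have cm0 : 0 <= c / lam `^ m by rewrite divr_ge0 ?(ltW lm0) ?(ltW l0) ?(ltW V0).
  apply: (@le_trans _ _ ((c / lam `^ m)%:E * \int[mu]_x (`|f x| `^ m)%:E)%E).
    rewrite -ge0_integralZl_EFin//.
    apply: ge0_le_integral => //.
    - by move=> x _; rewrite lee_fin; have /andP[] := gb x.
    - exact/measurable_EFinP.
    - exact: measurable_funeM.
    - by move=> x _; rewrite -EFinM lee_fin; have /andP[] := gb x.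
  rewrite (_ : c / V = c / lam `^ m * (lam `^ m / V)); last by field; rewrite !gt_eqF.
  by rewrite [leRHS]EFinM lee_wpmul2l.
have n1 : \int[mu]_x `|f1 x| <= lam / V.
  rewrite -lee_fin fineK; last by apply: integrable_fin_num => //; exact: integrable_norm.
  apply: split_int; [exact: measurableT_comp| |exact: ltW].
  move=> x; rewrite normr_ge0/= /f1 /big; case: ifPn => [/ltW lx|_].
    exact: le_powR_split.
  by rewrite normr0 mulr_ge0 ?powR_ge0// divr_ge0 ?ltW.
have n2 : (\int[mu]_x (f2 x ^+ 2)%:E <= (lam ^+ 2 / V)%:E)%E.
  apply: split_int; [exact: measurable_funX| |exact: sqr_ge0].
  move=> x; rewrite sqr_ge0/= /f2 /big; case: ifPn => [_|].
    by rewrite expr0n mulr_ge0 ?powR_ge0// divr_ge0 ?sqr_ge0 ?ltW.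
  rewrite -leNgt => lx; rewrite -real_normK ?num_real//.
  by apply: sqr_le_powR_split; rewrite ?normr_ge0.
pose g2 xi := cosT f2 xi ^+ 2 + sinT f2 xi ^+ 2.
have mg2 : measurable_fun setT (fun xi => (g2 xi)%:E).
  apply/measurable_EFinP.
  by apply: measurable_funD; apply: measurable_funX; [exact: measurable_cosT|exact: measurable_sinT].
have mWE : measurable_fun setT (fun xi => (W xi)%:E) by exact/measurable_EFinP.
have g20 xi : 0 <= g2 xi by rewrite addr_ge0 ?sqr_ge0.
(* Both transforms of [f1] are at most [lam / V] in modulus, so their squares add up to 2 (lam /
   V)^2; splitting (a + b)^2 <= 2 a^2 + 2 b^2 doubles this, and gives the factor 2 in front of
   [g2]. *)
apply: (@le_trans _ _ ((4 * (lam / V) ^+ 2)%:E * (\int[mu]_xi (W xi)%:E) +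
   (2 * B)%:E * (\int[mu]_xi (g2 xi)%:E))%E).
  have A0 : 0 <= 4 * (lam / V) ^+ 2 by rewrite mulr_ge0// sqr_ge0.
  have B20 : 0 <= 2 * B by rewrite mulr_ge0.
  rewrite -!ge0_integralZl_EFin//; try by move=> x _; rewrite lee_fin.
  rewrite -ge0_integralD//; first last.
  - exact: measurable_funeM.
  - by move=> x _; rewrite -EFinM lee_fin mulr_ge0.
  - exact: measurable_funeM.
  - by move=> x _; rewrite -EFinM lee_fin mulr_ge0.
  apply: ge0_le_integral => //.
  - by move=> x _; rewrite lee_fin mulr_ge0// addr_ge0 ?sqr_ge0.
  - apply/measurable_EFinP; apply: measurable_funM => //.
    by apply: measurable_funD; apply: measurable_funX; [exact: measurable_cosT|exact: measurable_sinT].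
  - by apply: emeasurable_funD; exact: measurable_funeM.
  move=> xi _; rewrite -!EFinM -EFinD lee_fin cE sE.
  have sq a b : (a + b) ^+ 2 <= 2 * a ^+ 2 + 2 * b ^+ 2 :> R.
    have := sqr_ge0 (a - b); lra.
  have bd a : `|a| <= lam / V -> a ^+ 2 <= (lam / V) ^+ 2.
    move=> h; rewrite -real_normK ?num_real// ler_pXn2r ?nnegrE//.
    by rewrite divr_ge0 ?(ltW lm0) ?(ltW l0) ?(ltW V0).
  have c1 := bd _ (le_trans (cosT_le if1 xi) n1).
  have s1 := bd _ (le_trans (sinT_le if1 xi) n1).
  have h : (cosT f1 xi + cosT f2 xi) ^+ 2 + (sinT f1 xi + sinT f2 xi) ^+ 2 <=
     4 * (lam / V) ^+ 2 + 2 * g2 xi.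
    have := sq (cosT f1 xi) (cosT f2 xi); have := sq (sinT f1 xi) (sinT f2 xi).
    by rewrite /g2; lra.
  apply: (le_trans (ler_wpM2l (W0 xi) h)); rewrite mulrDr.
  rewrite mulrC lerD2l mulrCA -mulrA ler_wpM2l// ler_wpM2r//.
have -> : (4 + 2 * (16 * pi) ^+ n) * (B * lam ^+ 2 / V) = 4 * (lam / V) ^+ 2 * (B * V) +
    2 * B * ((16 * pi) ^+ n * (lam ^+ 2 / V)) by field; rewrite gt_eqF.
rewrite EFinD; apply: leeD.
  by rewrite [leRHS]EFinM lee_wpmul2l// lee_fin mulr_ge0// sqr_ge0.
rewrite [leRHS]EFinM lee_wpmul2l//; first by rewrite lee_fin mulr_ge0.
apply: (le_trans (bessel mf2 if2)).
by rewrite [leRHS]EFinM lee_wpmul2l// lee_fin exprn_ge0// mulr_ge0// pi_ge0.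
Qed.

End weighted_interpolation.

(** * Complex-valued functions and the passage from L^1 to L^m *)

Section complex_fourier.
Variables (R : realType) (n : nat).
Local Notation C := R[i].
Local Notation mu := (lebesgue_rV R n).
Local Notation normc := ComplexField.Normc.normc.
Local Notation ReC := complex.Re.
Local Notation ImC := complex.Im.
Implicit Types f g F : 'rV[R]_n -> C.

Lemma normc_sqr (z : C) : normc z ^+ 2 = ReC z ^+ 2 + ImC z ^+ 2.
Proof. by case: z => a b /=; rewrite sqr_sqrtr// addr_ge0 ?sqr_ge0. Qed.

Lemma normc_ge0 (z : C) : 0 <= normc z.
Proof. by case: z => a b /=; exact: sqrtr_ge0. Qed.

Lemma normr_Re_le (z : C) : `|ReC z| <= normc z.
Proof.
rewrite -(@ler_pXn2r _ 2)// ?nnegrE ?normc_ge0// normc_sqr.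
by rewrite real_normK ?num_real// lerDl sqr_ge0.
Qed.

Lemma normr_Im_le (z : C) : `|ImC z| <= normc z.
Proof.
rewrite -(@ler_pXn2r _ 2)// ?nnegrE ?normc_ge0// normc_sqr.
by rewrite real_normK ?num_real// lerDr sqr_ge0.
Qed.

Lemma normc_sqr_triangle (y z : C) :
  normc y ^+ 2 <= 2 * normc (y - z) ^+ 2 + 2 * normc z ^+ 2.
Proof.
rewrite !normc_sqr; case: y => a b; case: z => c d /=.
have := sqr_ge0 (a - 2 * c); have := sqr_ge0 (b - 2 * d); lra.
Qed.

Lemma measurable_normc f : Defs.measurableC f -> measurable_fun setT (fun x => normc (f x)).
Proof.
move=> [mr mi]; rewrite (_ : (fun x => _) = fun x => Num.sqrt (ReC (f x) ^+ 2 + ImC (f x) ^+ 2)).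
  apply: measurableT_comp; first exact: (continuous_measurable_fun (@sqrt_continuous R)).
  by apply: measurable_funD; exact: measurable_funX.
by apply/funext => x; case: (f x).
Qed.

Lemma LnormC_leP (m : R) f (N : R) : 0 < m -> 0 <= N -> (LnormC m%:E f <= N%:E)%E ->
  (\int[mu]_x (normc (f x) `^ m)%:E <= (N `^ m)%:E)%E.
Proof.
move=> m0 N0 fN.
have -> : (\int[mu]_x (normc (f x) `^ m)%:E = (LnormC m%:E f `^ m)%E)%E.
  rewrite /LnormC poweR_Lnorm; last by rewrite gt_eqF.
  apply: eq_integral => x _.
  by rewrite abse_EFin ger0_norm ?normc_ge0// poweR_EFin.
rewrite -poweR_EFin; apply: gt0_ler_poweR => //; first exact: ltW.
- by rewrite in_itv/= leey andbT; exact: Lnorm_ge0.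
- by rewrite in_itv/= leey andbT lee_fin.
Qed.

Lemma LnormC2_le f (X : R) : 0 <= X ->
  (\int[mu]_x (normc (f x) ^+ 2)%:E <= (X ^+ 2)%:E)%E -> (LnormC 2%:E f <= X%:E)%E.
Proof.
move=> X0 h; rewrite /LnormC unlock.
under eq_integral do rewrite abse_EFin ger0_norm ?normc_ge0// poweR_EFin powR_mulrn ?normc_ge0//.
have -> : X%:E = ((X ^+ 2)%:E `^ 2^-1)%E.
  by rewrite poweR_EFin -powR_mulrn// -powRrM mulfV// powRr1.
apply: gt0_ler_poweR => //.
- rewrite in_itv/= leey andbT; apply: integral_ge0 => x _.
  by rewrite lee_fin sqr_ge0.
- by rewrite in_itv/= leey andbT lee_fin sqr_ge0.
Qed.

Section transform.
Variable g : 'rV[R]_n -> C.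
Hypothesis ir : mu.-integrable setT (fun x => (ReC (g x))%:E).
Hypothesis ii : mu.-integrable setT (fun x => (ImC (g x))%:E).
Let a x := ReC (g x).
Let b x := ImC (g x).

Lemma fourierE xi : fourier g xi = (cosT a xi + sinT b xi) +i* (cosT b xi - sinT a xi).
Proof.
rewrite /fourier /integralC; congr (_ +i* _).
- rewrite /cosT /sinT -RintegralD//; [|exact: integrable_cos|exact: integrable_sin].
  apply: eq_Rintegral => x _; rewrite /cis /a /b; case: (g x) => u v /=.
  by rewrite cosN sinN; ring.
- rewrite /cosT /sinT -RintegralB//; [|exact: integrable_cos|exact: integrable_sin].
  apply: eq_Rintegral => x _; rewrite /cis /a /b; case: (g x) => u v /=.
  by rewrite cosN sinN; ring.
Qed.

Lemma dotvC (x y : 'rV[R]_n) : dotv x y = dotv y x.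
Proof. by apply: eq_bigr => i _; rewrite mulrC. Qed.

Lemma ifourierE xi : ifourier g xi =
  (((2 * pi) ^+ n)^-1)%:C * ((cosT a xi - sinT b xi) +i* (cosT b xi + sinT a xi)).
Proof.
rewrite /ifourier /integralC; congr (_ * (_ +i* _)).
- rewrite /cosT /sinT -RintegralB//; [|exact: integrable_cos|exact: integrable_sin].
  apply: eq_Rintegral => x _; rewrite /cis /a /b dotvC; case: (g x) => u v /=; ring.
- rewrite /cosT /sinT -RintegralD//; [|exact: integrable_cos|exact: integrable_sin].
  apply: eq_Rintegral => x _; rewrite /cis /a /b dotvC; case: (g x) => u v /=; ring.
Qed.

Lemma fourier_sqr_le xi : normc (fourier g xi) ^+ 2 <=
  2 * (cosT a xi ^+ 2 + sinT a xi ^+ 2) + 2 * (cosT b xi ^+ 2 + sinT b xi ^+ 2).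
Proof.
rewrite fourierE normc_sqr /=.
have := sqr_ge0 (cosT a xi - sinT b xi); have := sqr_ge0 (cosT b xi + sinT a xi); lra.
Qed.

Lemma ifourier_sqr_le xi : normc (ifourier g xi) ^+ 2 <= (((2 * pi) ^+ n)^-1) ^+ 2 *
  (2 * (cosT a xi ^+ 2 + sinT a xi ^+ 2) + 2 * (cosT b xi ^+ 2 + sinT b xi ^+ 2)).
Proof.
rewrite ifourierE normc_sqr /= !mul0r subr0 addr0 !exprMn -mulrDr ler_wpM2l ?sqr_ge0//.
have := sqr_ge0 (cosT a xi + sinT b xi); have := sqr_ge0 (cosT b xi - sinT a xi); lra.
Qed.

Let mr : measurable_fun setT a.
Proof. by apply/measurable_EFinP; case/integrableP: ir. Qed.

Let mi : measurable_fun setT b.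
Proof. by apply/measurable_EFinP; case/integrableP: ii. Qed.

Lemma measurable_fourier : Defs.measurableC (fourier g).
Proof.
split; under eq_fun do rewrite fourierE /=.
- by apply: measurable_funD; [exact: measurable_cosT|exact: measurable_sinT].
- by apply: measurable_funB; [exact: measurable_cosT|exact: measurable_sinT].
Qed.

Lemma measurable_ifourier : Defs.measurableC (ifourier g).
Proof.
split; under eq_fun do rewrite ifourierE /=.
- apply: measurable_funB; apply: measurable_funM => //.
  + by apply: measurable_funB; [exact: measurable_cosT|exact: measurable_sinT].
  + by apply: measurable_funD; [exact: measurable_cosT|exact: measurable_sinT].
- apply: measurable_funD; apply: measurable_funM => //.
  + by apply: measurable_funD; [exact: measurable_cosT|exact: measurable_sinT].
  + by apply: measurable_funB; [exact: measurable_cosT|exact: measurable_sinT].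
Qed.

(** The leading 2 comes from separating real and imaginary parts, the squared inverse from the
    normalization of the inverse transform, and the last factor from [bessel]. *)
Definition ifourier_const : R := 2 * (((2 * pi) ^+ n)^-1) ^+ 2 * (16 * pi) ^+ n.

Lemma ifourier_const_ge0 : 0 <= ifourier_const.
Proof.
rewrite /ifourier_const; apply: mulr_ge0; first by rewrite mulr_ge0 ?sqr_ge0.
by rewrite exprn_ge0// mulr_ge0// pi_ge0.
Qed.

Lemma integral_ifourier_sqr :
  (\int[mu]_x (normc (ifourier g x) ^+ 2)%:E <=
    ifourier_const%:E * \int[mu]_x (normc (g x) ^+ 2)%:E)%E.
Proof.
have mI := measurable_normc measurable_ifourier.
set c := (((2 * pi) ^+ n)^-1 : R) ^+ 2; set K := (16 * pi : R) ^+ n.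
have c0 : 0 <= 2 * c by rewrite mulr_ge0// sqr_ge0.
have K0 : 0 <= K by rewrite exprn_ge0// mulr_ge0// pi_ge0.
have mg (h : 'rV[R]_n -> R) : measurable_fun setT h ->
    measurable_fun setT (fun x => (cosT h x ^+ 2 + sinT h x ^+ 2)%:E).
  move=> mh; apply/measurable_EFinP; apply: measurable_funD; apply: measurable_funX.
    exact: measurable_cosT.
  exact: measurable_sinT.
have g0 (h : 'rV[R]_n -> R) x : 0 <= cosT h x ^+ 2 + sinT h x ^+ 2.
  by rewrite addr_ge0 ?sqr_ge0.
apply: (@le_trans _ _ ((2 * c)%:E * \int[mu]_x (cosT a x ^+ 2 + sinT a x ^+ 2)%:E +
   (2 * c)%:E * \int[mu]_x (cosT b x ^+ 2 + sinT b x ^+ 2)%:E)%E).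
  rewrite -!ge0_integralZl_EFin//; try by [exact: mg|move=> x _; rewrite lee_fin].
  rewrite -ge0_integralD//; try by [apply: measurable_funeM; exact: mg|
    move=> x _; rewrite -EFinM lee_fin mulr_ge0].
  apply: ge0_le_integral => //.
  - by move=> x _; rewrite lee_fin sqr_ge0.
  - by apply/measurable_EFinP; apply: measurable_funX; exact: mI.
  - by apply: emeasurable_funD; apply: measurable_funeM; exact: mg.
  - move=> x _; rewrite -!EFinM -EFinD lee_fin; apply: le_trans (ifourier_sqr_le x) _.
    rewrite -/c; lra.
have -> : (\int[mu]_x (normc (g x) ^+ 2)%:E =
    \int[mu]_x (a x ^+ 2)%:E + \int[mu]_x (b x ^+ 2)%:E)%E.
  rewrite -ge0_integralD//; try by [apply/measurable_EFinP; exact: measurable_funX|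
    move=> x _; rewrite lee_fin sqr_ge0].
  by apply: eq_integral => x _; rewrite normc_sqr.
have IA : (0 <= \int[mu]_x (a x ^+ 2)%:E)%E.
  by apply: integral_ge0 => x _; rewrite lee_fin sqr_ge0.
have IB : (0 <= \int[mu]_x (b x ^+ 2)%:E)%E.
  by apply: integral_ge0 => x _; rewrite lee_fin sqr_ge0.
have bA := bessel mr ir; have bB := bessel mi ii.
have cE : ifourier_const%:E = ((2 * c)%:E * K%:E)%E by rewrite -EFinM.
rewrite (ge0_muleDr _ IA IB) cE -!muleA.
by apply: leeD; apply: lee_wpmul2l; rewrite ?lee_fin.
Qed.

End transform.

Lemma memL1_integrable g : memLp 1%E g ->
  mu.-integrable setT (fun x => (ReC (g x))%:E) /\
  mu.-integrable setT (fun x => (ImC (g x))%:E).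
Proof.
move=> [[mr mi] g1].
have ig : mu.-integrable setT (EFin \o (fun x => normc (g x))).
  apply/integrableP; split; first by apply/measurable_EFinP; exact: measurable_normc.
  by move: g1; rewrite /LnormC Lnorm1.
split; apply: (@integrable_le _ _ _ _ _ (fun x => normc (g x))) => //.
  by move=> x; exact: normr_Re_le.
by move=> x; exact: normr_Im_le.
Qed.

Section weight.
Variables (W : 'rV[R]_n -> R) (B V : R).
Hypothesis mW : measurable_fun setT W.
Hypothesis WB : forall xi, 0 <= W xi <= B.
Hypothesis V0 : 0 < V.
Hypothesis intW : (\int[mu]_xi (W xi)%:E <= (B * V)%:E)%E.

Let W0 xi : 0 <= W xi. Proof. by have /andP[] := WB xi. Qed.

Let WleB xi : W xi <= B. Proof. by have /andP[] := WB xi. Qed.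

Let B0 : 0 <= B. Proof. exact: le_trans (W0 0) (WleB 0). Qed.

(** The inner factor is the constant of [weighted_interpolation]; 4 is 2 for the cross terms of
    [fourier_sqr_le] times 2 for the real and imaginary parts. *)
Definition fourier_const : R := 4 * (4 + 2 * (16 * pi) ^+ n).

Lemma fourier_const_ge0 : 0 <= fourier_const.
Proof. by rewrite mulr_ge0// addr_ge0// mulr_ge0// exprn_ge0// mulr_ge0// pi_ge0. Qed.

Lemma weighted_fourier_L1 g (m lam : R) : 1 <= m <= 2 -> 0 < lam -> memLp 1%E g ->
  (\int[mu]_x (normc (g x) `^ m)%:E <= (lam `^ m / V)%:E)%E ->
  (\int[mu]_xi (W xi * normc (fourier g xi) ^+ 2)%:E <= (fourier_const * (B * lam ^+ 2 / V))%:E)%E.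
Proof.
move=> m12 l0 g1 gm; have [ir ii] := memL1_integrable g1.
have [[mr mi] _] := g1; have /andP[m1 m2] := m12.
have mn : measurable_fun setT (fun x => (normc (g x) `^ m)%:E).
  apply/measurable_EFinP; apply: (measurableT_comp (measurable_powR m)).
  exact: measurable_normc.
have part (h : 'rV[R]_n -> R) : measurable_fun setT h -> (forall x, `|h x| <= normc (g x)) ->
    (\int[mu]_x (`|h x| `^ m)%:E <= (lam `^ m / V)%:E)%E.
  move=> mh hg; apply: le_trans gm; apply: ge0_le_integral => //.
  - apply/measurable_EFinP; apply: (measurableT_comp (measurable_powR m)).
    exact: measurableT_comp.
  - move=> x _; rewrite lee_fin; apply: ge0_ler_powR; rewrite ?nnegrE ?normc_ge0//.
    exact: le_trans m1.
have pr := weighted_interpolation mr ir mW WB V0 l0 m12 intW (part _ mr (fun x => normr_Re_le (g x))).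
have pi_ := weighted_interpolation mi ii mW WB V0 l0 m12 intW (part _ mi (fun x => normr_Im_le (g x))).
have mg (h : 'rV[R]_n -> R) : measurable_fun setT h ->
    measurable_fun setT (fun x => (W x * (cosT h x ^+ 2 + sinT h x ^+ 2))%:E).
  move=> mh; apply/measurable_EFinP; apply: measurable_funM => //.
  apply: measurable_funD; apply: measurable_funX.
    exact: measurable_cosT.
  exact: measurable_sinT.
have g0 (h : 'rV[R]_n -> R) x : (0 <= (W x * (cosT h x ^+ 2 + sinT h x ^+ 2))%:E)%E.
  by rewrite lee_fin mulr_ge0// addr_ge0 ?sqr_ge0.
have mF := measurable_normc (measurable_fourier ir ii).
have two (x y : \bar R) (c : R) : (x <= c%:E -> y <= c%:E ->
    2%:E * x + 2%:E * y <= (4 * c)%:E)%E.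
  move=> xc yc; rewrite (_ : 4 * c = 2 * c + 2 * c); last by ring.
  rewrite [leRHS]EFinD; apply: leeD; rewrite [leRHS]EFinM.
    exact: lee_wpmul2l.
  exact: lee_wpmul2l.
rewrite /fourier_const -mulrA; apply: le_trans (two _ _ _ pr pi_).
rewrite -!ge0_integralZl_EFin//; [|exact: mg|exact: mg].
rewrite -ge0_integralD//; [|by move=> x _; rewrite mule_ge0|apply: measurable_funeM; exact: mg
  |by move=> x _; rewrite mule_ge0|apply: measurable_funeM; exact: mg].
apply: ge0_le_integral => //.
- by move=> x _; rewrite lee_fin mulr_ge0// sqr_ge0.
- by apply/measurable_EFinP; apply: measurable_funM => //; exact: measurable_funX.
- by apply: emeasurable_funD; apply: measurable_funeM; exact: mg.
- move=> x _; rewrite -!EFinM -EFinD lee_fin.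
  apply: (le_trans (ler_wpM2l (W0 x) (fourier_sqr_le ir ii x))); lra.
Qed.

(* [|z|^2 <= d^2 + d^(2 - q) |z|^q] when [2 <= q]: smallness in [L^q] gives
   smallness in [L^2(W)] without Hoelder's inequality. *)
Lemma weighted_sqr_small (m e : R) : 1 <= m <= 2 -> 0 < e ->
  exists2 d : R, 0 < d & forall h, Defs.measurableC h ->
    (LnormC (hoelder_conjugate m%:E) h <= d%:E)%E ->
    (\int[mu]_xi (W xi * normc (h xi) ^+ 2)%:E <= e%:E)%E.
Proof.
move=> /andP[m1 m2] e0.
(* The summand 1 keeps the divisor positive when [B] is 0; the same device reappears in
   [B * k + 1]. *)
pose D := B * V + 1.
have D0 : 0 < D by rewrite ltr_wpDl// mulr_ge0// ltW.
pose d := Num.sqrt (e / 2 / D).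
have d0 : 0 < d by rewrite sqrtr_gt0 !divr_gt0.
have d2 : d ^+ 2 = e / 2 / D by rewrite sqr_sqrtr// !divr_ge0// ltW.
have dD : d ^+ 2 * (B * V) <= e / 2.
  rewrite d2 mulrAC ler_pdivrMr// ler_wpM2l ?divr_ge0 ?(ltW e0)//.
  by rewrite /D lerDl.
have mWE : measurable_fun setT (fun xi => (W xi)%:E) by exact/measurable_EFinP.
have mWh h : Defs.measurableC h -> measurable_fun setT (fun xi => (W xi * normc (h xi) ^+ 2)%:E).
  move=> mh; apply/measurable_EFinP; apply: measurable_funM => //.
  by apply: measurable_funX; exact: measurable_normc.
have base : (\int[mu]_xi ((d ^+ 2)%:E * (W xi)%:E) <= (e / 2)%:E)%E.
  rewrite ge0_integralZl_EFin ?sqr_ge0//; last by move=> x _; rewrite lee_fin.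
  apply: le_trans (_ : (d ^+ 2 * (B * V))%:E <= _)%E; last by rewrite lee_fin.
  by rewrite [leRHS]EFinM lee_wpmul2l// lee_fin sqr_ge0.
have [m1e|m1n] := eqVneq m 1.
  exists d => // h mh hd.
  have ae : {ae mu, forall x, normc (h x) <= d}.
    (* For [m = 1] the conjugate exponent is infinite. The norm is then an essential supremum only
       if the space has positive measure; in the other case every property holds almost
       everywhere. *)
    move: hd; rewrite m1e hoelder_conjugate1 /LnormC unlock; case: ifPn => mu0.
      move=> /ess_supP; apply: filterS => x /=.
      by rewrite lee_fin ger0_norm ?normc_ge0.
    move=> _; have muT : mu setT = 0%E.
      by apply/eqP; rewrite eq_le measure_ge0 andbT leNgt.
    by exists setT; split.
  apply: (@le_trans _ _ (e / 2)%:E); last by rewrite lee_fin; lra.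
  apply: le_trans base; apply: ae_ge0_le_integral => //.
  - by move=> x _; rewrite lee_fin mulr_ge0// sqr_ge0.
  - exact: mWh.
  - by move=> x _; rewrite -EFinM lee_fin mulr_ge0// sqr_ge0.
  - exact: measurable_funeM.
  - apply: filterS ae => x hx _; rewrite -EFinM lee_fin mulrC ler_wpM2r//.
    by rewrite ler_pXn2r ?nnegrE ?normc_ge0// ltW.
have m1' : 1 < m by rewrite lt_def m1n.
pose q := m / (m - 1).
have qE : hoelder_conjugate m%:E = q%:E.
  rewrite /hoelder_conjugate eqe (gt_eqF (lt_trans ltr01 m1'))/=.
  by rewrite -EFinB inver subr_eq0 (negbTE m1n).
have q2 : 2 <= q by rewrite ler_pdivlMr ?subr_gt0//; lra.
have q0 : 0 < q by lra.
(* This is d^(2-q): where |h| > d, one has |h|^2 <= k |h|^q because q >= 2. Where |h| <= d, the term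
   d^2 W suffices. *)
pose k : R := d ^+ 2 / d `^ q.
have k0 : 0 <= k by rewrite divr_ge0 ?sqr_ge0 ?powR_ge0.
pose d' := (e / 2 / (B * k + 1)) `^ q^-1.
have Bk : 0 <= B * k by exact: mulr_ge0.
have Bk0 : 0 < B * k + 1 by exact: ltr_wpDl.
have d'0 : 0 < d' by rewrite powR_gt0// !divr_gt0.
exists d' => // h mh; rewrite qE => /(LnormC_leP q0 (ltW d'0)).
rewrite /d' -powRrM mulVf ?gt_eqF// powRr1 ?divr_ge0 ?(ltW e0) ?(ltW Bk0)// => hq.
have mq : measurable_fun setT (fun x => (normc (h x) `^ q)%:E).
  apply/measurable_EFinP; apply: (measurableT_comp (measurable_powR q)).
  exact: measurable_normc.
apply: (@le_trans _ _ (\int[mu]_xi ((d ^+ 2)%:E * (W xi)%:E) +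
    (B * k)%:E * \int[mu]_x (normc (h x) `^ q)%:E)%E); last first.
  rewrite (splitr e) [leRHS]EFinD; apply: leeD => //.
  apply: le_trans (_ : ((B * k) * (e / 2 / (B * k + 1)))%:E <= _)%E.
    by rewrite [leRHS]EFinM lee_wpmul2l// lee_fin.
  rewrite lee_fin mulrA ler_pdivrMr// mulrC ler_wpM2l ?divr_ge0 ?(ltW e0)// lerDl//.
rewrite -ge0_integralZl_EFin//; last by move=> x _; rewrite lee_fin powR_ge0.
rewrite -ge0_integralD//; [|by move=> x _; rewrite -EFinM lee_fin mulr_ge0// sqr_ge0
  |exact: measurable_funeM
  |by move=> x _; rewrite -EFinM lee_fin mulr_ge0 ?powR_ge0|exact: measurable_funeM].
apply: ge0_le_integral => //.
- by move=> x _; rewrite lee_fin mulr_ge0// sqr_ge0.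
- exact: mWh.
- by apply: emeasurable_funD; exact: measurable_funeM.
move=> x _; rewrite -!EFinM -EFinD lee_fin.
have h0 := normc_ge0 (h x); have P0 : 0 <= B * k * normc (h x) `^ q.
  by rewrite mulr_ge0 ?powR_ge0.
have [hd|hd] := leP (normc (h x)) d.
  have : normc (h x) ^+ 2 <= d ^+ 2 by rewrite ler_pXn2r ?nnegrE// ltW.
  by move=> /(ler_wpM2l (W0 x)); lra.
have : normc (h x) ^+ 2 <= k * normc (h x) `^ q.
  rewrite /k mulrAC ler_pdivlMr ?powR_gt0//.
  have hp z : 0 < z -> z `^ q = z ^+ 2 * z `^ (q - 2).
    move=> z0; rewrite -powR_mulrn ?ltW// -powRD; first by congr (_ `^ _); ring.
    by rewrite (gt_eqF z0) implybT.
  have hx0 : 0 < normc (h x) by exact: lt_trans hd.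
  rewrite (hp _ d0) (hp _ hx0) mulrCA ler_wpM2l ?sqr_ge0// ler_wpM2l ?sqr_ge0//.
  by apply: ge0_ler_powR; rewrite ?nnegrE ?subr_ge0// ltW.
have kh : 0 <= k * normc (h x) `^ q by rewrite mulr_ge0 ?powR_ge0.
move=> /(ler_wpM2l (W0 x)); have := ler_wpM2r kh (WleB x).
have : 0 <= d ^+ 2 * W x by rewrite mulr_ge0 ?sqr_ge0.
lra.
Qed.

End weight.

Lemma measurableCB g f : Defs.measurableC g -> Defs.measurableC f ->
  Defs.measurableC (fun x => g x - f x).
Proof.
case=> mg1 mg2 [mf1 mf2]; split.
  rewrite (_ : (fun x => _) = (fun x => ReC (g x) - ReC (f x))); first exact: measurable_funB.
  by apply/funext => x; case: (g x) => a b; case: (f x).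
rewrite (_ : (fun x => _) = (fun x => ImC (g x) - ImC (f x))); first exact: measurable_funB.
by apply/funext => x; case: (g x) => a b; case: (f x).
Qed.

Lemma LnormC_triangle (m : R) g f : 1 <= m -> Defs.measurableC g -> Defs.measurableC f ->
  (LnormC m%:E g <= LnormC m%:E (fun x => (g x - f x)%R) + LnormC m%:E f)%E.
Proof.
move=> m1 mg mf; have m0 : 0 < m by exact: lt_le_trans m1.
have mgf := measurableCB mg mf.
have mkN := @minkowski_EFin _ _ R mu (fun x => normc (g x - f x)) (fun x => normc (f x)) m
  (measurable_normc mgf) (measurable_normc mf) m1.
apply: le_trans mkN; rewrite /LnormC unlock.
have mp (h : 'rV[R]_n -> R) : measurable_fun setT h ->
    measurable_fun setT (fun x => `|(h x)%:E| `^ m)%E.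
  move=> mh; under eq_fun do rewrite abse_EFin poweR_EFin.
  apply/measurable_EFinP; apply: (measurableT_comp (measurable_powR m)).
  exact: measurableT_comp.
apply: gt0_ler_poweR => //.
- by rewrite invr_ge0 ltW.
- by rewrite in_itv/= leey andbT; apply: integral_ge0 => x _; rewrite lee_fin powR_ge0.
- by rewrite in_itv/= leey andbT; apply: integral_ge0 => x _; rewrite lee_fin powR_ge0.
apply: ge0_le_integral => //.
- by move=> x _; exact: poweR_ge0.
- apply: mp; exact: measurable_normc.
- apply: (mp (fun x => normc (g x - f x) + normc (f x))).
  by apply: measurable_funD; exact: measurable_normc.
move=> x _; rewrite /= lee_fin; apply: ge0_ler_powR; rewrite ?nnegrE ?(ltW m0)//.
rewrite !ger0_norm ?addr_ge0 ?normc_ge0//.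
rewrite -{1}(subrK (f x) (g x)).
exact: le_normcD.
Qed.

Lemma near_le_ereal (u : nat -> \bar R) (d : R) : 0 < d -> u k @[k --> \oo] --> 0%E ->
  \forall k \near \oo, (u k <= d%:E)%E.
Proof.
move=> d0 /fine_cvgP[ufin /cvgr_lt/(_ d d0) ud].
near=> k; have uk : u k \is a fin_num by near: k.
by rewrite -(fineK uk) lee_fin ltW//; near: k.
Unshelve. all: by end_near. Qed.

Section weight_limit.
Variables (W : 'rV[R]_n -> R) (B V : R).
Hypothesis mW : measurable_fun setT W.
Hypothesis WB : forall xi, 0 <= W xi <= B.
Hypothesis V0 : 0 < V.
Hypothesis intW : (\int[mu]_xi (W xi)%:E <= (B * V)%:E)%E.

(** The strict bound by [N] leaves room for an approximant [g k] of norm at most [N]; the positivity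
    of [N] makes the splitting height positive even when [f] has norm 0. The L^1 estimate is applied
    to [g k], and the distance from its transform to [F] is absorbed in [e]. *)
Lemma weighted_fourier_approx (m N e : R) f F : 1 <= m <= 2 -> 0 < N -> 0 < e ->
  memLp m%:E f -> has_fourier m f F -> (LnormC m%:E f < N%:E)%E ->
  (\int[mu]_xi (W xi * normc (F xi) ^+ 2)%:E <=
   (2 * fourier_const * (B * V `^ (2 / m - 1) * N ^+ 2) + e)%:E)%E.
Proof.
move=> m12 N0 e0 [mf flt] [mF [g [gL gf gF]]] fN.
have /andP[m1 m2] := m12; have m0 : 0 < m by exact: lt_le_trans m1.
have e20 : 0 < e / 2 by rewrite divr_gt0.
have W0 xi : 0 <= W xi by have /andP[] := WB xi.
have [d d0 small] := weighted_sqr_small mW WB V0 intW m12 e20.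
have f_fin : LnormC m%:E f \is a fin_num by rewrite ge0_fin_numE ?Lnorm_ge0.
have eta0 : 0 < N - fine (LnormC m%:E f) by rewrite subr_gt0 -lte_fin fineK.
have gf' : \forall k \near \oo, (LnormC m%:E (fun x => (g k x - f x)%R) <=
    (N - fine (LnormC m%:E f))%:E)%E by exact: near_le_ereal.
have gF' : \forall k \near \oo, (LnormC (hoelder_conjugate m%:E)
    (fun xi => (fourier (g k) xi - F xi)%R) <= d%:E)%E by exact: near_le_ereal.
have [k [k1 k2]] : exists k, (LnormC m%:E (fun x => (g k x - f x)%R) <=
    (N - fine (LnormC m%:E f))%:E)%E /\ (LnormC (hoelder_conjugate m%:E)
    (fun xi => (fourier (g k) xi - F xi)%R) <= d%:E)%E.
  by have [k] := filter_ex (filterI gf' gF'); exists k.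
have [gL1 gLm] := gL k.
have gN : (LnormC m%:E (g k) <= N%:E)%E.
  apply: le_trans (LnormC_triangle m1 gL1.1 mf) _.
  rewrite (_ : N = N - fine (LnormC m%:E f) + fine (LnormC m%:E f)); last by rewrite subrK.
  by rewrite EFinD; apply: leeD => //; rewrite fineK.
have gm := LnormC_leP m0 (ltW N0) gN.
(* The height for which lam^m / V = N^m, so that the bound [gm] on [g k] is exactly the hypothesis
   of the interpolation estimate. *)
pose lam := V `^ m^-1 * N.
have l0 : 0 < lam by rewrite mulr_gt0// powR_gt0.
have lamm : lam `^ m / V = N `^ m.
  rewrite /lam powRM ?powR_ge0 ?ltW// -powRrM mulVf ?gt_eqF// powRr1 ?ltW//.
  by rewrite mulrAC divff ?mul1r// gt_eqF.
have lam2 : lam ^+ 2 / V = V `^ (2 / m - 1) * N ^+ 2.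
  rewrite /lam exprMn mulrAC; congr (_ * _).
  rewrite powRD; last by rewrite (gt_eqF V0) implybT.
  rewrite powR_inv1 ?ltW//; congr (_ / _).
  by rewrite -powR_mulrn ?powR_ge0// -powRrM mulrC.
rewrite -lamm in gm.
have G := weighted_fourier_L1 mW WB V0 intW m12 l0 gL1 gm.
have [ir ii] := memL1_integrable gL1.
have mh := measurableCB (measurable_fourier ir ii) mF.
have H := small _ mh k2.
have mnF := measurable_normc mF.
have mng := measurable_normc (measurable_fourier ir ii).
have mnh := measurable_normc mh.
have mWsq (h : 'rV[R]_n -> C) : measurable_fun setT (fun x => normc (h x)) ->
    measurable_fun setT (fun x => (W x * normc (h x) ^+ 2)%:E).
  move=> mh'; apply/measurable_EFinP; apply: measurable_funM => //; exact: measurable_funX.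
have WF := mWsq _ mnF; have Wg := mWsq _ mng; have Wh := mWsq _ mnh.
apply: (@le_trans _ _ (2%:E * \int[mu]_xi (W xi * normc (fourier (g k) xi) ^+ 2)%:E +
   2%:E * \int[mu]_xi (W xi * normc (fourier (g k) xi - F xi)%R ^+ 2)%:E)%E).
  have posg x : [set: 'rV[R]_n] x -> (0 <= (W x * normc (fourier (g k) x) ^+ 2)%:E)%E.
    by rewrite lee_fin mulr_ge0// sqr_ge0.
  have posh x : [set: 'rV[R]_n] x -> (0 <= (W x * normc (fourier (g k) x - F x) ^+ 2)%:E)%E.
    by rewrite lee_fin mulr_ge0// sqr_ge0.
  rewrite -!ge0_integralZl_EFin//.
  rewrite -ge0_integralD//; [|by move=> x xT; rewrite mule_ge0// posg|exact: measurable_funeM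
    |by move=> x xT; rewrite mule_ge0// posh|exact: measurable_funeM].
  apply: ge0_le_integral => //.
  - by move=> x _; rewrite lee_fin mulr_ge0// sqr_ge0.
  - by apply: emeasurable_funD; apply: measurable_funeM; [exact: Wg|exact: Wh].
  - move=> x _; rewrite -!EFinM -EFinD lee_fin.
    have := ler_wpM2l (W0 x) (normc_sqr_triangle (F x) (fourier (g k) x)).
    have -> : normc (F x - fourier (g k) x) = normc (fourier (g k) x - F x).
      by rewrite -opprB normcN.
    lra.
rewrite [leRHS]EFinD; apply: leeD.
  rewrite -mulrA [leRHS]EFinM lee_wpmul2l//; apply: le_trans G _.
  suff -> : B * lam ^+ 2 / V = B * V `^ (2 / m - 1) * N ^+ 2 by [].
  by rewrite -mulrA lam2 mulrA.
by rewrite (_ : e = 2 * (e / 2)) ?[leRHS]EFinM ?lee_wpmul2l//; field.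
Qed.

(* Let [N] tend to the norm of [f] and [e] to [0]. *)
Lemma weighted_fourier (m : R) f F : 1 <= m <= 2 ->
  memLp m%:E f -> has_fourier m f F ->
  (\int[mu]_xi (W xi * normc (F xi) ^+ 2)%:E <=
   (2 * fourier_const * (B * V `^ (2 / m - 1) * fine (LnormC m%:E f) ^+ 2))%:E)%E.
Proof.
move=> m12 fL fF; set X := (X in (X <= _)%E); set A := 2 * fourier_const * (B * V `^ (2 / m - 1)).
have W0 xi : 0 <= W xi by have /andP[] := WB xi.
have B0 : 0 <= B by have /andP[+ _] := WB 0; move=> /le_trans; apply; have /andP[] := WB 0.
have A0 : 0 <= A.
  by apply: mulr_ge0; [rewrite mulr_ge0 ?fourier_const_ge0|rewrite mulr_ge0 ?powR_ge0].
set N := fine (LnormC m%:E f); have N0 : 0 <= N by rewrite fine_ge0// Lnorm_ge0.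
have f_fin : LnormC m%:E f \is a fin_num by rewrite ge0_fin_numE ?Lnorm_ge0//; case: fL.
apply/lee_addgt0Pr => e e0.
(* For eta <= 1 one has A ((N + eta)^2 - N^2) <= A (2 N + 1) eta, and eta D <= e / 2 makes this
   increment at most half of [e]. *)
pose D := A * (2 * N + 1) + 1.
have D0 : 0 < D by rewrite ltr_wpDl// mulr_ge0// addr_ge0// mulr_ge0.
pose eta := Num.min 1 (e / 2 / D).
have eta0 : 0 < eta by rewrite lt_min ltr01 !divr_gt0.
have eta1 : eta <= 1 by rewrite ge_min lexx.
have etaD : eta * D <= e / 2 by rewrite -ler_pdivlMr// ge_min lexx orbT.
have e20 : 0 < e / 2 by rewrite divr_gt0.
have Neta : 0 < N + eta by rewrite ltr_wpDl.
have fN : (LnormC m%:E f < (N + eta)%:E)%E by rewrite -(fineK f_fin) lte_fin ltrDl.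
apply: le_trans (weighted_fourier_approx m12 Neta e20 fL fF fN) _.
have AE z : 2 * fourier_const * (B * V `^ (2 / m - 1) * z) = A * z by rewrite /A !mulrA.
rewrite -EFinD lee_fin !AE.
have : A * eta ^+ 2 <= A * eta.
  by rewrite ler_wpM2l// expr2 ler_piMr// ltW.
have : A * (2 * N + 1) * eta <= eta * D.
  by rewrite mulrC ler_wpM2l ?(ltW eta0)// /D lerDl.
by rewrite -/N; lra.
Qed.

End weight_limit.
End complex_fourier.

(** * The plate system at a fixed frequency *)

Section ode.
Variable R : realType.

(** Nothing is known for negative times, so continuity on the closed interval combines the right
    limit at 0 with differentiability at positive times. *)
Lemma right_within (f : R -> R) (T : R) : 0 < T ->
  f x @[x --> 0^'+] --> f 0 -> (forall t : R, 0 < t -> derivable f t 1) ->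
  {within `[0, T], continuous f}.
Proof.
move=> T0 f0 df; apply: derivable_oo_LRcontinuous_within; split => //.
- by move=> x; rewrite in_itv/= => /andP[x0 _]; exact: df.
- apply: cvg_at_left_filter.
  by apply/differentiable_continuous/derivable1_diffP; exact: df.
Qed.

Lemma derive_le0_le (g g' : R -> R) (T : R) : 0 <= T ->
  g x @[x --> 0^'+] --> g 0 -> (forall t : R, 0 < t -> is_derive t 1 g (g' t)) ->
  (forall t, 0 < t < T -> g' t <= 0) -> g T <= g 0.
Proof.
rewrite le_eqVlt => /predU1P[<-//|T0] g0 dg g'0.
have df t : 0 < t -> derivable g t 1 by move=> /dg h; exact: ex_derive.
apply: (@ler0_derive1_nincr _ g 0 T) => //; last exact: ltW.
- by move=> x; rewrite in_itv/= => /andP[x0 _]; exact: df.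
- move=> x; rewrite in_itv/= => xT; have /andP[x0 _] := xT.
  by rewrite derive1E (@derive_val _ _ _ _ _ _ _ (dg x x0)); exact: g'0.
- exact: right_within.
Qed.

Lemma gronwall (f f' : R -> R) (k t : R) : 0 <= t ->
  f x @[x --> 0^'+] --> f 0 -> (forall t : R, 0 < t -> is_derive t 1 f (f' t)) ->
  (forall t, 0 < t -> f' t <= - k * f t) -> f t <= f 0 * expR (- k * t).
Proof.
move=> t0 f0 df fk.
suff : f t * expR (k * t) <= f 0 * expR (k * 0).
  rewrite mulr0 expR0 mulr1 => h.
  by rewrite mulNr expRN ler_pdivlMr// expR_gt0.
apply: (@derive_le0_le (fun s => f s * expR (k * s))
  (fun s => f' s * expR (k * s) + f s * (k * expR (k * s)))) => //.
- apply: cvgM => //; apply: cvg_at_right_filter.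
  apply: (@derivable_continuous _ (fun s => expR (k * s))) => x; exact: ex_derive.
- move=> s s0; have h := df _ s0; apply: is_derive_eq.
  by rewrite /GRing.scale/=; ring.
- move=> s /andP[s0 _]; rewrite mulrA -mulrDl pmulr_lle0 ?expR_gt0//.
  by have := fk s s0; lra.
Qed.

(** A component of the j-th term of the series of exp(-t N) applied to [x0]. The partial sums are
    polynomial in the entries of [N] and [x0], so they depend measurably on parameters. *)
Definition series_term (N : 'M[R]_3) (x0 : 'cV[R]_3) (t : R) (j : nat) (i : 'I_3) : R :=
  (- t) ^+ j / j`!%:R * (N ^+ j *m x0) i 0.

Definition series_sol (N : 'M[R]_3) (x0 : 'cV[R]_3) (t : R) (k : nat) (i : 'I_3) : R :=
  \sum_(j < k) series_term N x0 t j i.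

Lemma is_derive_coeff (j : nat) (t : R) :
  is_derive t 1 (fun s : R => (- s) ^+ j.+1 / j.+1`!%:R) (- ((- t) ^+ j / j`!%:R)).
Proof.
have h : is_derive t 1 (fun s : R => s ^+ j.+1) (j.+1%:R * t ^+ j).
  by apply: DeriveDef; [exact: exprn_derivable|rewrite exp_derive [LHS]mulr1].
rewrite (_ : (fun s => _) = (fun s => (-1) ^+ j.+1 / j.+1`!%:R * s ^+ j.+1)); last first.
  by apply/funext => s; rewrite (exprNn s) -!mulrA; congr (_ * _); rewrite mulrC.
apply: is_derive_eq; rewrite /GRing.scale/= factS natrM (exprNn t) exprS.
have : j.+1%:R != 0 :> R by rewrite pnatr_eq0.
have : j`!%:R != 0 :> R by rewrite pnatr_eq0 -lt0n fact_gt0.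
by move: (j.+1%:R : R) (j`!%:R : R) {h} => a b h1 h2; field; rewrite h1 h2.
Qed.

(** Differentiation lowers the truncation order by one: the sum with [k.+1] terms is the Picard
    iterate of the sum with [k] terms. *)
Lemma is_derive_series_sol N x0 k (t : R) (i : 'I_3) :
  is_derive t 1 (fun s : R => series_sol N x0 s k.+1 i)
    (- \sum_l N i l * series_sol N x0 t k l).
Proof.
elim: k => [|k IH].
  rewrite (_ : (fun s => _) = cst ((N ^+ 0 *m x0) i 0)).
    apply: is_derive_eq; rewrite big1 ?oppr0// => l _.
    by rewrite /series_sol big_ord0 mulr0.
  by apply/funext => s; rewrite /series_sol big_ord1 /series_term expr0 fact0 divr1 mul1r.
rewrite (_ : (fun s => _) =
    (fun s => series_sol N x0 s k.+1 i + series_term N x0 s k.+1 i)); last first.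
  by apply/funext => s; rewrite /series_sol big_ord_recr.
have h := is_derive_coeff k t; rewrite /series_term.
have e : (N ^+ k.+1 *m x0) i 0 = \sum_l N i l * (N ^+ k *m x0) l 0.
  by rewrite exprS -mulmxE -mulmxA mxE.
apply: is_derive_eq; rewrite /GRing.scale/= e.
under [in RHS]eq_bigr do rewrite /series_sol big_ord_recr/= mulrDr.
rewrite big_split opprD/= mulr0 add0r; congr (_ + _).
rewrite mulrN mulr_suml; congr (- _).
by apply: eq_bigr => l _; rewrite /series_term; ring.
Qed.

Lemma series_sol0 N x0 k i : series_sol N x0 0 k.+1 i = x0 i 0.
Proof.
rewrite /series_sol big_ord_recl big1 => [|j _]; last first.
  by rewrite /series_term oppr0 expr0n/= !mul0r.
by rewrite /series_term /= expr0 fact0 divr1 mul1r mul1mx addr0.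
Qed.

(* Picard iteration: the k-th remainder is at most [K (L t)^k / k!]. *)
Lemma series_sol_cvg (N : 'M[R]_3) (x : R -> 'cV[R]_3) :
  (forall i, x s i 0 @[s --> 0^'+] --> x 0 i 0) ->
  (forall t : R, 0 < t -> forall i, is_derive t 1 (fun s => x s i 0) (- \sum_l N i l * x t l 0)) ->
  forall t i, 0 <= t -> series_sol N (x 0) t k i @[k --> \oo] --> x t i 0.
Proof.
move=> x0 dx t i t0; pose T := t + 1; have T0 : 0 < T by rewrite ltr_wpDl.
have dfx l s : 0 < s -> derivable (fun s => x s l 0) s 1.
  by move=> /dx h; have := h l => hl; exact: ex_derive.
have bnd l : exists K, forall s, 0 <= s <= T -> `|x s l 0| <= K.
  have cx : {within `[0, T], continuous (fun s => x s l 0)}.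
    by apply: right_within => //; exact: dfx.
  have [c _ cmax] := EVT_max (ltW T0) cx.
  have [c' _ cmin] := EVT_min (ltW T0) cx.
  exists (`|x c l 0| + `|x c' l 0|) => s sT.
  have h1 : x s l 0 <= x c l 0 by apply: cmax; rewrite in_itv.
  have h2 : x c' l 0 <= x s l 0 by apply: cmin; rewrite in_itv.
  have := ler_norm (x c l 0); have := ler_norm (- x c' l 0); rewrite normrN.
  have := normr_ge0 (x c l 0); have := normr_ge0 (x c' l 0).
  by move=> *; rewrite ler_norml; apply/andP; split; lra.
have /choice[K KP] := bnd.
(* [M] bounds every component of the solution on [[0, T]]; [L] dominates every absolute row sum of
   [N] and so serves as Lipschitz constant. *)
pose M : R := \sum_l `|K l|; pose L : R := \sum_(j : 'I_3) \sum_(l : 'I_3) `|N j l|.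
have M0 : 0 <= M by exact: sumr_ge0.
have L0 : 0 <= L by apply: sumr_ge0 => j _; exact: sumr_ge0.
have NL j : \sum_l `|N j l| <= L.
  rewrite /L [leRHS](bigD1 j)//= lerDl.
  by apply: sumr_ge0 => a _; exact: sumr_ge0.
have key k l s : 0 <= s <= T ->
    `|x s l 0 - series_sol N (x 0) s k l| <= M * ((L * s) ^+ k / k`!%:R).
  elim: k l s => [|k IH] l s /andP[s0 sT].
    rewrite /series_sol big_ord0 subr0 expr0 fact0 divr1 mulr1.
    apply: le_trans (KP l s _) _; first by rewrite s0.
    rewrite /M (bigD1 l)//= (le_trans (ler_norm _))// lerDl.
    exact: sumr_ge0.
  have one (sg : R) : `|sg| = 1 ->
     sg * (x s l 0 - series_sol N (x 0) s k.+1 l) <= M * ((L * s) ^+ k.+1 / k.+1`!%:R).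
    move=> sg1; rewrite -subr_le0.
    (* The signed remainder minus its claimed bound: it vanishes at 0, and the induction hypothesis
       makes its derivative nonpositive. The power of s is written through - s so that
       [is_derive_coeff] also differentiates the bound. *)
    pose g (s : R) := sg * (x s l 0 - series_sol N (x 0) s k.+1 l)
      - M * L ^+ k.+1 * (-1) ^+ k.+1 * ((- s) ^+ k.+1 / k.+1`!%:R).
    have gE (r : R) : g r = sg * (x r l 0 - series_sol N (x 0) r k.+1 l) -
        M * ((L * r) ^+ k.+1 / k.+1`!%:R).
      rewrite /g exprMn -{1}(mulN1r r) exprMn -!mulrA (mulrA ((-1) ^+ k.+1)).
      by rewrite -exprMn mulrNN mulr1 expr1n mul1r.
    rewrite -gE; have g00 : g 0 = 0.
      by rewrite gE series_sol0 subrr mulr0 mulr0 expr0n/= mul0r mulr0 subrr.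
    rewrite -g00.
    pose g' (r : R) := sg * (- \sum_j N l j * (x r j 0 - series_sol N (x 0) r k j)) -
      M * L * ((L * r) ^+ k / k`!%:R).
    have dg (r : R) : 0 < r -> is_derive r 1 g (g' r).
      move=> r0; have h1 := dx r r0 l; have h2 := is_derive_series_sol N (x 0) k r l.
      have h3 := is_derive_coeff k r.
      have hs : \sum_j N l j * (x r j 0 - series_sol N (x 0) r k j) =
          \sum_j N l j * x r j 0 - \sum_j N l j * series_sol N (x 0) r k j.
        by rewrite -sumrB; apply: eq_bigr => j _; rewrite mulrBr.
      have hr : r ^+ k = (-1) ^+ k * (- r) ^+ k by rewrite -exprMn mulrNN mul1r.
      apply: is_derive_eq; rewrite /GRing.scale/= /g' hs exprMn hr !exprS; ring.
    apply: (@derive_le0_le g g' s) => //.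
    - apply: cvgB; apply: cvgM; try exact: cvg_cst.
        apply: cvgB; first exact: x0.
        apply: cvg_at_right_filter.
        apply: (@derivable_continuous _ (fun s => series_sol N (x 0) s k.+1 l)) => r.
        by have h := is_derive_series_sol N (x 0) k r l; exact: ex_derive.
      apply: cvg_at_right_filter.
      apply: (@derivable_continuous _ (fun s : R => (- s) ^+ k.+1 / k.+1`!%:R)) => r.
      by have h := is_derive_coeff k r; exact: ex_derive.
    - move=> r /andP[r0 rs]; rewrite /g' subr_le0.
      apply: le_trans (ler_norm _) _; rewrite normrM sg1 mul1r normrN.
      apply: le_trans (ler_norm_sum _ _ _) _.
      apply: (@le_trans _ _ (\sum_j `|N l j| * (M * ((L * r) ^+ k / k`!%:R)))).
        apply: ler_sum => j _; rewrite normrM ler_wpM2l// IH//.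
        by rewrite ltW//= (le_trans (ltW rs)).
      rewrite -mulr_suml -mulrA [leRHS]mulrCA ler_wpM2r//.
      by rewrite mulr_ge0// divr_ge0// exprn_ge0// mulr_ge0// ltW.
  rewrite ler_norml lerNl -mulN1r; apply/andP; split.
    by apply: one; rewrite normrN1.
  by rewrite -[leLHS]mul1r; apply: one; rewrite normr1.
apply/cvgrPdist_le => e e0.
have : M * ((L * t) ^+ k / k`!%:R) @[k --> \oo] --> 0.
  rewrite -[X in _ --> X](mulr0 M); apply: cvgM; first exact: cvg_cst.
  exact: cvg_series_cvg_0 (is_cvg_series_exp_coeff (L * t)).
move=> /cvgr_le/(_ e e0); apply: filterS => k h.
by apply: le_trans (key k i t _) h; rewrite t0 /T lerDl ler01.
Qed.

(** In d1 e1 + d2 e2 + d3 e3 the off-diagonal couplings cancel and leave del d2^2 + d3^2 plus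
    forcing, with no damping of [d1]. The cross term - del / 4 d1 d3 supplies it: through the entry
    - del d1 of [e3] it contributes del^2 / 4 d1^2, of the slowest order in the system. The weighted
    squares of the [w] components pay for the forcing [f2], [f3]. *)
Lemma lyapunov_decay (del d1 d2 d3 w1 w2 w3 f2 f3 e1 e2 e3 : R) : 0 <= del <= 1 / 4 ->
  f2 = del ^+ 3 * w1 + del ^+ 2 * (w2 + w3) ->
  f3 = (del ^+ 2 - del ^+ 3) * w1 - 2 * del ^+ 2 * (w2 + w3) ->
  e1 = del * d3 -> e2 = del * d2 + del * d3 + f2 ->
  e3 = - del * d1 - del * d2 + d3 + f3 ->
  del ^+ 2 / 8 * ((d1 ^+ 2 + d2 ^+ 2 + d3 ^+ 2) / 2 - del / 4 * (d1 * d3)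
    + 8 * del ^+ 2 * (w1 ^+ 2 + w2 ^+ 2 + w3 ^+ 2)) <=
  d1 * e1 + d2 * e2 + d3 * e3 - del / 4 * (e1 * d3 + d1 * e3)
    + 16 * del ^+ 2 * (del ^+ 2 * w1 ^+ 2 + del * w2 ^+ 2 + w3 ^+ 2).
Proof.
move=> /andP[d0 d4] f2E f3E -> -> ->.
(* The second row is damped only by [del], so one factor [del] is pulled out of [f2]; then [d2 * f2]
   completes to a square against del d2^2. *)
pose g2 := del ^+ 2 * w1 + del * (w2 + w3).
have sq (a : R) := sqr_ge0 a.
have up (a : R) : 0 <= a -> 0 <= a * (1 / 4 - del) by move=> a0; rewrite mulr_ge0// subr_ge0.
have dsq (k : nat) (a : R) : 0 <= del ^+ k * a ^+ 2 by rewrite mulr_ge0 ?sqr_ge0// exprn_ge0.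
have hg : del * g2 ^+ 2 <= del ^+ 4 * w1 ^+ 2 + 3 * (del ^+ 3 * w2 ^+ 2) + 3 * (del ^+ 3 * w3 ^+ 2).
  have := mulr_ge0 d0 (sq (del ^+ 2 * w1 - del * w2)).
  have := mulr_ge0 d0 (sq (del ^+ 2 * w1 - del * w3)).
  have := mulr_ge0 d0 (sq (del * w2 - del * w3)).
  have := up _ (dsq 4 w1).
  have := dsq 4 w1.
  by rewrite /g2; lra.
have hf : f3 ^+ 2 <= 3 * (del ^+ 4 * w1 ^+ 2) + 12 * (del ^+ 4 * w2 ^+ 2) + 12 * (del ^+ 4 * w3 ^+ 2).
  have := dsq 4 w1; have := dsq 5 w1; have := dsq 6 w1.
  have := up _ (dsq 5 w1).
  have := sq ((del ^+ 2 - del ^+ 3) * w1 + 2 * del ^+ 2 * w2).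
  have := sq ((del ^+ 2 - del ^+ 3) * w1 + 2 * del ^+ 2 * w3).
  have := sq (2 * del ^+ 2 * w2 - 2 * del ^+ 2 * w3).
  by rewrite f3E; lra.
(* Each square disposes of one mixed product: [H1] of d1 d2, [H2] of d1 d3, [H3] of d1 f3, [H4] of
   d2 f2, [H5] of d3 f3, and [H6] of the d1 d3 term on the left-hand side. The remaining facts
   compare powers of [del]; all of them enter linearly in the monomials. *)
have H1 := mulr_ge0 (sq del) (sq (d1 + 4 * d2)).
have H2 := sq (del * d1 - 2 * d3).
have H3 := sq (del * d1 - 4 * f3).
have H4 := mulr_ge0 d0 (sq (d2 + 2 * g2)).
have H5 := sq (d3 + 2 * f3).
have H6 := mulr_ge0 (exprn_ge0 3 d0) (sq (d1 + d3)).
have K1 := up _ (dsq 1 d2).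
have K2 := up _ (dsq 1 d3).
have K2' := up _ (dsq 0 d3).
have K3 := up _ (dsq 2 d1).
have K4 := up _ (dsq 2 d3).
have K5 := up _ (dsq 3 w2).
have K6 := up _ (dsq 3 w3).
have K7 := up _ (dsq 2 w3).
have P1 := dsq 2 d1. have P2 := dsq 1 d2. have P3 := dsq 0 d3. have P4 := dsq 4 w1.
have P5 := dsq 3 w2. have P6 := dsq 2 w3. have P7 := dsq 2 d3.
have -> : f2 = del * g2 by rewrite f2E /g2; ring.
move: g2 {f2E f3E} hg H4 => g hg H4.
lra.
Qed.

(** On the left stands v - T1 T1h w = d + (Y - T1 T1h) w, where d = v - Y w. The entries of Y - T1
    T1h are O(del), and the part 8 del^2 |w|^2 of the energy is there to pay for them. *)
Lemma plate_ansatz_dist (del d1 d2 d3 w1 w2 w3 : R) : 0 <= del <= 1 / 4 ->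
  (d1 + (del - del ^+ 3) * w2) ^+ 2 + (d2 - del * w1 - del ^+ 3 * w2 - del ^+ 2 * w3) ^+ 2 +
  (d3 - del ^+ 2 * w2 - del ^+ 3 * w3) ^+ 2 <=
  5 * ((d1 ^+ 2 + d2 ^+ 2 + d3 ^+ 2) / 2 - del / 4 * (d1 * d3)
    + 8 * del ^+ 2 * (w1 ^+ 2 + w2 ^+ 2 + w3 ^+ 2)).
Proof.
move=> /andP[d0 d4].
have sq (a : R) := sqr_ge0 a.
have up (a : R) : 0 <= a -> 0 <= a * (1 / 4 - del) by move=> a0; rewrite mulr_ge0// subr_ge0.
have dsq (k : nat) (a : R) : 0 <= del ^+ k * a ^+ 2 by rewrite mulr_ge0 ?sqr_ge0// exprn_ge0.
have := sq (d1 - (del - del ^+ 3) * w2).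
have := sq (d2 + del * w1 + del ^+ 3 * w2 + del ^+ 2 * w3).
have := sq (d3 + del ^+ 2 * w2 + del ^+ 3 * w3).
have := sq (del * w1 - del ^+ 3 * w2). have := sq (del * w1 - del ^+ 2 * w3).
have := sq (del ^+ 3 * w2 - del ^+ 2 * w3). have := sq (del ^+ 2 * w2 - del ^+ 3 * w3).
have := mulr_ge0 d0 (sq (d1 - d3)).
have := up _ (dsq 0 d1). have := up _ (dsq 0 d3).
have := dsq 0 d1. have := dsq 0 d2. have := dsq 0 d3.
have := dsq 2 w1. have := dsq 2 w2. have := dsq 2 w3.
have := dsq 4 w2.
have := up _ (dsq 2 w2). have := up _ (dsq 3 w2). have := up _ (dsq 4 w2). have := up _ (dsq 5 w2).
have := up _ (dsq 2 w3). have := up _ (dsq 3 w3). have := up _ (dsq 4 w3). have := up _ (dsq 5 w3).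
lra.
Qed.

(** Initially v = T1 T1h w, so d = (T1 T1h - Y) w is O(del) and its square is comparable with the
    weighted part of the energy; this is where the factor del^2 of the final error arises. *)
Lemma plate_energy_init (del d1 d2 d3 w1 w2 w3 : R) : 0 <= del <= 1 / 4 ->
  d1 = (del ^+ 3 - del) * w2 -> d2 = del * w1 + del ^+ 3 * w2 + del ^+ 2 * w3 ->
  d3 = del ^+ 2 * w2 + del ^+ 3 * w3 ->
  (d1 ^+ 2 + d2 ^+ 2 + d3 ^+ 2) / 2 - del / 4 * (d1 * d3)
    + 8 * del ^+ 2 * (w1 ^+ 2 + w2 ^+ 2 + w3 ^+ 2) <=
  11 * del ^+ 2 * (w1 ^+ 2 + w2 ^+ 2 + w3 ^+ 2).
Proof.
move=> /andP[d0 d4] d1E d2E d3E.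
have sq (a : R) := sqr_ge0 a.
have up (a : R) : 0 <= a -> 0 <= a * (1 / 4 - del) by move=> a0; rewrite mulr_ge0// subr_ge0.
have dsq (k : nat) (a : R) : 0 <= del ^+ k * a ^+ 2 by rewrite mulr_ge0 ?sqr_ge0// exprn_ge0.
have h1 : d1 ^+ 2 <= del ^+ 2 * w2 ^+ 2.
  rewrite d1E; have := up _ (dsq 2 w2). have := up _ (dsq 3 w2).
  by have := up _ (dsq 4 w2); have := up _ (dsq 5 w2); have := dsq 4 w2; lra.
have h2 : d2 ^+ 2 <= 3 * (del ^+ 2 * w1 ^+ 2) + del ^+ 2 * w2 ^+ 2 + del ^+ 2 * w3 ^+ 2.
  rewrite d2E; have := sq (del * w1 - del ^+ 3 * w2). have := sq (del * w1 - del ^+ 2 * w3).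
  have := sq (del ^+ 3 * w2 - del ^+ 2 * w3).
  have := dsq 2 w2; have := dsq 2 w3.
  have := up _ (dsq 2 w2). have := up _ (dsq 3 w2). have := up _ (dsq 4 w2).
  have := up _ (dsq 5 w2). have := up _ (dsq 2 w3). have := up _ (dsq 3 w3). lra.
have h3 : d3 ^+ 2 <= del ^+ 2 * w2 ^+ 2 + del ^+ 2 * w3 ^+ 2.
  rewrite d3E; have := sq (del ^+ 2 * w2 - del ^+ 3 * w3).
  have := dsq 2 w2; have := dsq 2 w3.
  have := up _ (dsq 2 w2). have := up _ (dsq 3 w2). have := up _ (dsq 2 w3).
  have := up _ (dsq 3 w3). have := up _ (dsq 4 w3). have := up _ (dsq 5 w3). lra.
have := mulr_ge0 d0 (sq (d1 + d3)). have := up _ (sq d1). have := up _ (sq d3).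
have := sq d1. have := sq d3.
have := dsq 2 w1. have := dsq 2 w2. have := dsq 2 w3.
lra.
Qed.

(** The product [T1 T1h] is the identity plus a perturbation k that is small for del <= 1/4, and (w
    + k)^2 >= w^2 / 2 - k^2 in each row; the three k^2 together take at most 1/3 of each w_i^2,
    which leaves 1/6. *)
Lemma diagonalizer_coercive (del w1 w2 w3 : R) : 0 <= del <= 1 / 4 ->
  w1 ^+ 2 + w2 ^+ 2 + w3 ^+ 2 <= 6 * (
    (w1 + del ^+ 3 * w2 + del * w3) ^+ 2 +
    ((1 + del ^+ 3) * w2 + (del + del ^+ 2) * w3) ^+ 2 +
    (del * w1 + (del + del ^+ 2) * w2 + (1 + del ^+ 3) * w3) ^+ 2).
Proof.
move=> /andP[d0 d4].
have sq (a : R) := sqr_ge0 a.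
pose k1 := del ^+ 3 * w2 + del * w3.
pose k2 := del ^+ 3 * w2 + (del + del ^+ 2) * w3.
pose k3 := del * w1 + (del + del ^+ 2) * w2 + del ^+ 3 * w3.
have b1 : del ^+ 2 <= 1 / 16 by have := mulr_ge0 d0 d0; have := ler_pM d0 d0 d4 d4; lra.
have b0 : 0 <= del ^+ 2 by exact: sq.
have b3 : 0 <= del ^+ 3 <= 1 / 64.
  by rewrite exprn_ge0//= exprS; have := ler_pM d0 b0 d4 b1; lra.
have /andP[c0 c1] := b3.
have b6 : (del ^+ 3) ^+ 2 <= 1 / 1000 by have := ler_pM c0 c0 c1 c1; lra.
have e0 : 0 <= del + del ^+ 2 by rewrite addr_ge0.
have e1 : del + del ^+ 2 <= 5 / 16 by lra.
have b7 : (del + del ^+ 2) ^+ 2 <= 25 / 256 by have := ler_pM e0 e0 e1 e1; lra.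
have h (a x c : R) : a ^+ 2 <= c -> (a * x) ^+ 2 <= c * x ^+ 2.
  by move=> ac; rewrite exprMn ler_wpM2r// sqr_ge0.
have q1 : k1 ^+ 2 <= 2 / 1000 * w2 ^+ 2 + 1 / 8 * w3 ^+ 2.
  have := h _ w2 _ b6; have := h _ w3 _ b1; have := sq (del ^+ 3 * w2 - del * w3).
  by rewrite /k1; lra.
have q2 : k2 ^+ 2 <= 2 / 1000 * w2 ^+ 2 + 50 / 256 * w3 ^+ 2.
  have := h _ w2 _ b6; have := h _ w3 _ b7.
  by have := sq (del ^+ 3 * w2 - (del + del ^+ 2) * w3); rewrite /k2; lra.
have q3 : k3 ^+ 2 <= 3 / 16 * w1 ^+ 2 + 75 / 256 * w2 ^+ 2 + 3 / 1000 * w3 ^+ 2.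
  have := h _ w1 _ b1; have := h _ w2 _ b7; have := h _ w3 _ b6.
  have := sq (del * w1 - (del + del ^+ 2) * w2). have := sq (del * w1 - del ^+ 3 * w3).
  by have := sq ((del + del ^+ 2) * w2 - del ^+ 3 * w3); rewrite /k3; lra.
have p1 := sq (w1 + 2 * k1). have p2 := sq (w2 + 2 * k2). have p3 := sq (w3 + 2 * k3).
have -> : w1 + del ^+ 3 * w2 + del * w3 = w1 + k1 by rewrite /k1; ring.
have -> : (1 + del ^+ 3) * w2 + (del + del ^+ 2) * w3 = w2 + k2 by rewrite /k2; ring.
have -> : del * w1 + (del + del ^+ 2) * w2 + (1 + del ^+ 3) * w3 = w3 + k3.
  by rewrite /k3; ring.
have := sq w1. have := sq w2. have := sq w3.
lra.
Qed.

(* With [d = v - Y w] for the corrected ansatz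
   [Y = [[1, del, del], [-del, 1, del], [del, del, 1]] = T_1 T_{1 1/2} + O(del)]
   the residual is small enough for the functional [Lam] below to decay. *)
Lemma plate_energy (rho del : R) (v1 v2 v3 w1 w2 w3 : R -> R) :
  0 <= rho -> 0 <= del <= 1 / 4 ->
  [/\ v1 s @[s --> 0^'+] --> v1 0, v2 s @[s --> 0^'+] --> v2 0 & v3 s @[s --> 0^'+] --> v3 0] ->
  [/\ w1 s @[s --> 0^'+] --> w1 0, w2 s @[s --> 0^'+] --> w2 0 & w3 s @[s --> 0^'+] --> w3 0] ->
  (forall t : R, 0 < t ->
    [/\ is_derive t 1 v1 (- rho * (del * v3 t)),
        is_derive t 1 v2 (- rho * (del * v2 t + del * v3 t)) &
        is_derive t 1 v3 (- rho * (- del * v1 t - del * v2 t + v3 t))]) ->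
  (forall t : R, 0 < t ->
    [/\ is_derive t 1 w1 (- rho * (del ^+ 2 * w1 t)),
        is_derive t 1 w2 (- rho * (del * w2 t)) &
        is_derive t 1 w3 (- rho * w3 t)]) ->
  v1 0 = w1 0 + del ^+ 3 * w2 0 + del * w3 0 ->
  v2 0 = (1 + del ^+ 3) * w2 0 + (del + del ^+ 2) * w3 0 ->
  v3 0 = del * w1 0 + (del + del ^+ 2) * w2 0 + (1 + del ^+ 3) * w3 0 ->
  forall t, 0 <= t ->
  (v1 t - (w1 t + del ^+ 3 * w2 t + del * w3 t)) ^+ 2 +
  (v2 t - ((1 + del ^+ 3) * w2 t + (del + del ^+ 2) * w3 t)) ^+ 2 +
  (v3 t - (del * w1 t + (del + del ^+ 2) * w2 t + (1 + del ^+ 3) * w3 t)) ^+ 2 <=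
  330 * del ^+ 2 * expR (- (rho * del ^+ 2 / 8) * t) * (v1 0 ^+ 2 + v2 0 ^+ 2 + v3 0 ^+ 2).
Proof.
move=> rho0 del4 [cv1 cv2 cv3] [cw1 cw2 cw3] dv dw i1 i2 i3 t t0.
have /andP[d0 d4] := del4.
pose d1 s := v1 s - (w1 s + del * w2 s + del * w3 s).
pose d2 s := v2 s - (- del * w1 s + w2 s + del * w3 s).
pose d3 s := v3 s - (del * w1 s + del * w2 s + w3 s).
pose Lam s := (d1 s ^+ 2 + d2 s ^+ 2 + d3 s ^+ 2) / 2 - del / 4 * (d1 s * d3 s) +
  8 * del ^+ 2 * (w1 s ^+ 2 + w2 s ^+ 2 + w3 s ^+ 2).
pose f2 s := del ^+ 3 * w1 s + del ^+ 2 * (w2 s + w3 s).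
pose f3 s := (del ^+ 2 - del ^+ 3) * w1 s - 2 * del ^+ 2 * (w2 s + w3 s).
pose e1 s := del * d3 s.
pose e2 s := del * d2 s + del * d3 s + f2 s.
pose e3 s := - del * d1 s - del * d2 s + d3 s + f3 s.
pose Lam' s := - rho * (d1 s * e1 s + d2 s * e2 s + d3 s * e3 s
    - del / 4 * (e1 s * d3 s + d1 s * e3 s)
    + 16 * del ^+ 2 * (del ^+ 2 * w1 s ^+ 2 + del * w2 s ^+ 2 + w3 s ^+ 2)).
have dLam (s : R) : 0 < s -> is_derive s 1 Lam (Lam' s).
  move=> s0; have [dv1 dv2 dv3] := dv s s0; have [dw1 dw2 dw3] := dw s s0.
  have D1 : is_derive s 1 d1 (- rho * e1 s).
    by apply: is_derive_eq; rewrite /GRing.scale/= /e1 /d3; ring.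
  have D2 : is_derive s 1 d2 (- rho * e2 s).
    by apply: is_derive_eq; rewrite /GRing.scale/= /e2 /d2 /d3 /f2; ring.
  have D3 : is_derive s 1 d3 (- rho * e3 s).
    by apply: is_derive_eq; rewrite /GRing.scale/= /e3 /d1 /d2 /d3 /f3; ring.
  by apply: is_derive_eq; rewrite /GRing.scale/= /Lam'; field.
have cLam : Lam s @[s --> 0^'+] --> Lam 0.
  have c1 : d1 s @[s --> 0^'+] --> d1 0.
    by apply: cvgB => //; apply: cvgD; [apply: cvgD => //|]; apply: cvgM => //; exact: cvg_cst.
  have c2 : d2 s @[s --> 0^'+] --> d2 0.
    by apply: cvgB => //; apply: cvgD; [apply: cvgD => //|]; apply: cvgM => //; exact: cvg_cst.
  have c3 : d3 s @[s --> 0^'+] --> d3 0.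
    by apply: cvgB => //; apply: cvgD; [apply: cvgD => //|]; try (apply: cvgM => //; exact: cvg_cst).
  have csq (h : R -> R) : h s @[s --> 0^'+] --> h 0 -> h s ^+ 2 @[s --> 0^'+] --> h 0 ^+ 2.
    by move=> hc; rewrite expr2; under eq_fun do rewrite expr2; exact: cvgM.
  apply: cvgD; first apply: cvgB.
  - by apply: cvgM; [apply: cvgD; [apply: cvgD|]; exact: csq|exact: cvg_cst].
  - by apply: cvgM; [exact: cvg_cst|exact: cvgM].
  - by apply: cvgM; [exact: cvg_cst|apply: cvgD; [apply: cvgD|]; exact: csq].
have Lt := @gronwall Lam Lam' (rho * del ^+ 2 / 8) t t0 cLam dLam.
have {}Lt : Lam t <= Lam 0 * expR (- (rho * del ^+ 2 / 8) * t).
  apply: Lt => s s0.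
  have := @lyapunov_decay del (d1 s) (d2 s) (d3 s) (w1 s) (w2 s) (w3 s) (f2 s) (f3 s)
    (e1 s) (e2 s) (e3 s) del4 erefl erefl erefl erefl erefl.
  by move=> /(ler_wpM2l rho0); rewrite /Lam' /Lam; lra.
have E_le := plate_ansatz_dist (d1 t) (d2 t) (d3 t) (w1 t) (w2 t) (w3 t) del4.
have L0 : Lam 0 <= 11 * del ^+ 2 * (w1 0 ^+ 2 + w2 0 ^+ 2 + w3 0 ^+ 2).
  apply: plate_energy_init => //; first by rewrite /d1 i1; ring.
    by rewrite /d2 i2; ring.
  by rewrite /d3 i3; ring.
have wv := diagonalizer_coercive (w1 0) (w2 0) (w3 0) del4.
rewrite -i1 -i2 -i3 in wv.
have X0 := ltW (expR_gt0 (- (rho * del ^+ 2 / 8) * t)).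
have -> : v1 t - (w1 t + del ^+ 3 * w2 t + del * w3 t) = d1 t + (del - del ^+ 3) * w2 t.
  by rewrite /d1; ring.
have -> : v2 t - ((1 + del ^+ 3) * w2 t + (del + del ^+ 2) * w3 t) =
    d2 t - del * w1 t - del ^+ 3 * w2 t - del ^+ 2 * w3 t by rewrite /d2; ring.
have -> : v3 t - (del * w1 t + (del + del ^+ 2) * w2 t + (1 + del ^+ 3) * w3 t) =
    d3 t - del ^+ 2 * w2 t - del ^+ 3 * w3 t by rewrite /d3; ring.
(* The constant 330 is 5 * 11 * 6: distance to the ansatz, initial energy, and coercivity of
   [T1 T1h]. *)
apply: (le_trans E_le); rewrite -/(Lam t).
apply: (le_trans (ler_wpM2l _ Lt)) => //; rewrite mulrA.
rewrite [leRHS]mulrAC ler_wpM2r// .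
have := ler_wpM2l (sqr_ge0 del) wv; lra.
Qed.

End ode.

(** * From the complex systems to the real energy estimate *)

Section plate_pointwise.
Variable R : realType.
Local Notation C := R[i].
Local Notation ReC := complex.Re.
Local Notation ImC := complex.Im.
Local Notation rc := (real_complex R).
Local Notation normc := ComplexField.Normc.normc.

Definition rmx3 (rows : seq (seq R)) : 'M[R]_3 :=
  \matrix_(i, j) nth 0 (nth [::] rows i) j.

Definition A0r := rmx3 [:: [:: 0; -1; -1]; [:: 1; 0; -1]; [:: 2^-1; 2^-1; 1]].
Definition A1r := rmx3 [:: [:: 2^-1; 2^-1; 0]; [:: 2^-1; 2^-1; 0]; [:: 0; 0; 0]].
Definition T0r := rmx3 [:: [:: -1; 0; 1]; [:: 1; 0; 1]; [:: 0; 1; 0]].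
Definition T0inv := rmx3 [:: [:: - 2^-1; 2^-1; 0]; [:: 0; 0; 1]; [:: 2^-1; 2^-1; 0]].
Definition T1r (d : R) := rmx3 [:: [:: 1; 0; d]; [:: 0; 1; d]; [:: d; d; 1]].
(** Here 1 - 2 d^2 is the determinant of [T1r d]. Having the inverse in closed form shows both that
    [invmx] is genuine for small d and that the reference data depend measurably on the
    frequency. *)
Definition T1inv (d : R) := let c := (1 - 2 * d ^+ 2)^-1 in
  rmx3 [:: [:: 1 + c * d ^+ 2; c * d ^+ 2; - c * d];
           [:: c * d ^+ 2; 1 + c * d ^+ 2; - c * d];
           [:: - c * d; - c * d; c]].
Definition T1hr (e : R) := rmx3 [:: [:: 1; 0; 0]; [:: 0; 1; e]; [:: 0; e; 1]].
Definition T1hinv (e : R) := let c := (1 - e ^+ 2)^-1 in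
  rmx3 [:: [:: 1; 0; 0]; [:: 0; c; - c * e]; [:: 0; - c * e; c]].

Ltac entries3 := apply/matrixP => -[[|[|[|?]]] ?] // [[|[|[|?]]] ?] //; rewrite !mxE /=.

Ltac entriesC := entries3; apply/eqP; rewrite eq_complex /=; apply/andP;
  split; apply/eqP; try by field.

Lemma A0E : A0 R = map_mx rc A0r.
Proof.
rewrite /A0 (_ : 2^-1 = (2^-1)%:C :> C); last by rewrite fmorphV rmorph_nat.
entriesC.
Qed.

Lemma A1E : A1 R = map_mx rc A1r.
Proof.
rewrite /A1 (_ : 2^-1 = (2^-1)%:C :> C); last by rewrite fmorphV rmorph_nat.
entriesC.
Qed.

Lemma T0E : T0 R = map_mx rc T0r.
Proof. entriesC. Qed.

Lemma T0V : T0r *m T0inv = 1%:M.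
Proof. entries3; rewrite !big_ord_recl big_ord0 !mxE /=; by field. Qed.

Lemma T1V (d : R) : 2 * d ^+ 2 != 1 -> T1r d *m T1inv d = 1%:M.
Proof.
move=> d1; have d0 : 1 - 2 * d ^+ 2 != 0 by rewrite subr_eq0 eq_sym.
entries3; rewrite !big_ord_recl big_ord0 !mxE /=; by field; rewrite ?d0.
Qed.

Lemma T1hV (e : R) : e ^+ 2 != 1 -> T1hr e *m T1hinv e = 1%:M.
Proof.
move=> d1; have d0 : 1 - e ^+ 2 != 0 by rewrite subr_eq0 eq_sym.
entries3; rewrite !big_ord_recl big_ord0 !mxE /=; by field; rewrite ?d0.
Qed.

Variable n : nat.
Implicit Types (xi : 'rV[R]_n) (sigma : R).

Definition del sigma xi : R := enorm xi `^ (2 - 2 * sigma).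
Definition rho sigma xi : R := enorm xi `^ (2 * sigma).

Lemma enorm_ge0 xi : 0 <= enorm xi.
Proof. exact: sqrtr_ge0. Qed.

Lemma del_ge0 sigma xi : 0 <= del sigma xi. Proof. exact: powR_ge0. Qed.

Lemma rho_ge0 sigma xi : 0 <= rho sigma xi. Proof. exact: powR_ge0. Qed.

(** At r = 0 both sides are 0, since b and a + b are nonzero. The exponent a may vanish: for sigma =
    0 the factor [rho] is r^0, which equals 1 also at r = 0. *)
Lemma powR_sum (r a b : R) : 0 <= r -> 0 < b -> a + b != 0 -> r `^ a * r `^ b = r `^ (a + b).
Proof.
rewrite le_eqVlt => /predU1P[<-|r0] b0 ab.
  by rewrite (powR0 (lt0r_neq0 b0)) mulr0 powR0.
by rewrite powRD// (gt_eqF r0) implybT.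
Qed.

Lemma T1E sigma xi : T1 sigma xi = map_mx rc (T1r (del sigma xi)).
Proof. rewrite /T1 /absp -/(del _ _); entriesC. Qed.

Lemma del_sqr sigma xi : 0 <= sigma < 1 -> enorm xi `^ (4 - 4 * sigma) = del sigma xi ^+ 2.
Proof.
move=> /andP[s0 s1]; rewrite expr2 /del powR_sum ?enorm_ge0//; last 2 first.
- by lra.
- by rewrite gt_eqF//; lra.
by congr (_ `^ _); ring.
Qed.

Lemma T1hE sigma xi : 0 <= sigma < 1 ->
  T1h sigma xi = map_mx rc (T1hr (del sigma xi ^+ 2)).
Proof. move=> s01; rewrite /T1h /absp del_sqr//; entriesC. Qed.

Definition TTr (d : R) : 'M[R]_3 := T0r *m T1r d *m T1hr (d ^+ 2).

Definition TTinv (d : R) : 'M[R]_3 := T1hinv (d ^+ 2) *m (T1inv d *m T0inv).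

Lemma TTE sigma xi : 0 <= sigma < 1 ->
  T0 R *m T1 sigma xi *m T1h sigma xi = map_mx rc (TTr (del sigma xi)).
Proof. by move=> s01; rewrite T0E T1E T1hE// -!map_mxM. Qed.

Lemma invmx_map (A B : 'M[R]_3) : A *m B = 1%:M -> invmx (map_mx rc A) = map_mx rc B.
Proof.
move=> AB; have ABc : map_mx rc A *m map_mx rc B = 1%:M by rewrite -map_mxM AB map_mx1.
have [uA _] := mulmx1_unit ABc.
by rewrite -[LHS]mulmx1 -ABc mulKmx.
Qed.

Lemma ref_initE sigma (w0 : 'rV[R]_n -> 'cV[C]_3) xi : 0 <= sigma < 1 ->
  del sigma xi <= 1 / 4 -> ref_init sigma w0 xi = map_mx rc (TTinv (del sigma xi)) *m w0 xi.
Proof.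
move=> s01 d4; rewrite /ref_init T0E T1E T1hE//; have d0 := del_ge0 sigma xi.
have d2 : del sigma xi ^+ 2 <= 1 / 16 by have := ler_pM d0 d0 d4 d4; lra.
rewrite (invmx_map T0V) (invmx_map (T1V _)); last by rewrite lt_eqF//; lra.
rewrite (invmx_map (T1hV _)); first by rewrite !mulmxA -!map_mxM /TTinv !mulmxA.
have := ler_pM (sqr_ge0 _) (sqr_ge0 _) d2 d2; rewrite -expr2 => h.
by rewrite lt_eqF//; lra.
Qed.

Lemma TTrK (d : R) : 0 <= d <= 1 / 4 -> TTr d *m TTinv d = 1%:M.
Proof.
move=> /andP[d0 d4]; have d2 : d ^+ 2 <= 1 / 16 by have := ler_pM d0 d0 d4 d4; lra.
rewrite /TTr /TTinv !mulmxA -(mulmxA _ (T1hr _)) T1hV ?mulmx1; last first.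
  have := ler_pM (sqr_ge0 _) (sqr_ge0 _) d2 d2; rewrite -expr2 => h.
  by rewrite lt_eqF//; lra.
rewrite -(mulmxA _ (T1r _)) T1V ?mulmx1 ?T0V//.
by rewrite lt_eqF//; lra.
Qed.

(** The symbol with r^(2 sigma) = [ro] factored out, using r^2 = ro d; likewise r^(4 - 2 sigma) = ro
    d^2 in [refN]. *)
Definition plateN (ro d : R) : 'M[R]_3 := (ro * d) *: A0r + ro *: A1r.

Definition refN (ro d : R) : 'M[R]_3 :=
  rmx3 [:: [:: ro * d ^+ 2; 0; 0]; [:: 0; ro * d; 0]; [:: 0; 0; ro]].

Lemma rho_del sigma xi : 0 <= sigma < 1 -> enorm xi `^ 2 = rho sigma xi * del sigma xi.
Proof.
move=> /andP[s0 s1]; rewrite /rho /del powR_sum ?enorm_ge0//; last 2 first.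
- by lra.
- by rewrite gt_eqF//; lra.
by congr (_ `^ _); ring.
Qed.

Lemma rho_del_sqr sigma xi : 0 <= sigma < 1 ->
  enorm xi `^ (4 - 2 * sigma) = rho sigma xi * del sigma xi ^+ 2.
Proof.
move=> s01; rewrite -del_sqr//; case/andP: s01 => s0 s1.
rewrite /rho powR_sum ?enorm_ge0//; last 2 first.
- by lra.
- by rewrite gt_eqF//; lra.
by congr (_ `^ _); ring.
Qed.

Lemma plate_symbolE sigma xi : 0 <= sigma < 1 ->
  plate_symbol sigma xi = map_mx rc (plateN (rho sigma xi) (del sigma xi)).
Proof.
move=> s01; rewrite /plate_symbol /absp A0E A1E (rho_del _ s01) -/(rho _ _).
by rewrite -!map_mxZ -map_mxD.
Qed.

Lemma ref_symbolE sigma xi : 0 <= sigma < 1 ->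
  ref_symbol sigma xi = map_mx rc (refN (rho sigma xi) (del sigma xi)).
Proof.
move=> s01; rewrite /ref_symbol /absp (rho_del _ s01) (rho_del_sqr _ s01) -/(rho _ _).
by entries3.
Qed.

Lemma ord3_ind (P : 'I_3 -> Prop) :
  P ord0 -> P (lift ord0 ord0) -> P (lift ord0 (lift ord0 ord0)) -> forall i, P i.
Proof.
move=> P0 P1 P2 -[[|[|[|//]]] i3].
- by rewrite (_ : Ordinal i3 = ord0)//; exact: val_inj.
- by rewrite (_ : Ordinal i3 = lift ord0 ord0)//; exact: val_inj.
- by rewrite (_ : Ordinal i3 = lift ord0 (lift ord0 ord0))//; exact: val_inj.
Qed.

Lemma sum3E (V : nmodType) (F : 'I_3 -> V) :
  \sum_i F i = F ord0 + F (lift ord0 ord0) + F (lift ord0 (lift ord0 ord0)).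
Proof. by rewrite !big_ord_recl big_ord0 addr0 addrA. Qed.

Definition real_solution (N : 'M[R]_3) (x : R -> 'cV[R]_3) :=
  (forall i, x s i 0 @[s --> 0^'+] --> x 0 i 0) /\
  forall t : R, 0 < t ->
    forall i, is_derive t 1 (fun s : R => x s i 0) (- \sum_l N i l * x t l 0).

Lemma Re_map_mulmx (A : 'M[R]_3) (z : 'cV[C]_3) :
  map_mx (@complex.Re R) (map_mx rc A *m z) = A *m map_mx (@complex.Re R) z.
Proof.
apply/matrixP => i j; rewrite !mxE raddf_sum; apply: eq_bigr => k _.
by rewrite !mxE; case: (z k j) => a b /=; rewrite mul0r subr0.
Qed.

Lemma Im_map_mulmx (A : 'M[R]_3) (z : 'cV[C]_3) :
  map_mx (@complex.Im R) (map_mx rc A *m z) = A *m map_mx (@complex.Im R) z.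
Proof.
apply/matrixP => i j; rewrite !mxE raddf_sum; apply: eq_bigr => k _.
by rewrite !mxE; case: (z k j) => a b /=; rewrite mul0r addr0.
Qed.

Lemma solves_real (M : 'rV[R]_n -> 'M[C]_3) w0 w xi (N : 'M[R]_3) :
  M xi = map_mx rc N -> solves M w0 w ->
  real_solution N (fun t => map_mx (@complex.Re R) (w t xi)) /\
  real_solution N (fun t => map_mx (@complex.Im R) (w t xi)).
Proof.
move=> MN /(_ xi)[_ cw dw].
have fR i : (fun s => map_mx (@complex.Re R) (w s xi) i 0) = (fun s => ReC (w s xi i 0)).
  by apply/funext => s; rewrite mxE.
have fI i : (fun s => map_mx (@complex.Im R) (w s xi) i 0) = (fun s => ImC (w s xi i 0)).
  by apply/funext => s; rewrite mxE.
split; split.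
- by move=> i; rewrite fR mxE; have [] := cw i.
- move=> t t0 i; have [z [z0 dz]] := dw _ t0; have [dzR _] := dz i.
  rewrite fR; apply: is_derive_eq dzR _.
  have -> : z = - (M xi *m w t xi) by apply/eqP; rewrite -addr_eq0 z0.
  have e : ReC ((map_mx rc N *m w t xi) i 0) =
      \sum_l N i l * map_mx (@complex.Re R) (w t xi) l 0.
    have := congr1 (fun A : 'cV_3 => A i 0) (Re_map_mulmx N (w t xi)).
    by rewrite [map_mx _ (_ *m _) _ _]mxE => ->; rewrite mxE.
  by rewrite MN [(- (_ *m _)) _ _]mxE -e; case: ((_ *m _) i 0).
- by move=> i; rewrite fI mxE; have [] := cw i.
- move=> t t0 i; have [z [z0 dz]] := dw _ t0; have [_ dzI] := dz i.
  rewrite fI; apply: is_derive_eq dzI _.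
  have -> : z = - (M xi *m w t xi) by apply/eqP; rewrite -addr_eq0 z0.
  have e : ImC ((map_mx rc N *m w t xi) i 0) =
      \sum_l N i l * map_mx (@complex.Im R) (w t xi) l 0.
    have := congr1 (fun A : 'cV_3 => A i 0) (Im_map_mulmx N (w t xi)).
    by rewrite [map_mx _ (_ *m _) _ _]mxE => ->; rewrite mxE.
  by rewrite MN [(- (_ *m _)) _ _]mxE -e; case: ((_ *m _) i 0).
Qed.

Lemma TTr_mul (d : R) (y : 'cV[R]_3) :
  let a := y ord0 0 in let b := y (lift ord0 ord0) 0 in
  let c := y (lift ord0 (lift ord0 ord0)) 0 in
  let e1 := a + d ^+ 3 * b + d * c in
  let e2 := (1 + d ^+ 3) * b + (d + d ^+ 2) * c in
  let e3 := d * a + (d + d ^+ 2) * b + (1 + d ^+ 3) * c in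
  [/\ (TTr d *m y) ord0 0 = - e1 + e3, (TTr d *m y) (lift ord0 ord0) 0 = e1 + e3 &
      (TTr d *m y) (lift ord0 (lift ord0 ord0)) 0 = e2].
Proof.
move=> a b c e1 e2 e3; rewrite /TTr -!mulmxA.
by split; rewrite !(mxE, sum3E) /= -/a -/b -/c /e1 /e2 /e3; ring.
Qed.

(* In the variables [T0^-1 x] the system is that of [plate_energy]. *)
Lemma real_solution_dist (ro d : R) (x y : R -> 'cV[R]_3) (t : R) :
  0 <= ro -> 0 <= d <= 1 / 4 ->
  real_solution (plateN ro d) x -> real_solution (refN ro d) y ->
  x 0 = TTr d *m y 0 -> 0 <= t ->
  \sum_i ((x t - TTr d *m y t) i 0) ^+ 2 <=
  660 * d ^+ 2 * expR (- (ro * d ^+ 2 / 8) * t) * \sum_i (x 0 i 0) ^+ 2.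
Proof.
move=> ro0 d01 [cx dx] [cy dy] xy t0.
pose x0 (s : R) : R := x s ord0 0; pose x1 (s : R) : R := x s (lift ord0 ord0) 0.
pose x2 (s : R) : R := x s (lift ord0 (lift ord0 ord0)) 0.
pose y0 (s : R) : R := y s ord0 0; pose y1 (s : R) : R := y s (lift ord0 ord0) 0.
pose y2 (s : R) : R := y s (lift ord0 (lift ord0 ord0)) 0.
pose v1 (s : R) : R := 2^-1 * x1 s - 2^-1 * x0 s; pose v3 (s : R) : R := 2^-1 * x0 s + 2^-1 * x1 s.
have dx3 (s : R) : 0 < s ->
    [/\ is_derive s 1 x0 (- (ro * d) * (- x1 s - x2 s) - ro / 2 * (x0 s + x1 s)),
    is_derive s 1 x1 (- (ro * d) * (x0 s - x2 s) - ro / 2 * (x0 s + x1 s)) &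
    is_derive s 1 x2 (- (ro * d) * (x0 s / 2 + x1 s / 2 + x2 s))].
  move=> s0; split; apply: is_derive_eq (dx _ s0 _) _;
    rewrite sum3E !mxE /= -/(x0 s) -/(x1 s) -/(x2 s); by field.
have dy3 (s : R) : 0 < s -> [/\ is_derive s 1 y0 (- ro * (d ^+ 2 * y0 s)),
    is_derive s 1 y1 (- ro * (d * y1 s)) & is_derive s 1 y2 (- ro * y2 s)].
  move=> s0; split; apply: is_derive_eq (dy _ s0 _) _;
    rewrite sum3E !mxE /= -/(y0 s) -/(y1 s) -/(y2 s); by field.
have [xy0 xy1 xy2] := TTr_mul d (y 0).
rewrite -xy -/(x0 0) -/(x1 0) -/(x2 0) -/(y0 0) -/(y1 0) -/(y2 0) in xy0 xy1 xy2.
have [h0 h1 h2] := TTr_mul d (y t).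
rewrite -/(y0 t) -/(y1 t) -/(y2 t) in h0 h1 h2.
have mB (A B : 'cV[R]_3) i : (A - B) i 0 = A i 0 - B i 0 by rewrite !mxE.
rewrite !sum3E !mB h0 h1 h2 -/(x0 t) -/(x1 t) -/(x2 t) -/(x0 0) -/(x1 0) -/(x2 0).
have : (v1 t - (y0 t + d ^+ 3 * y1 t + d * y2 t)) ^+ 2 +
  (x2 t - ((1 + d ^+ 3) * y1 t + (d + d ^+ 2) * y2 t)) ^+ 2 +
  (v3 t - (d * y0 t + (d + d ^+ 2) * y1 t + (1 + d ^+ 3) * y2 t)) ^+ 2 <=
  330 * d ^+ 2 * expR (- (ro * d ^+ 2 / 8) * t) * (v1 0 ^+ 2 + x2 0 ^+ 2 + v3 0 ^+ 2).
  apply: plate_energy => //.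
  - split; [|exact: cx|].
    + by apply: cvgB; apply: cvgM; [exact: cvg_cst|exact: cx|exact: cvg_cst|exact: cx].
    + by apply: cvgD; apply: cvgM; [exact: cvg_cst|exact: cx|exact: cvg_cst|exact: cx].
  - by split; exact: cy.
  - move=> s s0; have [d0 d1 d2] := dx3 s s0; split.
    + by apply: is_derive_eq; rewrite /GRing.scale /= /v3; field.
    + by apply: is_derive_eq; rewrite /v3; field.
    + by apply: is_derive_eq; rewrite /GRing.scale /= /v1 /v3; field.
  - by rewrite /v1 xy0 xy1; field.
  - by rewrite /v3 xy0 xy1; field.
set K := 330 * _ * _.
have K0 : 0 <= K.
  apply: mulr_ge0; last exact: expR_ge0.
  by apply: mulr_ge0; [exact: ler0n|exact: sqr_ge0].
have -> : 660 * d ^+ 2 * expR (- (ro * d ^+ 2 / 8) * t) = 2 * K by rewrite /K; ring.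
set e1 := y0 t + _ + _; set e2 := _ * y1 t + _; set e3 := d * y0 t + _ + _ => H.
(* The first two rows of [T0] send (v1, v3) to (- v1 + v3, v1 + v3), which doubles the sum of
   squares: hence 660 = 2 * 330. The initial data, transformed by the inverse, only get smaller. *)
have {}H : (x0 t - (- e1 + e3)) ^+ 2 + (x1 t - (e1 + e3)) ^+ 2 + (x2 t - e2) ^+ 2 <=
    2 * (K * (v1 0 ^+ 2 + x2 0 ^+ 2 + v3 0 ^+ 2)).
  apply: le_trans (ler_wpM2l _ H) => //; rewrite /v1 /v3.
  have := sqr_ge0 (x2 t - e2); set q := _ ^+ 2; nra.
apply: le_trans H _; rewrite -mulrA ler_wpM2l// ler_wpM2l// /v1 /v3.
have := sqr_ge0 (x0 0 + x1 0); have := sqr_ge0 (x0 0 - x1 0); nra.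
Qed.

Lemma sum_normc_sqr (z : 'cV[C]_3) :
  \sum_i normc (z i 0) ^+ 2 = \sum_i (map_mx (@complex.Re R) z i 0) ^+ 2 +
                              \sum_i (map_mx (@complex.Im R) z i 0) ^+ 2.
Proof. by rewrite -big_split; apply: eq_bigr => i _; rewrite normc_sqr !mxE. Qed.

(** Both symbols and the diagonalizers have real entries, so real and imaginary parts solve the same
    real systems; the real estimate is applied to each and the results are added. *)
Lemma plate_pointwise sigma xi w0 w wt (t : R) :
  0 <= sigma < 1 -> del sigma xi <= 1 / 4 -> 0 <= t ->
  solves (plate_symbol sigma) w0 w -> solves (ref_symbol sigma) (ref_init sigma w0) wt ->
  \sum_i normc ((w t xi - T0 R *m T1 sigma xi *m T1h sigma xi *m wt t xi) i 0) ^+ 2 <=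
  660 * del sigma xi ^+ 2 * expR (- (rho sigma xi * del sigma xi ^+ 2 / 8) * t) *
  \sum_i normc (w0 xi i 0) ^+ 2.
Proof.
move=> s01 d4 t0 sw swt.
have ro0 := rho_ge0 sigma xi.
have d01 : 0 <= del sigma xi <= 1 / 4 by rewrite del_ge0.
have w0E : w 0 xi = map_mx rc (TTr (del sigma xi)) *m wt 0 xi.
  have [-> _ _] := sw xi; have [-> _ _] := swt xi.
  by rewrite ref_initE// mulmxA -map_mxM TTrK// map_mx1 mul1mx.
have [Rw Iw] := solves_real (plate_symbolE xi s01) sw.
have [Rwt Iwt] := solves_real (ref_symbolE xi s01) swt.
have [<- _ _] := sw xi.
rewrite TTE// !sum_normc_sqr !map_mxB Re_map_mulmx Im_map_mulmx mulrDr lerD//.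
  by apply: (real_solution_dist ro0 d01 Rw Rwt _ t0); rewrite w0E Re_map_mulmx.
by apply: (real_solution_dist ro0 d01 Iw Iwt _ t0); rewrite w0E Im_map_mulmx.
Qed.

Lemma plate_init_normc (u0h u1h theta0h : 'rV[R]_n -> C) xi :
  \sum_i normc (plate_init u0h u1h theta0h xi i 0) ^+ 2 =
  2 * normc (absp xi 2 * u0h xi) ^+ 2 + 2 * normc (u1h xi) ^+ 2 + normc (theta0h xi) ^+ 2.
Proof.
rewrite sum3E !mxE /= !normc_sqr.
by case: (absp xi 2 * u0h xi) => a b; case: (u1h xi) => c d /=; ring.
Qed.

End plate_pointwise.

(** * Measurability in the frequency *)

Section plate_measurable.
Variable R : realType.
Local Notation C := R[i].
Local Notation ReC := complex.Re.
Local Notation ImC := complex.Im.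
Local Notation rc := (real_complex R).
Local Notation normc := ComplexField.Normc.normc.

Lemma measurable_enorm n : measurable_fun setT (@enorm R n).
Proof.
apply: measurableT_comp; last exact: measurable_dotv.
by apply: continuous_measurable_fun; exact: sqrt_continuous.
Qed.

(* The sigma-algebra is generated by the coordinates, so a continuous function
   is approximated by its values on the grids [Z^n / (k + 1)]. *)
Lemma measurable_continuous_rV n (f : 'rV[R]_n -> R) :
  continuous f -> measurable_fun setT f.
Proof.
move=> cf.
pose gr k (z : 'rV[int]_n) : 'rV[R]_n := \row_i ((z 0 i)%:~R / k.+1%:R).
pose fl k (x : 'rV[R]_n) : 'rV[int]_n := \row_i Num.floor (k.+1%:R * x 0 i).
apply: (@measurable_fun_cvg _ _ _ _ (fun k x => f (gr k (fl k x)))).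
  move=> k _ B mB; rewrite setTI.
  (* The grid approximation is constant on the cell of each integer vector [z], so preimages are
     countable unions of such boxes. *)
  pose F (z : 'rV[int]_n) : set 'rV[R]_n := [set x | B (f (gr k z))] `&`
    \bigcap_(i in [set: 'I_n]) ((fun x : 'rV[R]_n => k.+1%:R * x 0 i) @^-1`
      `[(z 0 i)%:~R, (z 0 i)%:~R + 1[%classic).
  rewrite (_ : _ @^-1` _ = \bigcup_z F z).
    apply: countable_bigcupT_measurable => [|z]; first exact: countableP.
    apply: measurableI; first by case: (pselect (B (f (gr k z)))) => h;
      [rewrite (_ : [set _ | _] = setT)|rewrite (_ : [set _ | _] = set0)] => //; apply/seteqP; split.
    apply: fin_bigcap_measurable => // i _; rewrite -[X in measurable X]setTI.
    by apply: measurable_funM => //; exact: measurable_coord.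
  apply/seteqP; split => x /=.
    move=> Bx; exists (fl k x) => //; split => // i _ /=.
    by rewrite in_itv /= mxE floor_le -(intrD _ _ 1) floorD1_gt.
  move=> [z _ [/= Bz zx]]; suff -> : fl k x = z by [].
  apply/rowP => i; rewrite mxE; apply: floor_def.
  by have := zx i I; rewrite /= in_itv /= intrD.
move=> x _; apply: (@cvg_comp _ _ _ (fun k => gr k (fl k x)) f _ (nbhs x)); last exact: cf.
apply/cvg_ballP => e e0; near=> k; split => // i j; rewrite ord1 !mxE.
have k0 : 0 < k.+1%:R :> R by [].
have := floor_le (k.+1%:R * x 0 j); have := floorD1_gt (k.+1%:R * x 0 j).
rewrite intrD; set z := (_%:~R) => h1 h2.
rewrite /ball /= ger0_norm ?subr_ge0 ?ler_pdivrMr 1?[x 0 j * _]mulrC//.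
rewrite -(ltr_pM2r k0) mulrBl divfK ?gt_eqF// [x 0 j * _]mulrC.
apply: (@lt_le_trans _ _ 1); first by rewrite ltrBlDl.
rewrite -ler_pdivrMr// mul1r; apply/ltW; near: k; exact: (near_infty_natSinv_lt (PosNum e0)).
Unshelve. all: by end_near.
Qed.

Section on_domain.
Context d (T : measurableType d) (D : set T).
Implicit Types p q r : nat.

Definition measurable_mx p q (A : T -> 'M[R]_(p, q)) :=
  forall i j, measurable_fun D (fun t => A t i j).

Lemma measurable_mx_cst p q (A : 'M[R]_(p, q)) : measurable_mx (fun=> A).
Proof. by move=> i j; exact: measurable_cst. Qed.

Lemma measurable_mxM p q r (A : T -> 'M[R]_(p, q)) (B : T -> 'M[R]_(q, r)) :
  measurable_mx A -> measurable_mx B -> measurable_mx (fun t => A t *m B t).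
Proof.
move=> mA mB i j; under [X in measurable_fun _ X]eq_fun do rewrite mxE.
by apply: measurable_sum => k; exact: measurable_funM.
Qed.

Lemma measurable_mxD p q (A B : T -> 'M[R]_(p, q)) :
  measurable_mx A -> measurable_mx B -> measurable_mx (fun t => A t + B t).
Proof.
move=> mA mB i j; under [X in measurable_fun _ X]eq_fun do rewrite mxE.
exact: measurable_funD.
Qed.

Lemma measurable_mxB p q (A B : T -> 'M[R]_(p, q)) :
  measurable_mx A -> measurable_mx B -> measurable_mx (fun t => A t - B t).
Proof.
move=> mA mB i j; under [X in measurable_fun _ X]eq_fun do rewrite !mxE.
exact: measurable_funB.
Qed.

Lemma measurable_mxZ p q (a : T -> R) (A : 'M[R]_(p, q)) :
  measurable_fun D a -> measurable_mx (fun t => a t *: A).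
Proof.
move=> ma i j; under [X in measurable_fun _ X]eq_fun do rewrite mxE.
exact: measurable_funM.
Qed.

Lemma measurable_mx3 (A : T -> seq (seq R)) :
  (forall i j, (i < 3)%N -> (j < 3)%N ->
     measurable_fun D (fun t => nth 0 (nth [::] (A t) i) j)) ->
  measurable_mx (fun t => rmx3 (A t)).
Proof.
move=> mA i j; under [X in measurable_fun _ X]eq_fun do rewrite mxE.
exact: mA.
Qed.

(** The solution is the pointwise limit of partial sums that are polynomial in [N] and the initial
    value; uniqueness is implicit in that convergence. *)
Lemma measurable_real_solution (N : T -> 'M[R]_3) (x : R -> T -> 'cV[R]_3) (t : R) :
  measurable_mx N -> measurable_mx (x 0) ->
  (forall a, D a -> real_solution (N a) (x ^~ a)) -> 0 <= t ->
  measurable_mx (x t).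
Proof.
move=> mN mx0 sx t0 i j; rewrite ord1.
apply: (@measurable_fun_cvg _ _ _ _ (fun k a => series_sol (N a) (x 0 a) t k i)).
  move=> k; apply: measurable_sum => l; apply: measurable_funM => //.
  apply: (@measurable_mxM _ _ _ (fun a => N a ^+ l) (x 0)) => //.
  elim: (nat_of_ord l) => [|p IHl]; first exact: measurable_mx_cst.
  have := measurable_mxM mN IHl; rewrite (_ : (fun _ => _ *m _) = (fun a => N a ^+ p.+1))//.
  by apply/funext => a; rewrite exprS.
by move=> a Da; have [cx dx] := sx a Da; exact: (series_sol_cvg cx dx).
Qed.

Lemma measurable_TTinv (a : T -> R) : measurable_fun D a -> measurable_mx (fun t => TTinv (a t)).
Proof.
move=> ma; have ma2 : measurable_fun D (fun t => a t ^+ 2) by exact: measurable_funX.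
(* Inversion is expressed through a real power of a square, since real powers are measurable; where
   b vanishes both sides are 0 by the convention for the inverse of 0. *)
have mV (b : T -> R) : measurable_fun D b -> measurable_fun D (fun t => (b t)^-1).
  move=> mb; rewrite (_ : (fun t => (b t)^-1) = (fun t => b t * (b t ^+ 2) `^ (-1))).
    apply: measurable_funM => //; apply: (@measurableT_comp _ _ _ _ _ _ (fun y : R => y `^ (-1))).
      exact: measurable_powR.
    exact: measurable_funX.
  apply/funext => s; rewrite powR_inv1 ?sqr_ge0// -exprVn expr2 mulrA.
  have [->|b0] := eqVneq (b s) 0; first by rewrite invr0 mulr0.
  by rewrite divff// mul1r.
have m1 (b : R) : measurable_fun D (fun=> b) by [].
have mc : measurable_fun D (fun t => (1 - 2 * a t ^+ 2)^-1).
  by apply: mV; apply: measurable_funB => //; apply: measurable_funM.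
have mc' : measurable_fun D (fun t => (1 - (a t ^+ 2) ^+ 2)^-1).
  by apply: mV; apply: measurable_funB => //; apply: measurable_funX.
rewrite /TTinv; apply: measurable_mxM.
  apply: measurable_mx3 => -[|[|[|//]]] [|[|[|//]]] _ _ //=.
  - by apply: measurable_funM => //; apply: measurableT_comp.
  - by apply: measurable_funM => //; apply: measurableT_comp.
apply: measurable_mxM; last exact: measurable_mx_cst.
apply: measurable_mx3 => -[|[|[|//]]] [|[|[|//]]] _ _ //=.
all: try by apply: measurable_funM => //; apply: measurableT_comp.
all: try by apply: measurable_funM.
all: apply: measurable_funD => //; exact: measurable_funM.
Qed.

Lemma measurable_TTr (a : T -> R) : measurable_fun D a -> measurable_mx (fun t => TTr (a t)).
Proof.
move=> ma; have ma2 : measurable_fun D (fun t => a t ^+ 2) by exact: measurable_funX.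
rewrite /TTr; apply: measurable_mxM; last first.
  by apply: measurable_mx3 => -[|[|[|//]]] [|[|[|//]]].
apply: measurable_mxM; first exact: measurable_mx_cst.
by apply: measurable_mx3 => -[|[|[|//]]] [|[|[|//]]].
Qed.

Lemma measurable_refN (r a : T -> R) : measurable_fun D r -> measurable_fun D a ->
  measurable_mx (fun t => refN (r t) (a t)).
Proof.
move=> mr ma; apply: measurable_mx3 => -[|[|[|//]]] [|[|[|//]]] _ _ //=.
  by apply: measurable_funM => //; exact: measurable_funX.
exact: measurable_funM.
Qed.

Lemma measurable_plateN (r a : T -> R) : measurable_fun D r -> measurable_fun D a ->
  measurable_mx (fun t => plateN (r t) (a t)).
Proof.
move=> mr ma; apply: measurable_mxD; last exact: measurable_mxZ.
by apply: measurable_mxZ; exact: measurable_funM.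
Qed.

End on_domain.

Lemma measurable_powR_enorm n (a : R) (D : set 'rV[R]_n) :
  measurable_fun D (fun xi => enorm xi `^ a).
Proof.
apply: (@measurableT_comp _ _ _ _ _ _ (fun y : R => y `^ a)).
  exact: measurable_powR.
by apply: measurable_funTS; exact: measurable_enorm.
Qed.

(** The region [D] is restricted to del <= 1/4 because only there is the reference datum given by
    the explicit inverse matrices. The argument is run once for an additive map [f] commuting with
    real matrices, then for real and imaginary parts. *)
Lemma measurable_plate_diff n sigma (D : set 'rV[R]_n) w0 w wt (t : R) :
  0 <= sigma < 1 -> (forall xi, D xi -> del sigma xi <= 1 / 4) -> 0 <= t ->
  measurable_mx D (fun xi => map_mx (@complex.Re R) (w0 xi)) ->
  measurable_mx D (fun xi => map_mx (@complex.Im R) (w0 xi)) ->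
  solves (plate_symbol sigma) w0 w -> solves (ref_symbol sigma) (ref_init sigma w0) wt ->
  let e xi := w t xi - T0 R *m T1 sigma xi *m T1h sigma xi *m wt t xi in
  measurable_mx D (fun xi => map_mx (@complex.Re R) (e xi)) /\
  measurable_mx D (fun xi => map_mx (@complex.Im R) (e xi)).
Proof.
move=> s01 Dd t0 mR mI sw swt e.
have mdel : measurable_fun D (del sigma) by exact: measurable_powR_enorm.
have mrho : measurable_fun D (rho sigma) by exact: measurable_powR_enorm.
have key (f : {additive C -> R}) :
    (forall (A : 'M[R]_3) (z : 'cV[C]_3), map_mx f (map_mx rc A *m z) = A *m map_mx f z) ->
    measurable_mx D (fun xi => map_mx f (w0 xi)) ->
    (forall M u0 u xi (N : 'M[R]_3), M xi = map_mx rc N -> @solves R n M u0 u ->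
       real_solution N (fun t => map_mx f (u t xi))) ->
    measurable_mx D (fun xi => map_mx f (e xi)).
  move=> fM mf sf.
  rewrite (_ : (fun xi => _) = (fun xi => map_mx f (w t xi) -
      TTr (del sigma xi) *m map_mx f (wt t xi))); last first.
    by apply/funext => xi; rewrite /e TTE// map_mxB fM.
  apply: measurable_mxB; last apply: measurable_mxM.
  - apply: (measurable_real_solution (measurable_plateN mrho mdel)
      (x := fun t xi => map_mx f (w t xi))) => //.
    + move=> i j; apply: eq_measurable_fun (mf i j) => xi _.
      by have [-> _ _] := sw xi.
    + by move=> xi _; apply: sf sw; exact: plate_symbolE.
  - exact: measurable_TTr.
  - apply: (measurable_real_solution (measurable_refN mrho mdel)
      (x := fun t xi => map_mx f (wt t xi))) => //.
    + have mU := measurable_mxM (measurable_TTinv mdel) mf.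
      move=> i j; apply: eq_measurable_fun (mU i j) => xi; rewrite inE => Dxi.
      by have [-> _ _] := swt xi; rewrite ref_initE ?fM//; exact: Dd.
    + by move=> xi _; apply: sf swt; exact: ref_symbolE.
split; apply: key => //.
- exact: Re_map_mulmx.
- by move=> M u0 u xi N MN su; have [] := solves_real MN su.
- exact: Im_map_mulmx.
- by move=> M u0 u xi N MN su; have [] := solves_real MN su.
Qed.

End plate_measurable.

(** * Decay of the low-frequency multiplier *)

Section plate_weight.
Variables (R : realType) (n : nat).
Implicit Types (xi : 'rV[R]_n) (sigma : R).

(** This is y / p <= exp(y / p) raised to the power p; it trades a power of the frequency for part
    of the exponential decay. *)
Lemma powR_expR_le (p y : R) : 0 < p -> 0 <= y -> (16 * y) `^ p <= (16 * p) `^ p * expR y.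
Proof.
move=> p0 y0; have p0' := ltW p0.
have -> : expR y = expR (y / p) `^ p by rewrite -expRM divfK ?gt_eqF.
rewrite -powRM ?expR_ge0// ?mulr_ge0//.
have yp : 0 <= y / p by exact: divr_ge0.
apply: ge0_ler_powR => //; rewrite ?nnegrE ?mulr_ge0 ?expR_ge0//.
rewrite -mulrA ler_wpM2l// -ler_pdivrMl// mulrC.
by apply: le_trans (expR_ge1Dx _); rewrite lerDr.
Qed.

(** In each coordinate 1 + q^2 <= 16 exp(q^2 / 16). Comparison with the kernel makes its known mass
    available in place of a Gaussian integral. *)
Lemma gauss_le_cauchy_kernel (tau : R) xi : 0 < tau ->
  expR (- ((tau * enorm xi) ^+ 2 / 16)) <= tau ^- n * cauchy_kernel tau xi.
Proof.
move=> tau0.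
have -> : - ((tau * enorm xi) ^+ 2 / 16) = \sum_i - ((tau * xi 0 i) ^+ 2 / 16).
  rewrite exprMn sqr_sqrtr; last by apply: sumr_ge0 => i _; rewrite -expr2 sqr_ge0.
  rewrite /dotv mulr_sumr mulr_suml -sumrN; apply: eq_bigr => i _.
  by rewrite -expr2 exprMn.
rewrite expR_sum (_ : tau ^- n = \prod_(i < n) tau^-1); last by rewrite prodr_const card_ord exprVn.
rewrite -big_split /=.
apply: ler_prod => i _; rewrite expR_ge0 /=.
set q := tau * _; have -> : tau^-1 * (16 * (tau / (1 + q ^+ 2))) = 16 / (1 + q ^+ 2).
  have q0 : 1 + q ^+ 2 != 0 by rewrite gt_eqF// ltr_pwDl ?sqr_ge0.
  by field; rewrite q0 gt_eqF.
have q0 : 0 < 1 + q ^+ 2 by rewrite ltr_pwDl ?sqr_ge0.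
rewrite expRN ler_pdivlMr// mulrC ler_pdivrMr ?expR_gt0//.
have := expR_ge1Dx (q ^+ 2 / 16); lra.
Qed.

Definition wexp sigma (s : R) := 2 * s + 4 - 4 * sigma.

(** The squared multiplier of the pointwise estimate, with r^(2 s) for the Sobolev norm and without
    the numerical constant. The sharp truncation at [eps] replaces the smooth cutoff, which it
    dominates. *)
Definition plate_wgt sigma s eps t xi : R :=
  if enorm xi <= eps then
    (enorm xi `^ s) ^+ 2 * (del sigma xi ^+ 2 * expR (- (rho sigma xi * del sigma xi ^+ 2 / 8) * t))
  else 0.

Lemma plate_wgt_ge0 sigma s eps t xi : 0 <= plate_wgt sigma s eps t xi.
Proof.
rewrite /plate_wgt; case: ifP => // _.
by rewrite mulr_ge0 ?sqr_ge0// mulr_ge0 ?sqr_ge0// expR_ge0.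
Qed.

Lemma measurable_plate_wgt sigma s eps t : measurable_fun setT (plate_wgt sigma s eps t).
Proof.
apply: measurable_fun_ifT => //.
  apply: measurable_fun_ler => //; exact: measurable_enorm.
have mp a : measurable_fun setT (fun xi : 'rV[R]_n => enorm xi `^ a).
  exact: measurable_powR_enorm.
apply: measurable_funM; first exact: measurable_funX.
have md : measurable_fun setT (fun xi : 'rV[R]_n => del sigma xi ^+ 2).
  by apply: measurable_funX; exact: mp.
apply: measurable_funM => //.
apply: measurableT_comp => //; apply: measurable_funM => //.
apply: measurableT_comp => //; apply: measurable_funM => //.
by apply: measurable_funM => //; exact: mp.
Qed.

Definition wscale sigma (t : R) := (1 + t) `^ (4 - 2 * sigma)^-1.

Definition wsup sigma s t :=
  let p := wexp sigma s / (4 - 2 * sigma) in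
  expR (8^-1) * (16 * p) `^ p * wscale sigma t `^ (- wexp sigma s).

Lemma wscale_gt0 sigma t : 0 <= t -> 0 < wscale sigma t.
Proof. by move=> t0; apply: powR_gt0; rewrite ltr_pwDl. Qed.

Lemma wsup_ge0 sigma s t : 0 <= wsup sigma s t.
Proof. by rewrite mulr_ge0 ?powR_ge0// mulr_ge0 ?powR_ge0// expR_ge0. Qed.

Lemma plate_wgt_le sigma s eps t xi : 0 <= sigma < 1 -> 0 <= s -> eps <= 1 -> 0 <= t ->
  plate_wgt sigma s eps t xi <= wsup sigma s t /\
  plate_wgt sigma s eps t xi <=
    wsup sigma s t * (expR 1 * (wscale sigma t ^- n * cauchy_kernel (wscale sigma t) xi)).
Proof.
move=> s01 s0 eps1 t0; have /andP[sg0 sg1] := s01.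
pose b := 4 - 2 * sigma; pose a := wexp sigma s.
set tau := wscale sigma t; set B := wsup sigma s t.
have b0 : 0 < b by rewrite /b; lra.
have a0 : 0 < a by rewrite /a /wexp; lra.
have p0 : 0 < a / b by exact: divr_gt0.
have t1 : 0 < 1 + t by lra.
have tau0 : 0 < tau by exact: wscale_gt0.
have B0 : 0 <= B by exact: wsup_ge0.
set r := enorm xi; set q := tau * r; have r0 : 0 <= r by exact: enorm_ge0.
have q0 : 0 <= q by rewrite mulr_ge0// ltW.
have qb : 0 <= q `^ b by exact: powR_ge0.
suff H : plate_wgt sigma s eps t xi <= B * expR (- (q `^ b / 16)).
  split; apply: le_trans H _.
    by rewrite ler_piMr// -[leRHS]expR0 ler_expR oppr_le0 divr_ge0.
  rewrite ler_wpM2l//; apply: le_trans (ler_wpM2l (expR_ge0 _) (gauss_le_cauchy_kernel xi tau0)).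
  rewrite -expRD ler_expR -/r -/q.
  (* Since b = 4 - 2 sigma exceeds 2, q^b dominates q^2 once q >= 1; for q < 1 the summand 1 does,
     and the factor [expR 1] has room for it. *)
  suff : q ^+ 2 <= q `^ b + 1 by lra.
  have [q1|q1] := leP 1 q.
    suff : q `^ 2%:R <= q `^ b by rewrite powR_mulrn//; lra.
    by apply: ler_powR => //; rewrite /b; lra.
  by have := ler_pM q0 q0 (ltW q1) (ltW q1); rewrite -expr2; lra.
rewrite /plate_wgt; case: ifP => [re|_]; last by rewrite mulr_ge0// expR_ge0.
have r1 : r <= 1 by exact: le_trans re eps1.
have rb1 : r `^ b <= 1 by have := @ge0_ler_powR R b (ltW b0) r 1; rewrite !nnegrE powR1; exact.
rewrite -rho_del_sqr// -del_sqr// -/r -/b -powR_mulrn ?powR_ge0// -powRrM mulrA.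
have d0 : 0 < 4 - 4 * sigma by lra.
have sa : s * 2 + (4 - 4 * sigma) = a by rewrite /a /wexp; ring.
rewrite powR_sum ?sa ?gt_eqF//.
have qbE : q `^ b = (1 + t) * r `^ b.
  by rewrite powRM ?(ltW tau0)// /tau /wscale -powRrM mulVf ?gt_eqF// powRr1// ltW.
have ra : r `^ a = tau `^ (- a) * (16 * (q `^ b / 16)) `^ (a / b).
  rewrite mulrCA divff// mulr1 -powRrM mulrCA divff ?gt_eqF// mulr1.
  rewrite powRM ?(ltW tau0)// powRN mulrA mulVf ?mul1r// gt_eqF//.
  exact: powR_gt0.
rewrite ra; set y := q `^ b / 16.
have y0 : 0 <= y by rewrite divr_ge0.
have hy := powR_expR_le p0 y0.
(* Replacing t by 1 + t in the exponential costs exp(1/8), because r^b <= 1. Of the resulting exp(-2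
   y), one factor exp(-y) is spent on the power r^a and the other remains as decay. *)
apply: (@le_trans _ _ (tau `^ (- a) * ((16 * (a / b)) `^ (a / b) * expR y) *
   (expR 8^-1 * expR (- (2 * y))))).
  apply: ler_pM; rewrite ?mulr_ge0 ?powR_ge0 ?expR_ge0 ?ler_wpM2l ?powR_ge0//.
  rewrite -expRD ler_expR /y qbE; lra.
have e : expR y * expR (- (2 * y)) = expR (- y) by rewrite -expRD; congr expR; ring.
rewrite le_eqVlt; apply/orP; left; apply/eqP; rewrite /B /wsup -/a -/b -/tau -e; ring.
Qed.

Lemma integral_plate_wgt sigma s eps t : 0 <= sigma < 1 -> 0 <= s -> eps <= 1 -> 0 <= t ->
  (\int[lebesgue_rV R n]_xi (plate_wgt sigma s eps t xi)%:E <=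
   (wsup sigma s t * (expR 1 * (wscale sigma t ^- n * (16 * pi) ^+ n)))%:E)%E.
Proof.
move=> s01 s0 eps1 t0; set tau := wscale sigma t; set B := wsup sigma s t.
have tau0 : 0 < tau by exact: wscale_gt0.
have B0 : 0 <= B by exact: wsup_ge0.
have c0 : 0 <= B * (expR 1 * tau ^- n).
  by rewrite mulr_ge0// mulr_ge0 ?expR_ge0// invr_ge0 exprn_ge0// ltW.
apply: (@le_trans _ _ (\int[lebesgue_rV R n]_xi ((B * (expR 1 * tau ^- n)) * cauchy_kernel tau xi)%:E)%E).
  apply: ge0_le_integral => //.
  - by move=> xi _; rewrite lee_fin plate_wgt_ge0.
  - by apply/measurable_EFinP; exact: measurable_plate_wgt.
  - by apply/measurable_EFinP; apply: measurable_funM => //; exact: measurable_cauchy_kernel.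
  - move=> xi _; rewrite lee_fin; have [_] := plate_wgt_le xi s01 s0 eps1 t0.
    by rewrite -/tau -/B !mulrA.
under eq_integral do rewrite EFinM.
rewrite ge0_integralZl_EFin//; first last.
- by apply/measurable_EFinP; exact: measurable_cauchy_kernel.
- by move=> xi _; rewrite lee_fin cauchy_kernel_ge0.
under eq_integral do rewrite -[X in cauchy_kernel _ X]subr0.
by rewrite integral_cauchy_kernel// -EFinM !mulrA.
Qed.

Definition rate sigma s m : R :=
  - (((2 - m) * n%:R + 2 * m * s) / (4 * m * (2 - sigma))) - (1 - sigma) / (2 - sigma).

(** With V proportional to tau^-n, the exponent of 1 + t in B V^(2/m - 1) is (- a - n (2/m - 1)) /
    (4 - 2 sigma), where a is [wexp sigma s]; this is exactly twice [rate]. All factors free of t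
    are collected in [K], chosen before t. *)
Lemma plate_wgt_bounds sigma s m eps : 0 <= sigma < 1 -> 0 <= s -> 1 <= m -> eps <= 1 ->
  exists K, 0 <= K /\ forall t, 0 <= t -> exists B V,
    [/\ 0 < V, forall xi, plate_wgt sigma s eps t xi <= B,
        (\int[lebesgue_rV R n]_xi (plate_wgt sigma s eps t xi)%:E <= (B * V)%:E)%E &
        B * V `^ (2 / m - 1) = K * ((1 + t) `^ rate sigma s m) ^+ 2].
Proof.
move=> s01 s0 m1 eps1; have /andP[sg0 sg1] := s01.
pose b := 4 - 2 * sigma; pose a := wexp sigma s; pose k := 2 / m - 1.
pose c := expR 1 * (16 * pi) ^+ n : R.
have c0 : 0 < c by rewrite mulr_gt0 ?expR_gt0// exprn_gt0// mulr_gt0// pi_gt0.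
exists (expR (8^-1) * (16 * (a / b)) `^ (a / b) * c `^ k); split.
  by rewrite mulr_ge0 ?powR_ge0// mulr_ge0 ?powR_ge0// expR_ge0.
move=> t t0; have t1 : 0 < 1 + t by lra.
pose tau := wscale sigma t; have tau0 : 0 < tau by exact: wscale_gt0.
exists (wsup sigma s t), (c * tau ^- n); split.
- by rewrite mulr_gt0// invr_gt0 exprn_gt0.
- by move=> xi; have [] := plate_wgt_le xi s01 s0 eps1 t0.
- apply: le_trans (integral_plate_wgt s01 s0 eps1 t0) _.
  by rewrite lee_fin /c -/tau le_eqVlt; apply/orP; left; apply/eqP; ring.
- have tn : 0 <= tau ^- n by rewrite invr_ge0 exprn_ge0// ltW.
  have tD x y : tau `^ x * tau `^ y = tau `^ (x + y).
    by rewrite powRD// (gt_eqF tau0) implybT.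
  rewrite /wsup; cbv zeta; rewrite -/a -/b -/k -/tau [X in _ * X = _]powRM ?(ltW c0)//.
  suff : tau `^ (- a) * (tau ^- n) `^ k = ((1 + t) `^ rate sigma s m) ^+ 2.
    by move=> <-; ring.
  rewrite -powR_mulrn ?(ltW tau0)// -powRN -powR_mulrn ?powR_ge0//.
  rewrite -powRrM tD /tau /wscale -!powRrM; congr (_ `^ _).
  rewrite /k /a /b /wexp /rate; field.
  by rewrite !gt_eqF//; lra.
Qed.

End plate_weight.

(** * The estimate on the Fourier side and its return to physical space *)

Section plate_estimate.
Variables (R : realType) (n : nat).
Local Notation C := R[i].
Local Notation ReC := complex.Re.
Local Notation ImC := complex.Im.
Local Notation normc := ComplexField.Normc.normc.
Local Notation mu := (lebesgue_rV R n).
Implicit Types (xi : 'rV[R]_n).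

Lemma enorm_sqr xi : enorm xi ^+ 2 = \sum_i xi 0 i ^+ 2.
Proof. by rewrite sqr_sqrtr//; apply: sumr_ge0 => i _; rewrite -expr2 sqr_ge0. Qed.

Lemma cauchy_kernel_ge1 xi : enorm xi <= 1 -> 1 <= cauchy_kernel 1 xi.
Proof.
move=> x1; rewrite [leLHS](_ : 1 = \prod_(i < n) (1 : R)); last by rewrite big1.
apply: ler_prod => i _; rewrite ler01 /= mul1r.
have q1 : xi 0 i ^+ 2 <= 1.
  have := ler_pM (enorm_ge0 xi) (enorm_ge0 xi) x1 x1.
  rewrite -expr2 enorm_sqr mulr1; apply: le_trans.
  by rewrite (bigD1 i)//= lerDl; apply: sumr_ge0 => j _; exact: sqr_ge0.
by rewrite mul1r ler_pdivlMr ?mul1r ?ltr_pwDl ?sqr_ge0//; lra.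
Qed.

(** [ifourier] is an integral, so the L^2 bound must first yield integrability. On the unit ball |G|
    <= 1 + |G|^2, and the kernel with N = 1 is an integrable function that is at least 1 there. *)
Lemma LnormC2_ifourier_le (G : 'rV[R]_n -> C) (X : R) :
  Defs.measurableC G -> (forall xi, 1 < enorm xi -> G xi = 0) -> 0 <= X ->
  (\int[mu]_xi (normc (G xi) ^+ 2)%:E <= (X ^+ 2)%:E)%E ->
  (LnormC 2%:E (ifourier G) <= (Num.sqrt (ifourier_const R n) * X)%:E)%E.
Proof.
move=> mG G0 X0 GX; have [mR mI] := mG.
have mn2 : measurable_fun setT (fun xi => normc (G xi) ^+ 2).
  by apply: measurable_funX; exact: measurable_normc.
have iB : mu.-integrable setT (EFin \o (fun xi => cauchy_kernel 1 xi + normc (G xi) ^+ 2)).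
  rewrite (_ : _ \o _ = (fun xi => (cauchy_kernel 1 xi)%:E + (normc (G xi) ^+ 2)%:E)%E)//.
  apply: integrableD => //; apply/integrableP; split.
  - by apply/measurable_EFinP; exact: measurable_cauchy_kernel.
  - under eq_integral do rewrite gee0_abs ?lee_fin ?cauchy_kernel_ge0//.
    under eq_integral do rewrite -[X in cauchy_kernel _ X]subr0.
    by rewrite integral_cauchy_kernel// ltry.
  - by apply/measurable_EFinP.
  - under eq_integral do rewrite gee0_abs ?lee_fin ?sqr_ge0//.
    exact: le_lt_trans GX (ltry _).
have Gle (a : R) xi : `|a| <= normc (G xi) -> `|a| <= cauchy_kernel 1 xi + normc (G xi) ^+ 2.
  move=> aG; have [x1|x1] := leP (enorm xi) 1.
    by have := cauchy_kernel_ge1 x1; have := sqr_ge0 (normc (G xi) - 1); nra.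
  apply: le_trans aG _; rewrite G0//= expr0n /= addr0 sqrtr0.
  by rewrite addr_ge0 ?cauchy_kernel_ge0 ?sqr_ge0.
have iR : mu.-integrable setT (fun xi => (ReC (G xi))%:E).
  by apply: integrable_le iB => // xi; apply: Gle; exact: normr_Re_le.
have iI : mu.-integrable setT (fun xi => (ImC (G xi))%:E).
  by apply: integrable_le iB => // xi; apply: Gle; exact: normr_Im_le.
apply: LnormC2_le; first by rewrite mulr_ge0 ?sqrtr_ge0.
apply: le_trans (integral_ifourier_sqr iR iI) _.
rewrite [in leRHS]exprMn sqr_sqrtr ?ifourier_const_ge0// [leRHS]EFinM.
by apply: lee_wpmul2l; rewrite ?lee_fin ?ifourier_const_ge0.
Qed.

Lemma normc_rM (a : R) (z : C) : normc (a%:C * z) ^+ 2 = a ^+ 2 * normc z ^+ 2.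
Proof. by rewrite !normc_sqr; case: z => x y /=; ring. Qed.

Variables (sigma eps s : R) (chi : 'rV[R]_n -> R).
Hypothesis s01 : 0 <= sigma < 1.
Hypothesis del4 : forall xi, enorm xi <= eps -> del sigma xi <= 1 / 4.
Hypothesis chiP : cutoff eps chi.
Variables (u0h u1h theta0h : 'rV[R]_n -> C) (w wt : R -> 'rV[R]_n -> 'cV[C]_3).
Let w0 := plate_init u0h u1h theta0h.
Hypothesis sw : solves (plate_symbol sigma) w0 w.
Hypothesis swt : solves (ref_symbol sigma) (ref_init sigma w0) wt.
Variable t : R.
Hypothesis t0 : 0 <= t.

Definition plate_diff xi := w t xi - T0 R *m T1 sigma xi *m T1h sigma xi *m wt t xi.

(** The constant is 1320 = 2 * 660, the 2 coming from the data: the parallelogram identity for the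
    first two components of [plate_init] doubles the squares of both terms. *)
Lemma plate_diff_wgt xi i :
  normc ((enorm xi `^ s)%:C * ((chi xi)%:C *: plate_diff xi) i 0) ^+ 2 <=
  1320 * (plate_wgt sigma s eps t xi * normc (absp xi 2 * u0h xi) ^+ 2 +
          plate_wgt sigma s eps t xi * normc (u1h xi) ^+ 2 +
          plate_wgt sigma s eps t xi * normc (theta0h xi) ^+ 2).
Proof.
have [_ chi01 chi0 _] := chiP.
rewrite mxE ![in leLHS]normc_rM -!mulrDr /plate_wgt; case: ifP => [re|/negbT]; last first.
  by rewrite -ltNge => /chi0 ->; rewrite expr0n /= !mul0r !mulr0.
have := plate_pointwise s01 (del4 re) t0 sw swt.
rewrite plate_init_normc -/(plate_diff xi).
set a := normc _ ^+ 2; set b := normc (u1h _) ^+ 2; set c := normc _ ^+ 2.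
rewrite -[660 * _ * _]mulrA; set D := _ * expR _ => H.
have D0 : 0 <= D by rewrite mulr_ge0 ?sqr_ge0 ?expR_ge0.
have Ei : normc (plate_diff xi i 0) ^+ 2 <= \sum_j normc (plate_diff xi j 0) ^+ 2.
  by rewrite (bigD1 i)//= lerDl; apply: sumr_ge0 => j _; exact: sqr_ge0.
have c1 : chi xi ^+ 2 <= 1 by have /andP[c0 c1] := chi01 xi; rewrite exprn_ile1.
have q0 : 0 <= (enorm xi `^ s) ^+ 2 by exact: sqr_ge0.
move: q0; set q := _ ^+ 2 => q0; rewrite -[q * D * _]mulrA [leRHS]mulrCA ler_wpM2l//.
apply: le_trans (ler_piMl (sqr_ge0 _) c1) _; apply: le_trans Ei _; apply: le_trans H _.
rewrite -mulrA mulrCA [leRHS]mulrCA ler_wpM2l//; have : 0 <= c by exact: sqr_ge0.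
lra.
Qed.

Lemma measurable_plate_diffC i :
  Defs.measurableC (fun xi => absp xi 2 * u0h xi) -> Defs.measurableC u1h ->
  Defs.measurableC theta0h ->
  Defs.measurableC (fun xi => (enorm xi `^ s)%:C * ((chi xi)%:C *: plate_diff xi) i 0).
Proof.
move=> [mR0 mI0] [mR1 mI1] [mR2 mI2]; have [sm _ chi0 _] := chiP.
have mchi : measurable_fun setT chi by apply: measurable_continuous_rV; exact: (sm 0%N).
have mD : measurable [set xi : 'rV[R]_n | enorm xi <= eps].
  rewrite (_ : [set _ | _] = @enorm R n @^-1` `]-oo, eps]%classic).
    by rewrite -[X in measurable X]setTI; exact: measurable_enorm.
  by apply/seteqP; split => xi; rewrite /= in_itv.
have m0R : measurable_mx [set xi | enorm xi <= eps] (fun xi => map_mx (@complex.Re R) (w0 xi)).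
  move=> j k; apply: measurable_funTS; under eq_fun do rewrite !mxE.
  elim/ord3_ind: j => /=; [| |exact: mR2].
  - under eq_fun do rewrite raddfD; exact: measurable_funD.
  - under eq_fun do rewrite raddfB; exact: measurable_funB.
have m0I : measurable_mx [set xi | enorm xi <= eps] (fun xi => map_mx (@complex.Im R) (w0 xi)).
  move=> j k; apply: measurable_funTS; under eq_fun do rewrite !mxE.
  elim/ord3_ind: j => /=; [| |exact: mI2].
  - under eq_fun do rewrite raddfD; exact: measurable_funD.
  - under eq_fun do rewrite raddfB; exact: measurable_funB.
have [mdR mdI] := measurable_plate_diff s01 del4 t0 m0R m0I sw swt.
(* Measurability is known only on the ball; outside it the cutoff vanishes, so the function may be
   replaced there by 0. *)
have key (g : 'rV[R]_n -> R) : measurable_fun [set xi | enorm xi <= eps] g ->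
    measurable_fun setT (fun xi => enorm xi `^ s * (chi xi * g xi)).
  move=> mg; rewrite (_ : (fun _ => _) = (fun xi => enorm xi `^ s *
      (chi xi * if enorm xi <= eps then g xi else 0))).
    apply: measurable_funM; first exact: measurable_powR_enorm.
    apply: measurable_funM => //; apply: measurable_fun_if => //.
    - by apply: measurable_fun_ler => //; exact: measurable_enorm.
    - by rewrite setTI.
  apply/funext => xi; case: ifPn => //; rewrite -ltNge => /chi0 ->.
  by rewrite !mul0r.
split.
  rewrite (_ : (fun _ => _) = (fun xi => enorm xi `^ s *
      (chi xi * map_mx (@complex.Re R) (plate_diff xi) i 0))).
    exact: (key _ (mdR i 0)).
  by apply/funext => xi; rewrite [in LHS]mxE [in RHS]mxE; case: (plate_diff xi i 0) => x y /=; ring.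
rewrite (_ : (fun _ => _) = (fun xi => enorm xi `^ s *
      (chi xi * map_mx (@complex.Im R) (plate_diff xi) i 0))).
  exact: (key _ (mdI i 0)).
by apply/funext => xi; rewrite [in LHS]mxE [in RHS]mxE; case: (plate_diff xi i 0) => x y /=; ring.
Qed.

End plate_estimate.

Unset Implicit Arguments.
Theorem theorem5p1 (R : realType) (n : nat) (sigma : R)
  (hn : (1 <= n)%N) (hsigma : 0 <= sigma < 1) :
  exists eps0 : R, 0 < eps0 /\
  forall (eps : R) (chi : 'rV[R]_n -> R),
    0 < eps <= eps0 -> cutoff eps chi ->
  forall (s m : R), 0 <= s -> 1 <= m <= 2 ->
  exists C : R, 0 < C /\
  forall (D2u0 u1 theta0 : 'rV[R]_n -> R[i])
         (u0h u1h theta0h : 'rV[R]_n -> R[i])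
         (w wt : R -> 'rV[R]_n -> 'cV[R[i]]_3),
    memLp m%:E D2u0 -> memLp m%:E u1 -> memLp m%:E theta0 ->
    has_fourier m D2u0 (fun xi => absp xi 2 * u0h xi) ->
    has_fourier m u1 u1h ->
    has_fourier m theta0 theta0h ->
    solves (plate_symbol sigma) (plate_init u0h u1h theta0h) w ->
    solves (ref_symbol sigma)
           (ref_init sigma (plate_init u0h u1h theta0h)) wt ->
  forall t : R, 0 <= t ->
    (\sum_(i < 3) Hdot_norm_ifourier s (fun xi => ((chi xi)%:C *:
       (w t xi - T0 R *m T1 sigma xi *m T1h sigma xi *m wt t xi)) i 0)%R
     <= (C * (1 + t) `^ (- (((2 - m) * n%:R + 2 * m * s)
                              / (4 * m * (2 - sigma)))
                         - (1 - sigma) / (2 - sigma)))%R%:E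
        * (LnormC m%:E D2u0 + LnormC m%:E u1 + LnormC m%:E theta0))%E.
Proof.
have /andP[sg0 sg1] := hsigma; have p0 : 0 < 2 - 2 * sigma by lra.
(* The radius at which del = r^(2 - 2 sigma) reaches 1/4. *)
exists ((1 / 4) `^ (2 - 2 * sigma)^-1); split; first exact: powR_gt0.
move=> eps chi /andP[eps0 epsle] chiP s m s0 m12; have /andP[m1 _] := m12.
have eps1 : eps <= 1.
  apply: le_trans epsle _.
  have := @ge0_ler_powR R (2 - 2 * sigma)^-1 _ (1 / 4) 1; rewrite !nnegrE powR1.
  by apply => //; rewrite ?invr_ge0 ?(ltW p0)//; lra.
have del4 (xi : 'rV[R]_n) : enorm xi <= eps -> del sigma xi <= 1 / 4.
  move=> xe; rewrite -[leRHS](@powRr1 R)// -[X in _ `^ X](mulVf (lt0r_neq0 p0)) powRrM.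
  apply: ge0_ler_powR; rewrite ?nnegrE ?powR_ge0 ?enorm_ge0 ?(ltW p0)//.
  exact: le_trans xe epsle.
have [K [K0 KP]] := plate_wgt_bounds n hsigma s0 m1 eps1.
have [q q0 qE] : exists2 q : R, 0 <= q & q = 1320.
  exists 1320; [exact: ler0n|reflexivity].
have [L L0 LE] : exists2 L, 0 <= L & L = q * (2 * fourier_const R n * K).
  by eexists; last reflexivity; rewrite mulr_ge0// mulr_ge0// mulr_ge0// fourier_const_ge0.
pose A := Num.sqrt (ifourier_const R n) * Num.sqrt L.
have A0 : 0 <= A by rewrite mulr_ge0 ?sqrtr_ge0.
(* One [A] for each component of the difference; the 1 only ensures positivity. *)
exists (3 * A + 1); split; first by rewrite ltr_wpDl// mulr_ge0.
move=> D2u0 u1 theta0 u0h u1h theta0h w wt l0 l1 l2 f0 f1 f2 sw swt t t0.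
rewrite -/(rate n sigma s m); set P := (1 + t) `^ rate n sigma s m.
have P0 : 0 <= P by exact: powR_ge0.
have [B [V [V0 WB intW BV]]] := KP t t0.
have WB' (xi : 'rV[R]_n) : 0 <= plate_wgt sigma s eps t xi <= B by rewrite plate_wgt_ge0 WB.
have data f F : memLp m%:E f -> has_fourier m f F ->
    (\int[lebesgue_rV R n]_xi (plate_wgt sigma s eps t xi * ComplexField.Normc.normc (F xi) ^+ 2)%:E <=
     (2 * fourier_const R n * K * (P * fine (LnormC m%:E f)) ^+ 2)%:E)%E.
  move=> lf hf; have mW := @measurable_plate_wgt R n sigma s eps t.
  have h := weighted_fourier mW WB' V0 intW m12 lf hf; apply: le_trans h _.
  by rewrite BV lee_fin le_eqVlt; apply/orP; left; apply/eqP; rewrite -/P; ring.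
have fin (f : 'rV[R]_n -> R[i]) : memLp m%:E f ->
    LnormC m%:E f = (fine (LnormC m%:E f))%:E /\ 0 <= fine (LnormC m%:E f).
  move=> [_ foo]; have n0 : (0 <= LnormC m%:E f)%E by exact: Lnorm_ge0.
  by rewrite fineK ?ge0_fin_numE// fine_ge0.
have [e0 a0] := fin _ l0; have [e1 a1] := fin _ l1; have [e2 a2] := fin _ l2.
have := data _ _ l0 f0; have := data _ _ l1 f1; have := data _ _ l2 f2.
rewrite e0 e1 e2 /=.
set a := fine (LnormC _ D2u0) in a0 *.
set b := fine (LnormC _ u1) in a1 *.
set c := fine (LnormC _ theta0) in a2 *.
move=> d2 d1 d0.
have S0 : 0 <= a + b + c by rewrite !addr_ge0.
have Gi (i : 'I_3) : (Hdot_norm_ifourier s (fun xi => ((chi xi)%:C *: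
       (w t xi - T0 R *m T1 sigma xi *m T1h sigma xi *m wt t xi)) i 0)%R <=
    (A * (P * (a + b + c)))%:E)%E.
  have m0 : Defs.measurableC (fun xi => absp xi 2 * u0h xi) by case: f0.
  have mu1 : Defs.measurableC u1h by case: f1.
  have mth : Defs.measurableC theta0h by case: f2.
  have [_ _ chi0 _] := chiP.
  rewrite /A -mulrA; apply: LnormC2_ifourier_le.
  - exact: (measurable_plate_diffC s hsigma del4 chiP sw swt t0 i m0 mu1 mth).
  - by move=> xi x1; rewrite chi0 ?scale0r ?mxE ?mulr0// (le_lt_trans eps1).
  - by rewrite mulr_ge0 ?sqrtr_ge0// mulr_ge0.
  have mW F : Defs.measurableC F -> measurable_fun [set: 'rV[R]_n]
      (fun xi => (plate_wgt sigma s eps t xi * ComplexField.Normc.normc (F xi) ^+ 2)%:E).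
    move=> mF; apply/measurable_EFinP; apply: measurable_funM; first exact: measurable_plate_wgt.
    by apply: measurable_funX; exact: measurable_normc.
  have W0 (F : 'rV[R]_n -> R[i]) (xi : 'rV[R]_n) :
      (0 <= (plate_wgt sigma s eps t xi * ComplexField.Normc.normc (F xi) ^+ 2)%:E)%E.
    by rewrite lee_fin mulr_ge0 ?sqr_ge0 ?plate_wgt_ge0.
  pose H xi :=
    ((plate_wgt sigma s eps t xi * ComplexField.Normc.normc (absp xi 2 * u0h xi) ^+ 2)%:E +
    (plate_wgt sigma s eps t xi * ComplexField.Normc.normc (u1h xi) ^+ 2)%:E +
    (plate_wgt sigma s eps t xi * ComplexField.Normc.normc (theta0h xi) ^+ 2)%:E)%E.
  have mH : measurable_fun setT H.
    by apply: emeasurable_funD; [apply: emeasurable_funD|]; exact: mW.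
  have Wu := W0 (fun xi => absp xi 2 * u0h xi).
  have H0 xi : (0 <= H xi)%E by exact: adde_ge0 (adde_ge0 (Wu _) (W0 _ _)) (W0 _ _).
  apply: (@le_trans _ _ (\int[lebesgue_rV R n]_xi (q%:E * H xi))%E).
    apply: ge0_le_integral => //.
    - by move=> xi _; rewrite lee_fin sqr_ge0.
    - apply/measurable_EFinP; apply: measurable_funX; apply: measurable_normc.
      exact: (measurable_plate_diffC s hsigma del4 chiP sw swt t0 i m0 mu1 mth).
    - exact: measurable_funeM.
    - move=> xi _; rewrite /H -!EFinD -EFinM lee_fin qE.
      exact: (plate_diff_wgt s hsigma del4 chiP sw swt t0 xi i).
  rewrite ge0_integralZl_EFin// ge0_integralD//=; first last.
  - exact: mW.
  - by apply: emeasurable_funD; exact: mW.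
  - by move=> xi _; exact: adde_ge0 (Wu _) (W0 _ _).
  rewrite ge0_integralD//=; [|exact: mW|exact: mW].
  apply: (@le_trans _ _ (q%:E * (((2 * fourier_const R n * K * (P * a) ^+ 2)%:E +
    (2 * fourier_const R n * K * (P * b) ^+ 2)%:E) + (2 * fourier_const R n * K * (P * c) ^+ 2)%:E))%E).
    by apply: lee_wpmul2l => //; apply: leeD => //; apply: leeD.
  rewrite -!EFinD -EFinM lee_fin [in leRHS]exprMn sqr_sqrtr//.
  have -> : q * (2 * fourier_const R n * K * (P * a) ^+ 2 + 2 * fourier_const R n * K * (P * b) ^+ 2 +
      2 * fourier_const R n * K * (P * c) ^+ 2) = L * (P ^+ 2 * (a ^+ 2 + b ^+ 2 + c ^+ 2)).
    by rewrite LE; ring.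
  rewrite ler_wpM2l// [in leRHS]exprMn ler_wpM2l ?sqr_ge0//.
  (* The squares of the three norms are at most the square of their sum, as the mixed products are
     nonnegative. *)
  have := mulr_ge0 a0 a1; have := mulr_ge0 a0 a2; have := mulr_ge0 a1 a2; nra.
apply: le_trans (lee_sum _ (fun i _ => Gi i)) _.
rewrite sumEFin sumr_const card_ord -!EFinD -EFinM lee_fin -mulr_natl.
have : 0 <= P * (a + b + c) by exact: mulr_ge0.
by rewrite -[_ * P * _]mulrA; nra.
Qed.
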